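(* Let $K$ be a perfect field of characteristic $p>0$, let $C$ be a curve over $K$, and let $S,T$ be finite subsets of $C(\overline{K})$ such that $S$ is disjoint from the set of $\mathrm{Gal}(\overline{K}/K)$-conjugates of elements of $T$. Then there exists a finite morphism $\varphi\colon C\to\mathbb{P}^1$ defined over $K$ such that: (1) $\mathrm{Br}(\varphi)=\{\infty\}$; (2) $\varphi$ is ramified at every point in $S$; (3) $\infty\notin\varphi(T)$.
   Context: A curve over a field $K$ means a smooth, projective, geometrically irreducible algebraic curve over $K$. $\overline{K}$ is an algebraic closure of $K$. Curves come equipped with a fixed embedding into projective space over $K$, and $\mathrm{Gal}(\overline{K}/K)$ acts coordinatewise on $C(\overline{K})$. For a finite morphism $\varphi\colon C\to\mathbb{P}^1$, $\mathrm{Br}(\varphi)\subseteq\mathbb{P}^1(\overline{K})$ denotes the branch locus of $\varphi$, i.e. the set of images $\varphi(P)$ of the points $P\in C(\overline{K})$ at which $\varphi$ is ramified (ramification index greater than $1$). *)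

(* Defs.v *)
From HB Require Import structures.
From mathcomp Require Import all_boot all_order all_algebra all_field.
From mathcomp Require Import finmap mpoly.

Set Implicit Arguments.
Unset Strict Implicit.
Unset Printing Implicit Defensive.

Import GRing.Theory.
Local Open Scope ring_scope.

Definition perfect_field (K : fieldType) : Prop :=
  forall f : {poly K}, irreducible_poly f -> separable_poly f.

Definition algebraic_closure (K : fieldType) (L : closedFieldType)
    (iota : {rmorphism K -> L}) : Prop :=
  forall x : L, algebraicOver iota x.

(* Points of P^n over L are the lines of L^(n+1), so [v] is <[v]>%VS and an
   equation val P = <[v]>%VS forces v != 0.  *)
Definition proj (L : fieldType) (n : nat) :=
  {U : {vspace 'rV[L]_n.+1} | \dim U == 1%N}.

Definition coords (L : fieldType) n (P : proj L n) : 'rV[L]_n.+1 :=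
  vpick (val P).

(* This depends on the representative coords P; it is only applied to
   homogeneous polynomials, to test vanishing, to form quotients of equal
   degree, or to form tuples of equal degree up to scaling.  *)
Definition eval_at (L : fieldType) n (f : {mpoly L[n.+1]}) (P : proj L n) : L :=
  f.@[coords P ord0].

Lemma infty_subproof (L : fieldType) :
  \dim <[delta_mx ord0 ord0 : 'rV[L]_2]>%VS == 1%N.
Proof.
rewrite dim_vline eqb1; apply/eqP => /matrixP /(_ ord0 ord0) /eqP.
by rewrite !mxE !eqxx oner_eq0.
Qed.

(* [1 : 0]; the affine coordinate on P^1 is x0 / x1.  *)
Definition infty (L : fieldType) : proj L 1 := 
  exist (fun U : {vspace 'rV[L]_2} => is_true (\dim U == 1%N)) _ (infty_subproof L).

Section Zariski.
Variables (L : fieldType) (n : nat).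
Implicit Types (X Y Z U : proj L n -> Prop) (P Q : proj L n).

Definition zariski_closed X : Prop :=
  exists I : {mpoly L[n.+1]} -> Prop,
    (forall f, I f -> f \is homog mdeg) /\
    (forall P, X P <-> forall f, I f -> eval_at f P = 0).

Definition zariski_open X : Prop := zariski_closed (fun P => ~ X P).

Definition near_in X P (A : proj L n -> Prop) : Prop :=
  exists U, [/\ zariski_open U, U P & forall Q, X Q -> U Q -> A Q].

Definition irreducible X : Prop :=
  (exists P, X P) /\
  forall Y Z, zariski_closed Y -> zariski_closed Z ->
    (forall P, X P -> Y P \/ Z P) ->
    (forall P, X P -> Y P) \/ (forall P, X P -> Z P).

Definition irreducible_chain X (m : nat) : Prop :=
  exists Z : nat -> proj L n -> Prop,
    (forall i, (i <= m)%N ->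
       [/\ zariski_closed (Z i), irreducible (Z i) & forall P, Z i P -> X P]) /\
    (forall i, (i < m)%N ->
       (forall P, Z i P -> Z i.+1 P) /\ exists P, Z i.+1 P /\ ~ Z i P).

Definition has_dim X (d : nat) : Prop :=
  irreducible_chain X d /\ forall m, irreducible_chain X m -> (m <= d)%N.

Definition regular_at X P (f : proj L n -> L) : Prop :=
  exists d (g h : {mpoly L[n.+1]}),
    [/\ g \is d.-homog, h \is d.-homog &
        near_in X P (fun Q =>
          eval_at h Q != 0 /\ f Q = eval_at g Q / eval_at h Q)].

Definition regular_fun X (f : proj L n -> L) : Prop :=
  forall P, X P -> regular_at X P f.

(* A generator of the maximal ideal of the local ring of X at P.  Germs are
   represented by total functions, compared near P.  *)
Definition uniformizer X P (t : proj L n -> L) : Prop :=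
  [/\ regular_at X P t, t P = 0 &
      forall f, regular_at X P f -> f P = 0 ->
        exists2 g, regular_at X P g & near_in X P (fun Q => f Q = g Q * t Q)].

Definition has_ord X P (f : proj L n -> L) (e : nat) : Prop :=
  exists t u, [/\ uniformizer X P t, regular_at X P u, u P != 0 &
    near_in X P (fun Q => f Q = u Q * t Q ^+ e)].

End Zariski.

Definition projT (L : fieldType) n : proj L n -> Prop := fun=> True.

(* Morphisms X -> Y given locally by tuples of homogeneous polynomials of equal
   degree with coefficients in k, where iota embeds k in L.  Values of phi
   outside X are irrelevant.  *)
Definition regular_map (k L : fieldType) (iota : {rmorphism k -> L}) (n m : nat)
    (X : proj L n -> Prop) (Y : proj L m -> Prop) (phi : proj L n -> proj L m)
    : Prop :=
  forall P, X P -> Y (phi P) /\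
    exists d (f : 'I_m.+1 -> {mpoly k[n.+1]}),
      (forall i, f i \is d.-homog) /\
      near_in X P (fun Q =>
        val (phi Q) = <[\row_i eval_at (map_mpoly iota (f i)) Q]>%VS).

Definition isomorphic (L : fieldType) (n m : nat)
    (X : proj L n -> Prop) (Y : proj L m -> Prop) : Prop :=
  exists (phi : proj L n -> proj L m) (psi : proj L m -> proj L n),
    [/\ regular_map idfun X Y phi, regular_map idfun Y X psi,
        forall P, X P -> psi (phi P) = P & forall Q, Y Q -> phi (psi Q) = Q].

(* Isomorphic to a closed subset of A^m = {x0 != 0} in P^m.  *)
Definition affine (L : fieldType) n (X : proj L n -> Prop) : Prop :=
  exists m (Z : proj L m -> Prop), zariski_closed Z /\
    isomorphic X (fun Q => Z Q /\ coords Q ord0 ord0 != 0).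

(* The ring of regular functions on W is a finitely generated module, via phi,
   over the ring of regular functions on V.  *)
Definition finite_over (L : fieldType) (n m : nat)
    (W : proj L n -> Prop) (V : proj L m -> Prop) (phi : proj L n -> proj L m)
    : Prop :=
  exists r (b : 'I_r -> proj L n -> L), (forall i, regular_fun W (b i)) /\
    forall f, regular_fun W f ->
      exists a : 'I_r -> proj L m -> L, (forall i, regular_fun V (a i)) /\
        forall P, W P -> f P = \sum_i a i (phi P) * b i P.

(* Finiteness is tested over L, which is harmless since it descends along the
   extension L / k.  *)
Definition finite_morphism (k L : fieldType) (iota : {rmorphism k -> L})
    (n m : nat) (X : proj L n -> Prop) (Y : proj L m -> Prop)
    (phi : proj L n -> proj L m) : Prop :=
  regular_map iota X Y phi /\
  forall Q, Y Q -> exists U : proj L m -> Prop,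
    let V := fun R => Y R /\ U R in
    let W := fun P => X P /\ U (phi P) in
    [/\ zariski_open U, U Q, affine V, affine W & finite_over W V phi].

Definition ram_index (L : fieldType) n (X : proj L n -> Prop)
    (phi : proj L n -> proj L 1) (P : proj L n) (e : nat) : Prop :=
  exists2 t, uniformizer (@projT L 1) (phi P) t & has_ord X P (t \o phi) e.

Definition ramified (L : fieldType) n (X : proj L n -> Prop)
    (phi : proj L n -> proj L 1) (P : proj L n) : Prop :=
  exists2 e, ram_index X phi P e & (1 < e)%N.

Definition branch (L : fieldType) n (X : proj L n -> Prop)
    (phi : proj L n -> proj L 1) (Q : proj L 1) : Prop :=
  exists P, [/\ X P, ramified X phi P & phi P = Q].

Section Curve.
Variables (K : fieldType) (L : closedFieldType) (iota : {rmorphism K -> L}).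
Variable n : nat.

(* The L-points of the subscheme of P^n over K cut out by F.  *)
Definition points (F : seq {mpoly K[n.+1]}) : proj L n -> Prop :=
  fun P => forall f, f \in F -> eval_at (map_mpoly iota f) P = 0.

Definition jacobian (F : seq {mpoly K[n.+1]}) (P : proj L n)
    : 'M[L]_(size F, n.+1) :=
  \matrix_(i < size F, j < n.+1) eval_at (map_mpoly iota (F`_i)^`M(j)) P.

(* For L an algebraic closure of K: the scheme cut out by F is geometrically
   irreducible of dimension 1, and smooth by the Jacobian criterion (rank n - 1
   at every geometric point, in homogeneous coordinates); smoothness forces the
   scheme to be reduced.  *)
Definition curve (F : seq {mpoly K[n.+1]}) : Prop :=
  [/\ forall f, f \in F -> f \is homog mdeg,
      irreducible (points F), has_dim (points F) 1 &
      forall P, points F P -> (\rank (jacobian F P) + 1 = n)%N].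

Definition galois_aut (sigma : {rmorphism L -> L}) : Prop :=
  bijective sigma /\ forall x, sigma (iota x) = iota x.

Definition conjugate (P Q : proj L n) : Prop :=
  exists2 sigma : {rmorphism L -> L}, galois_aut sigma &
    val Q = <[map_mx sigma (coords P)]>%VS.

End Curve.

(* Main.v *)
Require Import Defs.
From HB Require Import structures.
From mathcomp Require Import all_boot all_order all_algebra all_field.
From mathcomp Require Import boolp.
From mathcomp Require classical_sets.
From mathcomp Require Import ring zify.
From mathcomp Require Import finmap mpoly.

(** In characteristic [p] adding a [p]-th power to a function does not change its
    differential.  Take a function f on the curve, regular at the points of [T] and
    with nonzero differential there, and a function g with poles of large order at
    the points of [S], at the poles of f and at the zeros of df, but regular at [T].
    Then f + g ^ p has nonzero differential wherever it is finite, while its poles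
    have order divisible by [p]: it is a map to the line branched exactly over
    infinity, ramified at [S] and finite at [T].

    In terms of forms over [K] the map is [A * C ^ p + a ^ (2 p) : C ^ (2 p)], with
    f = A / C ^ p and g = (a / C) ^ 2.  The zeros of [C] contain [S] and the points
    where the differential of [A] vanishes along the curve, but no point of [T], and
    [a] has no zero in common with [C] on the curve ([construct_forms]).  Such forms
    exist by prime avoidance ([avoidance]) as soon as for all P in [S] and Q in [T]
    some form over [K] vanishes at P and not at Q.  Otherwise the residue fields of
    P and Q would be isomorphic over [K], and extending the isomorphism to [L] would
    make P a conjugate of Q ([conjugate_of_ideals]).

    Being unramified or ramified is read off from the Jacobian matrix: a form [q]
    through a point P, transversal to the tangent line, generates the maximal ideal
    of the local ring at P ([generates_transversal]).  If the map pulls a coordinate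
    back to such a generator it is unramified ([line_map_unramified]); and since
    every form not vanishing on the curve has finite order at P ([finite_order]),
    the order of a zero of [C ^ (2 p)] is a proper multiple of that of [C]
    ([line_map_ramified]).  Finite order, and the finiteness of proper closed
    subsets of the curve, come from Hilbert's basis theorem.

    The map is finite because its two components have no common zero on the curve:
    by the projective Nullstellensatz they generate all forms of large degree
    ([forms_generated]), and functions regular off the zeros of one component are
    quotients of forms by its powers ([regular_on_complement]). *)

Set Implicit Arguments.
Unset Strict Implicit.
Unset Printing Implicit Defensive.

Import GRing.Theory.
Local Open Scope ring_scope.

(** * Homogeneous polynomials *)

Section Homogeneous.
Variables (R : comNzRingType) (n : nat).
Implicit Types (f : {mpoly R[n]}) (v : 'I_n -> R).

Lemma meval_scale d f c v :
  f \is d.-homog -> f.@[fun i => c * v i] = c ^+ d * f.@[v].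
Proof.
move/dhomogP => fd; rewrite !mevalE mulr_sumr; apply: eq_big_seq => m /fd md.
rewrite mulrCA; congr (_ * _).
under eq_bigr do rewrite exprMn.
by rewrite big_split /= prodrXr -mdegE md.
Qed.

Lemma dhomog_bigprod (I : Type) (r : seq I) (P : pred I) (d : I -> nat)
    (g : I -> {mpoly R[n]}) :
  (forall i, P i -> g i \is (d i).-homog) ->
  \prod_(i <- r | P i) g i \is (\sum_(i <- r | P i) d i)%N.-homog.
Proof.
move=> gd; elim/big_rec2: _ => [|i e h Pi]; first exact: dhomog1.
by apply: dhomogM; apply: gd.
Qed.

Lemma dhomog_mderiv d f i : f \is d.-homog -> f^`M(i) \is d.-1.-homog.
Proof.
move/dhomogP => fd; apply/dhomogP => m; rewrite mcoeff_msupp mcoeff_deriv => c0.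
have /fd : (m + U_(i))%MM \in msupp f.
  by rewrite mcoeff_msupp; apply: contraNneq c0 => ->; rewrite mul0rn.
by rewrite /= mdegD mdeg1 addn1 => <-.
Qed.

Lemma euler d f : f \is d.-homog -> \sum_i 'X_i * f^`M(i) = d%:R *: f.
Proof.
move/dhomogP => fd; rewrite {1 2}[f]mpolyE scaler_sumr.
under eq_bigr do rewrite raddf_sum mulr_sumr.
rewrite exchange_big /=; apply: eq_big_seq => m /fd md.
under eq_bigr => i _ do rewrite mderivZ mderivX scalerA -scalerAr.
rewrite -[X in (X%:R *: _)]md /= mdegE natr_sum scaler_suml; apply: eq_bigr => i _.
have [mi0|mi0] := eqVneq (m i) 0%N; first by rewrite mi0 mulr0 !scale0r.
rewrite scalerA [in RHS]mulrC -mpolyXD addmC submK ?lep1mP //.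
Qed.

Lemma dhomog_mpolyC (c : R) : c%:MP_[n] \is 0.-homog.
Proof. by rewrite -[c%:MP]mulr1 mul_mpolyC rpredZ ?dhomog1. Qed.

Lemma dhomogXU (i : 'I_n) : ('X_i : {mpoly R[n]}) \is 1.-homog.
Proof. by rewrite dhomogX /= mdeg1. Qed.

Lemma mderivXU (i k : 'I_n) : ('X_i : {mpoly R[n]})^`M(k) = (i == k)%:R.
Proof.
rewrite mderivX mnm1E; case: eqP => [->|_]; last by rewrite scale0r.
have -> : (U_(k) - U_(k) = 0)%MM by apply/mnmP => j; rewrite mnmBE subnn mnm0E.
by rewrite scale1r mpolyX0.
Qed.

End Homogeneous.

Lemma dhomog_comp (R : comNzRingType) n k d e (f : {mpoly R[n]})
    (lq : n.-tuple {mpoly R[k]}) :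
  f \is d.-homog -> (forall i, tnth lq i \is e.-homog) ->
  f \mPo lq \is (d * e).-homog.
Proof.
move/dhomogP => fd lqe; rewrite comp_mpolyEX big_seq_cond.
apply: rpred_sum => m /andP[/fd md _]; apply: rpredZ; rewrite comp_mpolyX.
have -> : (d * e = \sum_(i < n) e * m i)%N.
  by rewrite -big_distrr /= -mdegE -md mulnC.
by apply: dhomog_bigprod => i _; apply: dhomogMn.
Qed.

Lemma mevalX_exp (R : comNzRingType) n (f : {mpoly R[n]}) v k :
  (f ^+ k).@[v] = f.@[v] ^+ k.
Proof. by rewrite (rmorphXn (meval v)). Qed.

Section MapMpoly.
Variables (R S : comNzRingType) (h : {rmorphism R -> S}) (n : nat).
Implicit Types (f : {mpoly R[n]}).

Lemma dhomog_map d f : f \is d.-homog -> map_mpoly h f \is d.-homog.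
Proof.
move/dhomogP => fd; apply/dhomogP => m; rewrite mcoeff_msupp mcoeff_map_mpoly.
by move=> c0; apply: fd; rewrite mcoeff_msupp; apply: contraNneq c0 => ->; rewrite raddf0.
Qed.

Lemma map_mderiv f i : map_mpoly h f^`M(i) = (map_mpoly h f)^`M(i).
Proof.
by apply/mpolyP => m; rewrite mcoeff_map_mpoly !mcoeff_deriv mcoeff_map_mpoly raddfMn.
Qed.

Lemma map_mpolyXU i : map_mpoly h ('X_i : {mpoly R[n]}) = 'X_i.
Proof. exact: map_mpolyX. Qed.

End MapMpoly.

Lemma meval_map (S1 S2 : comNzRingType) (s : {rmorphism S1 -> S2}) n
    (f : {mpoly S1[n]}) v :
  (map_mpoly s f).@[fun i => s (v i)] = s f.@[v].
Proof.
elim/mpolyind: f => [|c m p _ _ IH]; first by rewrite !raddf0.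
rewrite raddfD /= !mevalD IH rmorphD; congr (_ + _).
rewrite map_mpolyZ !mevalZ rmorphM; congr (_ * _).
by rewrite map_mpolyX !mevalX rmorph_prod; apply: eq_bigr => i _; rewrite rmorphXn.
Qed.

(** * Points of projective space *)

Section Points.
Variables (L : fieldType) (n : nat).
Implicit Types (P Q : proj L n) (f g : {mpoly L[n.+1]}) (v : 'rV[L]_n.+1).

Lemma coords_neq0 P : coords P != 0.
Proof. by rewrite vpick0 -dimv_eq0 (eqP (valP P)). Qed.

Lemma coordsK P : <[coords P]>%VS = val P.
Proof.
apply/eqP; rewrite eqEdim -memvE memv_pick dim_vline coords_neq0.
by rewrite (eqP (valP P)).
Qed.

Lemma line_eq v (w : 'rV[L]_n.+1) : w != 0 -> <[v]>%VS = <[w]>%VS ->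
  exists2 c, c != 0 & w = c *: v.
Proof.
move=> w0 e; have: w \in <[v]>%VS by rewrite e memv_line.
case/vlineP => c wc; exists c => //.
by apply: contraNneq w0 => c0; rewrite wc c0 scale0r.
Qed.

Lemma mkpt_subproof v : v != 0 -> \dim <[v]>%VS == 1%N.
Proof. by rewrite dim_vline => ->. Qed.

Definition mkpt v (v0 : v != 0) : proj L n :=
  exist (fun U : {vspace 'rV[L]_n.+1} => is_true (\dim U == 1%N))
    <[v]>%VS (mkpt_subproof v0).

Lemma coords_line P v : v != 0 -> val P = <[v]>%VS ->
  exists2 c, c != 0 & coords P = c *: v.
Proof.
move=> v0 e; have [|c c0 ->] := @line_eq v (coords P) (coords_neq0 P).
  by rewrite coordsK e.
by exists c.
Qed.

Lemma eval_line P v : v != 0 -> val P = <[v]>%VS ->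
  exists2 c, c != 0 & forall d f, f \is d.-homog ->
    eval_at f P = c ^+ d * f.@[v ord0].
Proof.
move=> v0 /coords_line[] // c c0 e; exists c => // d f fd.
rewrite /eval_at e -(meval_scale _ _ fd); apply: meval_eq => i.
by rewrite mxE.
Qed.

Lemma eval_line_eq0 P v d f : v != 0 -> val P = <[v]>%VS ->
  f \is d.-homog -> (eval_at f P == 0) = (f.@[v ord0] == 0).
Proof.
move=> v0 /eval_line[] // c c0 e /e ->.
by rewrite mulf_eq0 expf_eq0 (negPf c0) andbF.
Qed.

Lemma coords_ex P : exists j, coords P ord0 j != 0.
Proof.
have /matrix0Pn[i [j]] := coords_neq0 P.
by rewrite ord1 => c0; exists j.
Qed.

Lemma eval_at0 P : eval_at 0 P = 0. Proof. exact: meval0. Qed.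
Lemma eval_at1 P : eval_at 1 P = 1. Proof. exact: meval1. Qed.
Lemma eval_atM f g P : eval_at (f * g) P = eval_at f P * eval_at g P.
Proof. exact: mevalM. Qed.
Lemma eval_atD f g P : eval_at (f + g) P = eval_at f P + eval_at g P.
Proof. exact: mevalD. Qed.
Lemma eval_atB f g P : eval_at (f - g) P = eval_at f P - eval_at g P.
Proof. exact: mevalB. Qed.
Lemma eval_atX f k P : eval_at (f ^+ k) P = eval_at f P ^+ k.
Proof. exact: mevalX_exp. Qed.
Lemma eval_atZ c f P : eval_at (c *: f) P = c * eval_at f P.
Proof. exact: mevalZ. Qed.
Lemma eval_atXU i P : eval_at 'X_i P = coords P ord0 i.
Proof. exact: mevalXU. Qed.
Lemma eval_at_sum (I : Type) (r : seq I) (p : pred I) (g : I -> {mpoly L[n.+1]}) P :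
  eval_at (\sum_(i <- r | p i) g i) P = \sum_(i <- r | p i) eval_at (g i) P.
Proof. exact: (raddf_sum (meval _)). Qed.
Lemma eval_at_prod (I : Type) (r : seq I) (p : pred I) (g : I -> {mpoly L[n.+1]}) P :
  eval_at (\prod_(i <- r | p i) g i) P = \prod_(i <- r | p i) eval_at (g i) P.
Proof. exact: (rmorph_prod (meval _)). Qed.

Lemma proj_eqP P Q :
  (forall i j, coords P ord0 i * coords Q ord0 j
             = coords P ord0 j * coords Q ord0 i) -> P = Q.
Proof.
move=> h; have [j Qj] := coords_ex Q; apply/val_inj; rewrite /= -!coordsK.
have e : coords P = (coords P ord0 j / coords Q ord0 j) *: coords Q.
  apply/rowP => i; rewrite !mxE.
  by apply: (mulIf Qj); rewrite h mulrAC divfK.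
have c0 : coords P ord0 j / coords Q ord0 j != 0.
  by apply: contraNneq (coords_neq0 P) => c0; rewrite e c0 scale0r.
apply/eqP; rewrite eqEdim -!memvE !dim_vline !coords_neq0 andbT.
by rewrite {1}e rpredZ // memv_line.
Qed.

End Points.

(** * The Zariski topology, in terms of basic open sets *)

Section Topology.
Variables (L : fieldType) (n : nat).
Implicit Types (X Y Z : proj L n -> Prop) (P Q : proj L n).
Implicit Types (f g h b : {mpoly L[n.+1]}).

Lemma near_basic X P (A : proj L n -> Prop) b d : b \is d.-homog ->
  eval_at b P != 0 -> (forall Q, X Q -> eval_at b Q != 0 -> A Q) ->
  near_in X P A.
Proof.
move=> bd bP bA; exists (fun Q => eval_at b Q != 0); split=> //.
exists (fun f => f = b); split=> [_ ->|Q]; first by apply: homogE bd.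
split=> [nb _ ->|h]; first by apply/eqP; apply: contrapT => /negP.
by rewrite (h b erefl) eqxx.
Qed.

Lemma near_basicP X P (A : proj L n -> Prop) : near_in X P A ->
  exists b d, [/\ b \is d.-homog, eval_at b P != 0 &
    forall Q, X Q -> eval_at b Q != 0 -> A Q].
Proof.
case=> U [[I [Ih IU]] UP UA].
have [b [Ib bP]] : exists b, I b /\ eval_at b P != 0.
  apply: contrapT => nb; have /IU : forall f, I f -> eval_at f P = 0.
    move=> f If; apply/eqP; apply: contrapT => /negP fP.
    by apply: nb; exists f.
  exact.
have /homogP[d bd] := Ih _ Ib.
exists b, d; split=> // Q XQ bQ; apply: UA => //.
by apply: contrapT => /IU /(_ b Ib) b0; rewrite b0 eqxx in bQ.
Qed.

Lemma near_self X P A : X P -> near_in X P A -> A P.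
Proof. by move=> XP /near_basicP[b [d [_ bP]]]; apply. Qed.

Lemma near_sub X P (A B : proj L n -> Prop) :
  (forall Q, X Q -> A Q -> B Q) -> near_in X P A -> near_in X P B.
Proof. by move=> AB [U [oU UP UA]]; exists U; split=> // Q XQ /UA; auto. Qed.

Lemma near_and X P (A B : proj L n -> Prop) :
  near_in X P A -> near_in X P B -> near_in X P (fun Q => A Q /\ B Q).
Proof.
move=> /near_basicP[b [d [bd bP bA]]] /near_basicP[c [e [ce cP cB]]].
apply: (near_basic (dhomogM bd ce)); first by rewrite eval_atM mulf_neq0.
by move=> Q XQ; rewrite eval_atM mulf_eq0 negb_or => /andP[/bA ? /cB]; auto.
Qed.

Lemma near_all X P (A : proj L n -> Prop) :
  (forall Q, X Q -> A Q) -> near_in X P A.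
Proof.
move=> h; apply: (near_basic (dhomog1 _ _)) => [|Q XQ _]; last exact: h.
by rewrite eval_at1 oner_neq0.
Qed.

Lemma closed_form f d : f \is d.-homog -> zariski_closed (fun Q => eval_at f Q = 0).
Proof.
move=> fd; exists (fun g => g = f); split=> [_ ->|Q]; first exact: homogE fd.
by split=> [h _ ->|] //; apply.
Qed.

Lemma closedI Y Z : zariski_closed Y -> zariski_closed Z ->
  zariski_closed (fun P => Y P /\ Z P).
Proof.
move=> [I [Ih IY]] [J [Jh JZ]]; exists (fun f => I f \/ J f).
split=> [f []|P]; [exact: Ih|exact: Jh|].
rewrite IY JZ; split=> [[h1 h2] f []|h]; [exact: h1|exact: h2|].
by split=> f ?; apply: h; [left|right].
Qed.

(** Proportionality to [coords P] is the vanishing of the 2x2 minors. *)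
Lemma closed1 P : zariski_closed (fun Q => Q = P).
Proof.
exists (fun f => exists i j, f = coords P ord0 i *: 'X_j - coords P ord0 j *: 'X_i).
split=> [_ [i [j ->]]|Q].
  by apply: (@homogE _ _ _ 1); rewrite rpredB ?rpredZ ?dhomogXU.
split=> [-> _ [i [j ->]]|h].
  by rewrite eval_atB !eval_atZ !eval_atXU mulrC subrr.
apply: esym; apply: proj_eqP => i j; apply/eqP; rewrite -subr_eq0.
have := h _ (ex_intro _ i (ex_intro _ j erefl)).
by rewrite eval_atB !eval_atZ !eval_atXU => ->.
Qed.

Lemma irreducible1 P : irreducible (fun Q => Q = P).
Proof.
split=> [|Y Z _ _ YZ]; first by exists P.
by have [YP|ZP] := YZ P erefl; [left|right] => _ ->.
Qed.

Section Irreducible.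
Variable X : proj L n -> Prop.
Hypothesis Xirr : irreducible X.

Lemma irr_mul d e f g : f \is d.-homog -> g \is e.-homog ->
  (forall P, X P -> eval_at f P * eval_at g P = 0) ->
  (forall P, X P -> eval_at f P = 0) \/ (forall P, X P -> eval_at g P = 0).
Proof.
move=> fd ge fg.
apply: (Xirr.2 _ _ (closed_form fd) (closed_form ge)) => P /fg /eqP.
by rewrite mulf_eq0 => /orP[] /eqP; [left|right].
Qed.

Lemma irr_cancel d e f g P : f \is d.-homog -> g \is e.-homog ->
  X P -> eval_at g P != 0 ->
  (forall P, X P -> eval_at f P * eval_at g P = 0) ->
  forall P, X P -> eval_at f P = 0.
Proof.
move=> fd ge XP gP fg; have [//|/(_ P XP) g0] := irr_mul fd ge fg.
by rewrite g0 eqxx in gP.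
Qed.

Lemma irr_near d f P : f \is d.-homog -> X P ->
  near_in X P (fun Q => eval_at f Q = 0) -> forall Q, X Q -> eval_at f Q = 0.
Proof.
move=> fd XP /near_basicP[b [e [be bP bf]]].
apply: (irr_cancel fd be XP bP) => Q XQ.
by have [->|/(bf Q XQ)->] := eqVneq (eval_at b Q) 0; rewrite ?mulr0 ?mul0r.
Qed.

End Irreducible.
End Topology.

Section RegularAt.
Variables (L : fieldType) (n : nat) (X : proj L n -> Prop) (P : proj L n).

Lemma regular_frac d g h : X P -> g \is d.-homog -> h \is d.-homog ->
  eval_at h P != 0 -> regular_at X P (fun Q => eval_at g Q / eval_at h Q).
Proof.
move=> XP gd hd hP; exists d, g, h; split=> //.
by apply: (near_basic hd).
Qed.

End RegularAt.

(** * Noetherianity *)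

Lemma nat_minimal (P : nat -> Prop) : (exists m, P m) ->
  exists2 m, P m & forall k, P k -> (m <= k)%N.
Proof.
move=> exP; have exb : exists m, `[< P m >] by case: exP => m /asboolP; exists m.
by case: (ex_minnP exb) => m /asboolP Pm h; exists m => // k /asboolP /h.
Qed.

Lemma nondecreasing_subseq (v : nat -> nat) :
  exists2 phi : nat -> nat, {homo phi : i j / (i < j)%N} &
    {homo v \o phi : i j / (i <= j)%N}.
Proof.
have h N : exists m, (N <= m)%N /\ forall k, (N <= k)%N -> (v m <= v k)%N.
  have [|m [k Nk <-] mk] := @nat_minimal (fun m => exists2 k, (N <= k)%N & v k = m).
    by exists (v N), N.
  by exists k; split=> // l Nl; apply: mk; exists l.
have [m hm] := choice h.
pose phi := fix phi i := if i is j.+1 then m (phi j).+1 else m 0%N.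
have phiS i : (phi i < phi i.+1)%N by have [] := hm (phi i).+1.
exists phi; first by move=> i j; apply: (homo_ltn ltn_trans phiS).
apply: homo_leq => //=; first exact: leq_trans.
case=> [|i]; first by apply: (hm 0%N).2.
by apply: (hm (phi i).+1).2; exact: (ltn_trans (phiS i) (phiS i.+1)).
Qed.

(** Dickson: extract subsequences nondecreasing in one exponent after another. *)
Lemma dickson n (u : nat -> 'X_{1..n}) :
  exists i j, (i < j)%N /\ (u i <= u j)%MM.
Proof.
have H k : (k <= n)%N ->
    exists2 phi : nat -> nat, {homo phi : i j / (i < j)%N} &
    forall l : 'I_n, (l < k)%N -> {homo (fun i => u (phi i) l) : i j / (i <= j)%N}.
  elim: k => [_|k IH kn]; first by exists id.
  have [phi hphi mono] := IH (ltnW kn).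
  have [psi hpsi mpsi] := nondecreasing_subseq (fun i => u (phi i) (Ordinal kn)).
  exists (phi \o psi) => [i j ij|l lk]; first by apply/hphi/hpsi.
  move: lk; rewrite ltnS leq_eqVlt => /orP[/eqP lk|lk] i j ij /=.
    have -> : l = Ordinal kn by apply: val_inj.
    exact: mpsi.
  apply: (mono l lk); move: ij; rewrite leq_eqVlt => /orP[/eqP->//|ij].
  by apply/ltnW/hpsi.
have [phi hphi mono] := H n (leqnn n).
exists (phi 0%N), (phi 1%N); split; first exact: hphi.
by apply/mnm_lepP => l; apply: mono.
Qed.

(** Hilbert's basis theorem.  Otherwise pick [f m] with least leading monomial in
    the ideal of [s 0, ..., s m] but not in that of [s 0, ..., s (m-1)]; by
    Dickson some [f i] could be used to lower the leading monomial of a later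
    [f j]. *)
Theorem hilbert_basis (L : fieldType) n (s : nat -> {mpoly L[n]}) :
  exists m (a : 'I_m -> {mpoly L[n]}), s m = \sum_(i < m) a i * s i.
Proof.
apply: contrapT => ns.
pose I m f := exists a : nat -> {mpoly L[n]}, f = \sum_(i < m) a i * s i.
have I0 m : I m 0.
  by exists (fun=> 0); rewrite big1 // => i _; rewrite mul0r.
have IB m f g h : I m f -> I m g -> I m (f - h * g).
  case=> a -> [b ->]; exists (fun i => a i - h * b i).
  rewrite mulr_sumr -sumrB; apply: eq_bigr => i _.
  by rewrite mulrBl mulrA.
have Isub m k f : (m <= k)%N -> I m f -> I k f.
  move=> mk [a ->]; exists (fun i => if (i < m)%N then a i else 0).
  rewrite (big_ord_widen k (fun i => a i * s i) mk) big_mkcond.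
  by apply: eq_bigr => i _; case: ifP; rewrite ?mul0r.
have Is m : I m.+1 (s m).
  exists (fun i => (i == m)%:R); rewrite big_ord_recr /= eqxx mul1r big1 ?add0r //.
  by move=> i _; rewrite ltn_eqF ?mul0r.
have nIs m : ~ I m (s m) by case=> a e; apply: ns; exists m, (fun i => a i).
have min m : exists f, [/\ I m.+1 f, ~ I m f &
    forall g, I m.+1 g -> ~ I m g -> ~ (mlead g < mlead f)%O].
  apply: contrapT => nf.
  have : forall u f, mlead f = u -> I m.+1 f -> I m f; last by move/(_ _ _ erefl (Is m))/nIs.
  apply: (well_founded_ind (ltom_wf (n := n))) => u IH f fu If.
  apply: contrapT => nIf; apply: nf; exists f; split=> // g Ig nIg gf.
  by apply: nIg; apply: (IH _ _ _ erefl Ig); rewrite -fu.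
have [f hf] := choice min.
have [i [j [ij lij]]] := dickson (fun m => mlead (f m)).
have [Ii nIi _] := hf i; have [Ij nIj minj] := hf j.
have fi0 : f i != 0 by apply/eqP => fi0; apply: nIi; rewrite fi0.
have fj0 : f j != 0 by apply/eqP => fj0; apply: nIj; rewrite fj0.
pose c := mleadc (f j) / mleadc (f i).
have c0 : c != 0 by rewrite mulf_neq0 ?invr_eq0 ?mleadc_eq0.
pose h : {mpoly L[n]} := c *: 'X_[mlead (f j) - mlead (f i)].
have X0 : 'X_[mlead (f j) - mlead (f i)] != 0 :> {mpoly L[n]}.
  by rewrite -msize_poly_eq0 msizeX.
have Iji : I j (f i) by apply: Isub Ii.
have nIg : ~ I j (f j - h * f i).
  by move=> Ig; apply: nIj; have := IB _ _ _ (- h) Ig Iji; rewrite mulNr opprK subrK.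
apply: (minj _ (IB _ _ _ _ Ij (Isub _ _ _ (leqnSn j) Iji)) nIg).
have h0 : h != 0 by rewrite scaler_eq0 negb_or c0.
have lead : mlead (h * f i) = mlead (f j).
  by rewrite mleadM // mleadZ // mleadXm submK.
rewrite Order.POrderTheory.lt_neqAle; apply/andP; split; last first.
  apply: (Order.POrderTheory.le_trans (mleadB_le _ _)).
  by rewrite lead Order.JoinTheory.joinxx.
apply: contra_notN nIg => /eqP e.
suff /eqP-> : f j - h * f i == 0 by [].
rewrite -mleadc_eq0 e mcoeffB.
have -> : (h * f i)@_(mlead (f j)) = mleadc (f j).
  rewrite -{1}lead mleadM // mleadcM mleadcZE mleadXm mcoeffX eqxx mulr1.
  by rewrite divfK ?mleadc_eq0.
by rewrite subrr.
Qed.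

Definition finite_pts L n (Y : proj L n -> Prop) :=
  exists r : seq (proj L n), forall P, Y P -> P \in r.

Lemma finite_ptsU L n (Y Z W : proj L n -> Prop) :
  (forall P, Y P -> Z P \/ W P) -> finite_pts Z -> finite_pts W -> finite_pts Y.
Proof.
move=> YZW [r rZ] [s sW]; exists (r ++ s) => P /YZW[/rZ|/sW] h;
  by rewrite mem_cat h ?orbT.
Qed.

Section Dimension1.
Variables (L : fieldType) (n : nat) (X : proj L n -> Prop).
Hypotheses (Xcl : zariski_closed X) (Xirr : irreducible X) (Xdim : has_dim X 1).

(** A strictly decreasing sequence of closed sets would give forms, the [i]-th
    vanishing on the later sets but not on its own, so that none is a combination
    of the previous ones; this contradicts the basis theorem. *)
Lemma closed_minimal (A : (proj L n -> Prop) -> Prop) Y :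
  zariski_closed Y -> A Y -> exists Z, [/\ zariski_closed Z, A Z,
    forall P, Z P -> Y P & forall W, zariski_closed W -> A W ->
      (forall P, W P -> Z P) -> forall P, Z P -> W P].
Proof.
move=> Ycl AY; apply: contrapT => nZ.
pose T := {Z | zariski_closed Z /\ A Z /\ forall P, Z P -> Y P}.
have step (Z : T) : exists W : T, (forall P, sval W P -> sval Z P) /\
    exists P, sval Z P /\ ~ sval W P.
  case: Z => Z [Zcl [AZ ZY]] /=; apply: contrapT => nW; apply: nZ; exists Z.
  split=> // W Wcl AW WZ P ZP; apply: contrapT => nWP; apply: nW.
  have hW : zariski_closed W /\ A W /\ forall P, W P -> Y P by split=> //; split=> // Q /WZ/ZY.
  by exists (exist _ W hW); split=> //=; exists P.
have [next hnext] := choice step.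
pose Z := fix Z i : T :=
  if i is j.+1 then next (Z j) else exist _ Y (conj Ycl (conj AY (fun _ h => h))).
have Zmono i j : (i <= j)%N -> forall P, sval (Z j) P -> sval (Z i) P.
  elim: j => [|j IH]; first by rewrite leqn0 => /eqP->.
  rewrite leq_eqVlt => /orP[/eqP->//|ij P ZP]; apply: IH => //.
  by apply: (hnext (Z j)).1.
have sep i : exists f, (forall P, sval (Z i.+1) P -> eval_at f P = 0) /\
    exists2 P, sval (Z i) P & eval_at f P != 0.
  have [P [ZP nWP]] := (hnext (Z i)).2.
  have [[I [Ih IZ]] _] := svalP (Z i.+1).
  have [f /not_implyP[If fP]] : exists f, ~ (I f -> eval_at f P = 0).
    by apply/existsNP => h; apply: nWP; apply/IZ.
  exists f; split=> [Q /IZ|]; first exact.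
  by exists P => //; apply/eqP.
have [f hf] := choice sep.
have [m [a e]] := hilbert_basis f.
have [_ [P ZP /eqP]] := hf m; apply.
rewrite e eval_at_sum big1 // => i _; rewrite eval_atM (hf i).1 ?mulr0 //.
by apply: Zmono ZP; apply: ltn_ord.
Qed.

Lemma curve_two_points : exists P Q, [/\ X P, X Q & P <> Q].
Proof.
have [[Z [h1 h2]] _] := Xdim.
have [_ [Q [ZQ nZQ]]] := h2 0%N isT.
have [_ [[P ZP] _] ZX] := h1 0%N isT.
exists P, Q; split; first exact: ZX.
  by have [_ _] := h1 1%N (leqnn _); apply.
by move=> e; apply: nZQ; rewrite -e.
Qed.

(** An infinite closed subset contains a minimal one; it is irreducible, hence
    would sit strictly between a point and the curve. *)
Lemma curve_proper_finite Y : zariski_closed Y -> (forall P, Y P -> X P) ->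
  (exists2 P, X P & ~ Y P) -> finite_pts Y.
Proof.
move=> Ycl YX [P0 XP0 nYP0]; apply: contrapT => nfin.
have [Z [Zcl Zinf ZY Zmin]] := @closed_minimal (fun Z => ~ finite_pts Z) Y Ycl nfin.
have [P ZP] : exists P, Z P.
  by apply: contrapT => nP; apply: Zinf; exists [::] => P ZP; case: nP; exists P.
have Zirr : irreducible Z.
  split=> [|V W Vcl Wcl ZVW]; first by exists P.
  have VZ : (forall P, Z P -> V P) \/ finite_pts (fun P => Z P /\ V P).
    apply: contrapT => /not_orP[nV nVf]; apply: nV => Q ZQ.
    by have [] := Zmin _ (closedI Zcl Vcl) nVf (fun _ h => h.1) Q ZQ.
  have WZ : (forall P, Z P -> W P) \/ finite_pts (fun P => Z P /\ W P).
    apply: contrapT => /not_orP[nV nVf]; apply: nV => Q ZQ.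
    by have [] := Zmin _ (closedI Zcl Wcl) nVf (fun _ h => h.1) Q ZQ.
  case: VZ => [|Vf]; first by left.
  case: WZ => [|Wf]; first by right.
  case: Zinf; apply: finite_ptsU Vf Wf => Q ZQ.
  by have [] := ZVW Q ZQ; [left|right].
have [Q [ZQ QP]] : exists Q, Z Q /\ Q <> P.
  apply: contrapT => nQ; apply: Zinf; exists [:: P] => Q ZQ; rewrite inE.
  by apply/eqP; apply: contrapT => QP; apply: nQ; exists Q.
suff /(Xdim.2) : irreducible_chain X 2 by [].
exists (fun i => if i is 0%N then (fun R => R = P) else if i is 1%N then Z else X).
split=> [[|[|[|i]]] // _|[|[|i]] // _]; split=> //.
- exact: closed1.
- exact: irreducible1.
- by move=> _ ->; apply/YX/ZY.
- by move=> R /ZY/YX.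
- by move=> _ ->.
- by exists Q.
- by move=> R /ZY/YX.
- by exists P0; split=> // /ZY.
Qed.

Lemma curve_zeros_finite d f : f \is d.-homog -> (exists2 P, X P & eval_at f P != 0) ->
  finite_pts (fun P => X P /\ eval_at f P = 0).
Proof.
move=> fd [P XP fP]; apply: curve_proper_finite => [|Q []//|].
  by apply: closedI => //; apply: closed_form fd.
by exists P => // -[_ f0]; rewrite f0 eqxx in fP.
Qed.

End Dimension1.

(** * Local structure at a smooth point *)

Lemma dhomog_det_rows (R : comNzRingType) n k (e : 'I_k -> nat)
    (A : 'M[{mpoly R[n]}]_k) :
  (forall i j, A i j \is (e i).-homog) -> \det A \is (\sum_i e i)%N.-homog.
Proof.
move=> Ae; rewrite /determinant; apply: rpred_sum => s _.
by rewrite rpredMsign; apply: dhomog_bigprod.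
Qed.

Lemma dhomog_det (R : comNzRingType) n k e (A : 'M[{mpoly R[n]}]_k) :
  (forall i j, A i j \is e.-homog) -> \det A \is (k * e).-homog.
Proof.
move=> Ae; have -> : (k * e = \sum_(i < k) e)%N by rewrite sum_nat_const card_ord.
exact: dhomog_det_rows.
Qed.

Lemma dhomog0_const (R : comNzRingType) n (h : {mpoly R[n]}) :
  h \is 0.-homog -> h = (h@_0)%:MP.
Proof.
move=> hd; apply/mpolyP => u; rewrite mcoeffC.
have [->|u0] := eqVneq u 0%MM; rewrite ?mulr1 ?mulr0 //.
by apply: (dhomog_nemf_coeff hd); rewrite /= mdeg_eq0.
Qed.

Lemma dhomog0_eq0 (L : fieldType) n (h : {mpoly L[n.+1]}) P :
  h \is 0.-homog -> eval_at h P = 0 -> h = 0.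
Proof. by move/dhomog0_const => hc; rewrite hc /eval_at mevalC => ->. Qed.

Lemma homog_pos (L : fieldType) n (h : {mpoly L[n.+1]}) P :
  h \is homog mdeg -> eval_at h P = 0 -> exists2 d, (0 < d)%N & h \is d.-homog.
Proof.
case/homogP => -[|d] hd hP; last by exists d.+1.
by exists 1%N; rewrite // (dhomog0_eq0 hd hP) rpred0.
Qed.

Section Hadamard.
Variables (L : fieldType) (n : nat) (v : 'I_n.+1 -> L) (j : 'I_n.+1).
Hypothesis vj : v j != 0.

(** For [k != j] a basis of the linear forms vanishing at [v]. *)
Definition lin_at k : {mpoly L[n.+1]} := v j *: 'X_k - v k *: 'X_j.

Lemma lin_atj : lin_at j = 0. Proof. exact: subrr. Qed.

Lemma lin_at_eval k : (lin_at k).@[v] = 0.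
Proof. by rewrite mevalB !mevalZ !mevalXU mulrC subrr. Qed.

Lemma dhomog_divX d (c : {mpoly L[n.+1]}) :
  c * 'X_j \is d.+1.-homog -> c \is d.-homog.
Proof.
move/dhomogP => h; apply/dhomogP => m cm; apply/eqP; rewrite -eqSS -(h (U_(j) + m)%MM).
  by rewrite /= mdegD mdeg1.
by rewrite mcoeff_msupp mcoeffMX -mcoeff_msupp.
Qed.

Lemma hadamard_aux d g : g \is d.-homog ->
  exists c : 'I_n.+1 -> {mpoly L[n.+1]}, (forall k, c k * 'X_j \is d.-homog) /\
    v j ^+ d *: g - g.@[v] *: 'X_j ^+ d = \sum_k c k * lin_at k.
Proof.
pose H d g := exists c : 'I_n.+1 -> {mpoly L[n.+1]}, (forall k, c k * 'X_j \is d.-homog) /\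
  v j ^+ d *: g - g.@[v] *: 'X_j ^+ d = \sum_k c k * lin_at k.
have HD e g1 g2 a : H e g1 -> H e g2 -> H e (a *: g1 + g2).
  case=> c1 [h1 e1] [c2 [h2 e2]]; exists (fun k => a *: c1 k + c2 k); split.
    by move=> k; rewrite mulrDl -scalerAl rpredD ?rpredZ.
  under eq_bigr do rewrite mulrDl -scalerAl.
  rewrite big_split -scaler_sumr -e1 -e2 /= mevalD mevalZ scalerDr scalerDl opprD.
  by rewrite scalerBr !scalerA mulrC addrACA.
have H0 e : H e 0.
  exists (fun=> 0); split=> [k|]; first by rewrite mul0r rpred0.
  by rewrite meval0 scaler0 scale0r subrr big1 // => k _; rewrite mul0r.
have HX m : H (mdeg m) 'X_[m].
  move: {2}(mdeg m) (erefl (mdeg m)) => e; elim: e m => [|e IH] m me.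
    move/eqP: (me); rewrite mdeg_eq0 => /eqP->; exists (fun=> 0).
    split=> [k|]; first by rewrite mul0r rpred0.
    rewrite mdeg0 !expr0 scale1r mpolyX0 meval1 scale1r subrr.
    by rewrite big1 // => k _; rewrite mul0r.
  have [i mi] : exists i, m i != 0%N.
    apply/existsP; apply: contra_eqT me; rewrite negb_exists => /forallP h.
    by rewrite mdegE big1 // => i _; apply/eqP/negPn.
  have [m' em] : exists m', m = (U_(i) + m')%MM.
    by exists (m - U_(i))%MM; rewrite addmC submK // lep1mP.
  have m'e : mdeg m' = e.
    by apply/eqP; rewrite -eqSS -me em mdegD mdeg1.
  have [c [ch ce]] := IH _ m'e; rewrite m'e in ch ce; rewrite me em mpolyXD.
  exists (fun k => v j *: ('X_i * c k) + (if k == i then 'X_[m'].@[v] *: 'X_j ^+ e else 0)).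
  split=> [k|].
    rewrite mulrDl rpredD //.
      by rewrite -scalerAl rpredZ // -mulrA; apply: dhomogM (dhomogXU _ _) (ch k).
    case: ifP; rewrite ?mul0r ?rpred0 // -scalerAl rpredZ // -exprSr.
    by have := dhomogMn e.+1 (dhomogXU L j); rewrite mul1n.
  under eq_bigr do rewrite mulrDl -scalerAl -mulrA.
  rewrite big_split /= -scaler_sumr -mulr_sumr -ce.
  rewrite (bigD1 i) //= eqxx big1 ?addr0; last by move=> k /negPf->; rewrite mul0r.
  rewrite mevalM mevalXU /lin_at !exprS -!mul_mpolyC !mpolyCM.
  by ring.
move/dhomogP => gd; rewrite -/(H d g) [g]mpolyE big_seq.
apply: (big_ind (H d)) => // [g1 g2 h1 h2|m /gd md].
  by have := HD _ _ _ 1 h1 h2; rewrite scale1r.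
have h := HX m; rewrite [mdeg m]md in h.
by have := HD _ _ _ g@_m h (H0 d); rewrite addr0.
Qed.

(** Differentiating the decomposition at [v] identifies the values of the
    coefficients there, up to the factor [v j], with the partial derivatives. *)
Lemma hadamard d g : g \is d.+1.-homog -> g.@[v] = 0 ->
  exists c : 'I_n.+1 -> {mpoly L[n.+1]}, [/\ forall k, c k \is d.-homog,
    g = \sum_k c k * lin_at k &
    forall k, k != j -> g^`M(k).@[v] = v j * (c k).@[v]].
Proof.
move=> gd g0; have [c [cd e]] := hadamard_aux gd.
have vd0 : v j ^+ d.+1 != 0 by rewrite expf_neq0.
pose c' k := (v j ^+ d.+1)^-1 *: c k.
have e' : g = \sum_k c' k * lin_at k.
  under eq_bigr do rewrite -scalerAl; rewrite -scaler_sumr -e g0 scale0r subr0.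
  by rewrite scalerA mulVf ?scale1r.
exists c'; split=> // [k|k kj].
  by rewrite rpredZ // dhomog_divX.
rewrite {1}e' (raddf_sum (mderiv k)) (raddf_sum (meval v)) (bigD1 k) //= big1 => [|l lk].
  rewrite mderivM mevalD !mevalM lin_at_eval mulr0 add0r addr0 mulrC; congr (_ * _).
  rewrite mderivB !mderivZ !mderivXU eqxx (negPf (_ : j != k)) 1?eq_sym //.
  by rewrite scaler0 subr0 mevalZ meval1 mulr1.
rewrite mderivM mevalD !mevalM lin_at_eval mulr0 add0r.
rewrite mderivB !mderivZ !mderivXU (negPf (_ : l != k)) //.
by rewrite (negPf (_ : j != k)) 1?eq_sym // !scaler0 subr0 meval0 mulr0.
Qed.

End Hadamard.

(** Nakayama's lemma by hand.  The forms [g i] are combinations of the linear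
    forms through [P]; having no common tangent direction at [P], they are so with
    a matrix of full rank at [P], which Cramer's rule inverts near [P]. *)
Lemma local_generators (L : fieldType) n m (g : 'I_m -> {mpoly L[n.+1]})
    (e : 'I_m -> nat) (P : proj L n) :
  (forall i, g i \is (e i).-homog) -> (forall i, (0 < e i)%N) ->
  (forall i, eval_at (g i) P = 0) ->
  (forall z : 'I_n.+1 -> L,
     (forall i, \sum_k z k * eval_at (g i)^`M(k) P = 0) ->
     exists c, forall k, z k = c * coords P ord0 k) ->
  exists N D, [/\ D \is N.-homog, eval_at D P != 0, forall i, (e i <= N)%N &
    forall d h, h \is d.-homog -> eval_at h P = 0 ->
      exists s : 'I_m -> {mpoly L[n.+1]},
        (forall i, s i \is (d + N - e i).-homog) /\ h * D = \sum_i s i * g i].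
Proof.
move=> ge e0 gP tan; have [j vj] := coords_ex P.
set v := coords P ord0 in vj.
have /choice[c hc] i : exists c : 'I_n.+1 -> {mpoly L[n.+1]},
    [/\ forall k, c k \is (e i).-1.-homog, g i = \sum_k c k * lin_at v j k &
    forall k, k != j -> (g i)^`M(k).@[v] = v j * (c k).@[v]].
  by apply: (hadamard vj); [rewrite prednK|exact: gP].
(* Rows are brought to the common degree [E] by powers of x_j. *)
pose E := (\sum_i e i)%N.
have leE i : (e i <= E)%N by rewrite /E (bigD1 i) //= leq_addr.
pose B : 'M[{mpoly L[n.+1]}]_(m, n) :=
  \matrix_(i, k) (c i (lift j k) * 'X_j ^+ (E - (e i).-1)).
have leE1 i : ((e i).-1 <= E)%N by apply: leq_trans (leq_pred _) (leE i).
have XjE k : ('X_j ^+ k : {mpoly L[n.+1]}) \is k.-homog.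
  by have := dhomogMn k (dhomogXU L j); rewrite mul1n.
have Bh i k : B i k \is E.-homog.
  have [ch _ _] := hc i; rewrite mxE.
  by have := dhomogM (ch (lift j k)) (XjE (E - (e i).-1)%N); rewrite subnKC.
pose Bv : 'M[L]_(m, n) := map_mx (meval v) B.
have /row_freeP[N0 N0B] : row_free Bv^T.
  apply: inj_row_free => z zB.
  pose z' k := if unlift j k is Some l then z ord0 l else 0.
  have [|t ht] := tan z'.
    move=> i; rewrite (bigD1_ord j) //= {1}/z' unlift_none mul0r add0r.
    have /rowP/(_ i) := zB; rewrite !mxE => zi.
    apply: (mulIf (expf_neq0 (E - (e i).-1) vj)); rewrite mul0r.
    transitivity (v j * \sum_k z ord0 k * Bv^T k i); last by rewrite zi mulr0.
    rewrite mulr_suml mulr_sumr; apply: eq_bigr => k _.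
    rewrite /z' liftK !mxE mevalM mevalX_exp mevalXU /eval_at -/v.
    have [_ _ ->] := hc i; last by rewrite eq_sym neq_lift.
    by ring.
  have t0 : t = 0.
    have := ht j; rewrite /z' unlift_none => /esym/eqP.
    by rewrite mulf_eq0 (negPf vj) orbF => /eqP.
  by apply/rowP => k; have := ht (lift j k); rewrite /z' liftK t0 mul0r mxE.
pose C : 'M[{mpoly L[n.+1]}]_(n, m) := map_mx (@mpolyC n.+1 L) N0^T.
pose D := \det (C *m B).
have CBh i k : (C *m B) i k \is E.-homog.
  by rewrite mxE rpred_sum // => l _; rewrite [C _ _]mxE mul_mpolyC rpredZ.
have DnE : D \is (n * E).-homog by apply: dhomog_det.
have DP : eval_at D P = 1.
  rewrite /eval_at -/v /D -det_map_mx map_mxM /= -/Bv.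
  have -> : map_mx (meval v) C = N0^T.
    by apply/matrixP => i k; rewrite !mxE mevalC.
  by rewrite -[Bv]trmxK -trmx_mul N0B trmx1 det1.
have Adj k i : (\adj (C *m B)) k i \is (n.-1 * E).-homog.
  rewrite mxE /cofactor rpredMsign; apply: dhomog_det => a b.
  by rewrite !mxE; have := CBh (lift i a) (lift k b); rewrite mxE.
pose A := \adj (C *m B) *m C.
have Ah k i : A k i \is (n.-1 * E).-homog.
  by rewrite mxE rpred_sum // => l _; rewrite [C _ _]mxE mulrC mul_mpolyC rpredZ.
have DX k : lin_at v j (lift j k) * D
    = \sum_i A k i * 'X_j ^+ (E - (e i).-1) * g i.
  pose y : 'cV[{mpoly L[n.+1]}]_n := \col_k lin_at v j (lift j k).
  have By : B *m y = \col_i ('X_j ^+ (E - (e i).-1) * g i).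
    apply/colP => i; rewrite !mxE; have [_ -> _] := hc i.
    rewrite (bigD1_ord j) //= lin_atj mulr0 add0r mulr_sumr.
    by apply: eq_bigr => l _; rewrite !mxE mulrAC mulrC.
  have : \adj (C *m B) *m (C *m B) *m y = A *m (B *m y) by rewrite /A !mulmxA.
  rewrite mul_adj_mx -/D By => /colP/(_ k); rewrite mul_scalar_mx !mxE mulrC => ->.
  by apply: eq_bigr => i _; rewrite [X in _ * X]mxE mulrA.
clearbody D; exists (n.+1 * E)%N, (D * 'X_j ^+ E); split.
- by rewrite mulSn addnC; apply: dhomogM.
- by rewrite eval_atM DP mul1r eval_atX eval_atXU expf_neq0.
- by move=> i; rewrite mulSn (leq_trans (leE i)) // leq_addr.
case=> [|d] h hd hP.
  have h0 : h = 0.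
    exact: dhomog0_eq0 hd hP.
  exists (fun=> 0); split=> [i|]; first exact: rpred0.
  by rewrite h0 mul0r big1 // => i _; rewrite mul0r.
have [ch [chd he _]] := hadamard vj hd hP.
exists (fun i => \sum_k ch (lift j k) * A k i * 'X_j ^+ (E - (e i).-1) * 'X_j ^+ E).
split=> [i|].
  apply: rpred_sum => k _.
  have := dhomogM (dhomogM (dhomogM (chd (lift j k)) (Ah k i)) (XjE (E - (e i).-1)%N)) (XjE E).
  suff -> : (d + n.-1 * E + (E - (e i).-1) + E = d.+1 + n.+1 * E - e i)%N by [].
  have n0 : (0 < n)%N by apply: leq_ltn_trans (ltn_ord k).
  have -> : (n.+1 * E = n.-1 * E + E + E)%N by rewrite -{1}(prednK n0) !mulSn; lia.
  by have := leE i; have := e0 i; lia.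
rewrite {1}he (bigD1_ord j) //= lin_atj mulr0 add0r mulr_suml.
have DXE k : lin_at v j (lift j k) * (D * 'X_j ^+ E)
    = (\sum_i A k i * 'X_j ^+ (E - (e i).-1) * g i) * 'X_j ^+ E by rewrite mulrA DX.
transitivity (\sum_k ch (lift j k) *
    ((\sum_i A k i * 'X_j ^+ (E - (e i).-1) * g i) * 'X_j ^+ E)).
  by apply: eq_bigr => k _; rewrite -DXE mulrA.
under [RHS]eq_bigr do rewrite mulr_suml; rewrite exchange_big /=.
apply: eq_bigr => k _; rewrite mulr_suml mulr_sumr; apply: eq_bigr => i _.
by ring.
Qed.

Definition grad (L : fieldType) n (f : {mpoly L[n.+1]}) (P : proj L n) : 'rV[L]_n.+1 :=
  \row_k eval_at f^`M(k) P.

Lemma grad_coords (L : fieldType) n d (f : {mpoly L[n.+1]}) P : f \is d.-homog ->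
  grad f P *m (coords P)^T = (d%:R * eval_at f P)%:M.
Proof.
move=> fd; apply/matrixP => i k; rewrite !ord1 !mxE -eval_atZ -(euler fd) eval_at_sum.
by apply: eq_bigr => l _; rewrite !mxE eval_atM eval_atXU mulrC.
Qed.

(** Up to degrees: the germ of [q] generates the maximal ideal of the local ring of
    [X] at [P], with one denominator [D] for all forms [h]. *)
Definition generates_at (L : fieldType) n (X : proj L n -> Prop) (P : proj L n)
    d (q : {mpoly L[n.+1]}) :=
  exists N D, [/\ D \is N.-homog, eval_at D P != 0, (d <= N)%N &
    forall e h, h \is e.-homog -> eval_at h P = 0 ->
      exists2 s, s \is (e + N - d).-homog &
        forall Q, X Q -> eval_at h Q * eval_at D Q = eval_at s Q * eval_at q Q].

(** Together with the equations of the curve, [q] has no common tangent direction at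
    [P]; restricted to the curve, only the multiples of [q] survive. *)
Lemma generates_transversal (K : fieldType) (L : closedFieldType)
    (iota : {rmorphism K -> L}) n (F : seq {mpoly K[n.+1]}) d q P :
  (forall f, f \in F -> f \is homog mdeg) -> points iota F P ->
  (0 < d)%N -> q \is d.-homog -> eval_at q P = 0 ->
  \rank (col_mx (jacobian iota F P) (grad q P)) = n ->
  generates_at (points iota F) P d q.
Proof.
move=> Fh XP d0 qd qP rk; pose Fl i := map_mpoly iota F`_i.
have /choice[df hdf] (i : 'I_(size F)) : exists df, (0 < df)%N /\ Fl i \is df.-homog.
  have Fi : F`_i \in F by rewrite mem_nth.
  have [||e e0 h] := @homog_pos _ _ (Fl i) P.
  - by have /homogP[e h] := Fh _ Fi; apply: homogE (dhomog_map iota h).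
  - exact: XP.
  by exists e.
pose g (i : 'I_(size F + 1)) := if split i is inl k then Fl k else q.
pose e (i : 'I_(size F + 1)) := if split i is inl k then df k else d.
have gP i : eval_at (g i) P = 0.
  by rewrite /g; case: split => // k; apply/XP/mem_nth.
have ge i : g i \is (e i).-homog.
  by rewrite /g /e; case: split => // k; have [] := hdf k.
have [|||N [D [DN DP eN gen]]] := @local_generators L n _ g e P ge.
- by move=> i; rewrite /e; case: split => // k; have [] := hdf k.
- exact: gP.
- move=> z hz; set M := col_mx _ _ in rk.
  have Mg i k : M i k = eval_at (g i)^`M(k) P.
    by rewrite /M mxE /g; case: split => l; rewrite !mxE // map_mderiv.
  have zM : (\row_k z k <= kermx M^T)%MS.
    apply/sub_kermxP/rowP => i; rewrite mxE [RHS]mxE -[RHS](hz i).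
    by apply: eq_bigr => k _; rewrite [M^T _ _]mxE Mg mxE.
  have vM : (coords P <= kermx M^T)%MS.
    apply/sub_kermxP/rowP => i; rewrite mxE [RHS]mxE.
    have := grad_coords P (ge i); rewrite gP mulr0 => /matrixP/(_ ord0 ord0).
    rewrite !mxE mul0rn => gc; rewrite -[RHS]gc; apply: eq_bigr => k _.
    by rewrite [M^T _ _]mxE Mg !mxE mulrC.
  have : (kermx M^T <= coords P)%MS.
    rewrite -(geq_leqif (mxrank_leqif_sup vM)) mxrank_ker mxrank_tr rk subSnn.
    by rewrite rank_rV coords_neq0.
  move/(submx_trans zM)/sub_rVP => [c zc]; exists c => k.
  by have /rowP/(_ k) := zc; rewrite !mxE.
have split_last : split (rshift (size F) (ord0 : 'I_1)) = inr ord0.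
  by rewrite -[rshift _ _]/(unsplit (inr ord0)) unsplitK.
exists N, D; split=> //; first by have := eN (rshift (size F) ord0); rewrite /e split_last.
move=> k h hk hP; have [s [sh hs]] := gen k h hk hP.
exists (s (rshift (size F) ord0)).
  by have := sh (rshift (size F) ord0); rewrite /e split_last.
move=> Q XQ; rewrite -eval_atM hs eval_at_sum big_split_ord /= big1 ?add0r.
  by rewrite big_ord1 eval_atM /g split_last.
move=> i _; rewrite eval_atM /g -[lshift _ _]/(unsplit (inl i)) unsplitK.
by rewrite (XQ F`_i) ?mem_nth // mulr0.
Qed.

Lemma pihomogM (R : comNzRingType) n d e (a s : {mpoly R[n]}) : s \is e.-homog ->
  (e <= d)%N -> pihomog mdeg d (a * s) = pihomog mdeg (d - e) a * s.
Proof.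
move=> se ed; elim/mpolyind: a => [|c m a _ _ IH]; first by rewrite !(mul0r, raddf0).
rewrite mulrDl !raddfD /= mulrDl IH; congr (_ + _).
have Xs : 'X_[m] * s \is (mdeg m + e).-homog by rewrite dhomogM // dhomogX.
rewrite -scalerAl !linearZ /= -scalerAl; congr (_ *: _).
rewrite [X in _ = X * _]pihomogX /=; case: eqP => [me|/eqP me].
  by rewrite pihomog_dE //; move: Xs; rewrite me subnK.
by rewrite mul0r (pihomog_ne0 _ Xs) // -(subnK ed) eqn_add2r.
Qed.

Section LocalRing.
Variables (L : fieldType) (n : nat) (X : proj L n -> Prop) (P : proj L n).
Variables (d : nat) (q : {mpoly L[n.+1]}).
Hypotheses (XP : X P) (qd : q \is d.-homog) (qP : eval_at q P = 0).
Hypothesis qgen : generates_at X P d q.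

Lemma generates_uniformizer h : h \is d.-homog -> eval_at h P != 0 ->
  uniformizer X P (fun Q => eval_at q Q / eval_at h Q).
Proof.
move=> hd hP; split; [exact: regular_frac hd hP|by rewrite qP mul0r|].
move=> f [e [a [b [ae be ab]]]] fP.
have [bP fPe] := near_self XP ab.
have aP : eval_at a P = 0.
  by apply/eqP; move: fPe; rewrite fP => /esym/eqP; rewrite mulf_eq0 invr_eq0 (negPf bP) orbF.
have [N [D [DN DP dN gen]]] := qgen; have [s sh hs] := gen e a ae aP.
have shh : s * h \is (e + N).-homog.
  by have := dhomogM sh hd; rewrite subnK // (leq_trans dN) ?leq_addl.
have bD : b * D \is (e + N).-homog by apply: dhomogM.
exists (fun Q => eval_at (s * h) Q / eval_at (b * D) Q).
  by apply: regular_frac shh bD _; rewrite // eval_atM mulf_neq0.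
have nh : near_in X P (fun Q => eval_at h Q != 0) by apply: (near_basic hd).
have nD : near_in X P (fun Q => eval_at D Q != 0) by apply: (near_basic DN).
apply: near_sub (near_and ab (near_and nh nD)) => Q XQ [[bQ ->] [hQ DQ]].
have aQ : eval_at a Q = eval_at s Q * eval_at q Q / eval_at D Q.
  by rewrite -hs // mulfK.
by rewrite aQ !eval_atM; field; rewrite bQ hQ DQ.
Qed.

Hypothesis Xirr : irreducible X.

(** Krull's intersection theorem for a curve: if [c] were divisible by [q ^ m]
    for all [m], with quotients [s m], the basis theorem would express some [s m]
    by the previous ones, that is by multiples [q * s m], forcing [s m = 0]. *)
Lemma finite_order e c : c \is e.-homog -> (exists2 Q, X Q & eval_at c Q != 0) ->
  exists m k1 k2 s1 s2, [/\ s1 \is k1.-homog, s2 \is k2.-homog,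
    eval_at s1 P != 0, eval_at s2 P != 0 &
    (e + k1 = m * d + k2)%N /\
    forall Q, X Q -> eval_at c Q * eval_at s1 Q = eval_at q Q ^+ m * eval_at s2 Q].
Proof.
move=> ce [Q0 XQ0 cQ0]; have [N [D [DN DP dN gen]]] := qgen.
apply: contrapT => nex.
pose k m := (e + m * (N - d))%N.
have hk m : (e + N * m = m * d + k m)%N.
  by rewrite /k addnCA mulnBr mulnC subnKC // leq_mul2l dN orbT.
pose R m s := s \is (k m).-homog /\
  forall Q, X Q -> eval_at c Q * eval_at D Q ^+ m = eval_at q Q ^+ m * eval_at s Q.
have RP m s : R m s -> eval_at s P = 0.
  move=> [sk hs]; apply/eqP; apply: contrapT => /negP sP; apply: nex.
  exists m, (N * m)%N, (k m), (D ^+ m), s; split=> //; first exact: dhomogMn.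
    by rewrite eval_atX expf_neq0.
  by split=> [|Q XQ]; [exact: hk|rewrite eval_atX hs].
have /choice[s hs] m : exists s, R m s.
  elim: m => [|m [s Rs]].
    by exists c; rewrite /R /k addn0; split=> // Q XQ; rewrite !expr0 mulr1 mul1r.
  have [t th ht] := gen _ _ Rs.1 (RP _ _ Rs); exists t; split.
    by rewrite /k mulSn addnCA [(_ - _ + _)%N]addnC addnBA // in th *.
  by move=> Q XQ; rewrite !exprSr mulrA Rs.2 // -mulrA ht // mulrAC mulrA.
have cancel f g u w Q : f \is u.-homog -> g \is w.-homog -> X Q -> eval_at g Q != 0 ->
    (forall Q, X Q -> eval_at f Q * eval_at g Q = 0) -> forall Q, X Q -> eval_at f Q = 0.
  by move=> *; apply: (@irr_cancel _ _ X Xirr u w f g Q).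
have DmP m : eval_at (D ^+ m) P != 0 by rewrite eval_atX expf_neq0.
have cD m : exists2 Q, X Q & eval_at (c * D ^+ m) Q != 0.
  apply: contrapT => nQ; move/negP: cQ0; apply.
  apply/eqP; apply: (@cancel c (D ^+ m) e (N * m)%N P) => //; first exact: dhomogMn.
  move=> Q XQ; apply/eqP; apply: contrapT => /negP h; apply: nQ; exists Q => //.
  by rewrite eval_atM.
have qX : exists2 Q, X Q & eval_at q Q != 0.
  have [Q XQ] := cD 1%N; rewrite eval_atM eval_atX (hs 1%N).2 // mulf_eq0 negb_or expr1.
  by case/andP => ? _; exists Q.
have sX m : exists2 Q, X Q & eval_at (s m) Q != 0.
  have [Q XQ] := cD m; rewrite eval_atM eval_atX (hs m).2 // mulf_eq0 negb_or.
  by case/andP => _ ?; exists Q.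
have [m [a ea]] := hilbert_basis s.
(* Only the components of the [a i] of the right degree matter. *)
pose a' (i : 'I_m) := pihomog mdeg (k m - k i) (a i).
have kle (i : 'I_m) : (k i <= k m)%N by rewrite /k leq_add2l leq_mul2r ltnW ?orbT.
have ea' : s m = \sum_(i < m) a' i * s i.
  have [sk _] := hs m.
  rewrite -(pihomog_dE sk) {1}ea raddf_sum; apply: eq_bigr => i _.
  by have [sik _] := hs i; rewrite /= (pihomogM _ sik).
have rel (i : 'I_m) Q : X Q ->
    eval_at (s i) Q * eval_at D Q ^+ (m - i) = eval_at q Q ^+ (m - i) * eval_at (s m) Q.
  have [Q1 XQ1 qQ1] := qX; have im := ltnW (ltn_ord i).
  pose f := s i * D ^+ (m - i) - q ^+ (m - i) * s m.
  have fh : f \is (k i + N * (m - i)).-homog.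
    rewrite rpredB //; first by apply: dhomogM; [have [] := hs i|exact: dhomogMn].
    have -> : (k i + N * (m - i) = d * (m - i) + k m)%N.
      have := hk i; have := hk m; rewrite mulnBr mulnBr.
      have := leq_mul (leqnn N) im; have := leq_mul (leqnn d) im; lia.
    by apply: dhomogM; [exact: dhomogMn|have [] := hs m].
  move=> XQ; apply/eqP; rewrite -subr_eq0 -!eval_atX -!eval_atM -eval_atB; apply/eqP.
  apply: (@cancel f (q ^+ i) _ (d * i)%N Q1 fh) => //; first exact: dhomogMn.
    by rewrite eval_atX expf_neq0.
  move=> Q2 XQ2; rewrite eval_atX /f eval_atB !eval_atM !eval_atX.
  have e1 := (hs i).2 _ XQ2; have e2 := (hs m).2 _ XQ2.
  have split_exp (x : L) : x ^+ m = x ^+ i * x ^+ (m - i) by rewrite -exprD subnKC.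
  rewrite !split_exp in e2.
  transitivity (eval_at q Q2 ^+ i * eval_at (s i) Q2 * eval_at D Q2 ^+ (m - i)
    - eval_at q Q2 ^+ i * eval_at q Q2 ^+ (m - i) * eval_at (s m) Q2); first by ring.
  by rewrite -e1 -e2; ring.
have [Q1 XQ1 /eqP] := sX m; apply.
(* By [rel], [s m * E] vanishes on the curve, and [E] is a power of [D] at [P]. *)
pose E := D ^+ m - \sum_(i < m) a' i * D ^+ i * q ^+ (m - i).
have Eh : E \is (N * m).-homog.
  rewrite rpredB ?dhomogMn // rpred_sum // => i _; have im := ltnW (ltn_ord i).
  have := dhomogM (dhomogM (pihomogP mdeg (k m - k i) (a i)) (dhomogMn i DN)) (dhomogMn (m - i) qd).
  suff -> : (k m - k i + N * i + d * (m - i) = N * m)%N by [].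
  have := kle i; have := hk i; have := hk m; rewrite mulnBr.
  have := leq_mul (leqnn d) im; lia.
apply: (@cancel (s m) E (k m) (N * m)%N P) => //; first by have [] := hs m.
  rewrite /E eval_atB eval_at_sum big1 ?subr0 // => i _.
  by rewrite !eval_atM [eval_at (q ^+ _) _]eval_atX qP expr0n subn_eq0 leqNgt ltn_ord mulr0.
move=> Q XQ; rewrite /E eval_atB mulrBr; apply/eqP; rewrite subr_eq0; apply/eqP.
rewrite {1}ea' !eval_at_sum mulr_suml mulr_sumr; apply: eq_bigr => i _.
have im := ltnW (ltn_ord i).
rewrite !eval_atM !eval_atX.
transitivity (eval_at (a' i) Q * eval_at D Q ^+ i * (eval_at (s i) Q * eval_at D Q ^+ (m - i))).
  have -> : eval_at D Q ^+ m = eval_at D Q ^+ i * eval_at D Q ^+ (m - i) by rewrite -exprD subnKC.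
  by ring.
by rewrite rel //; ring.
Qed.

End LocalRing.

(** * The projective Nullstellensatz *)

Section Ideals.
Variable R : comNzRingType.
Implicit Types (I J : R -> Prop) (f g a b : R).

Definition is_ideal I :=
  [/\ I 0, forall f g, I f -> I g -> I (f + g) & forall a f, I f -> I (a * f)].

Definition adjoin I g f := exists h a, I h /\ f = h + a * g.

Lemma ideal_opp I f : is_ideal I -> I f -> I (- f).
Proof. by case=> _ _ IM If; rewrite -mulN1r; apply: IM. Qed.

Lemma ideal_sum I (T : eqType) (r : seq T) (P : pred T) (F : T -> R) : is_ideal I ->
  (forall i, i \in r -> P i -> I (F i)) -> I (\sum_(i <- r | P i) F i).
Proof.
move=> [I0 ID _] h; rewrite big_seq_cond; apply: (big_ind I) => // i /andP[].
exact: h.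
Qed.

Lemma adjoin_ideal I g : is_ideal I -> is_ideal (adjoin I g).
Proof.
move=> [I0 ID IM]; split.
- by exists 0, 0; rewrite mul0r addr0.
- move=> _ _ [h1 [a1 [Ih1 ->]]] [h2 [a2 [Ih2 ->]]].
  by exists (h1 + h2), (a1 + a2); split; [exact: ID|rewrite mulrDl addrACA].
- move=> b _ [h [a [Ih ->]]]; exists (b * h), (b * a); split; first exact: IM.
  by rewrite mulrDr mulrA.
Qed.

Lemma adjoin_sub I g f : I f -> adjoin I g f.
Proof. by move=> If; exists f, 0; rewrite mul0r addr0. Qed.

Lemma adjoin_gen I g : is_ideal I -> adjoin I g g.
Proof. by case=> I0 _ _; exists 0, 1; rewrite mul1r add0r. Qed.

(** Multiplying 1 = k + a * F r by the other factors removes the factor [F r]. *)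
Lemma ideal_prod_unit I (T : Type) (s : seq T) (F : T -> R) : is_ideal I ->
  I (\prod_(r <- s) F r) -> (forall r, adjoin I (F r) 1) -> I 1.
Proof.
move=> idI Is uF; elim: s Is => [|r s IH]; first by rewrite big_nil.
rewrite big_cons => h; apply: IH; case: idI => I0 ID IM.
have [k [a [Ik e]]] := uF r.
set y := \prod_(_ <- _) _ in h *.
rewrite -[y]mul1r e mulrDl; apply: ID; first by rewrite mulrC; apply: IM.
by rewrite -mulrA; apply: IM.
Qed.

End Ideals.

Section FiniteCodimension.
Variables (L : closedFieldType) (n : nat).
Implicit Types (B : {mpoly L[n]} -> Prop).

(** Finite codimension, in a form that passes to larger ideals and involves no
    quotient. *)
Definition bounded_mod B M := forall f, exists2 g, (msize g <= M)%N & B (f - g).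

(** The powers of a variable are linearly dependent modulo [B], so [B] contains a
    polynomial in it; this one splits into linear factors. *)
Lemma finite_codim_root B M (i : 'I_n) : is_ideal B -> bounded_mod B M -> ~ B 1 ->
  exists r, ~ adjoin B ('X_i - r%:MP) 1.
Proof.
move=> idB bB nB; have [B0 BD BM] := idB.
apply: contrapT => nr.
have unit r : adjoin B ('X_i - r%:MP) 1 by apply: contrapT => h; apply: nr; exists r.
have /choice[g hg] t : exists g, (msize g <= M)%N /\ B ('X_i ^+ t - g).
  by have [g ? ?] := bB ('X_i ^+ t); exists g.
pose N := #|{: 'X_{1..n < M}}|.
pose A : 'M[L]_(N.+1, N) := \matrix_(t, u) (g t)@_(enum_val u : 'X_{1..n < M}).
have /rowV0Pn[z zA z0] : kermx A != 0.
  by rewrite -mxrank_eq0 mxrank_ker subn_eq0 -ltnNge ltnS rank_leq_col.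
have gz : \sum_t z ord0 t *: g t = 0.
  apply/mpolyP => u; rewrite mcoeff0 (raddf_sum (mcoeff u)).
  have [uM|Mu] := ltnP (mdeg u) M; last first.
    rewrite big1 // => t _; apply/eqP; rewrite mcoeff_eq0.
    apply: contraL Mu => /msize_mdeg_lt; rewrite -ltnNge => /leq_trans; apply.
    by apply: leq_trans (mmeasureZ_le _ _ _) _; case: (hg t).
  have /rowP/(_ (enum_rank (BMultinom uM))) := sub_kermxP zA.
  rewrite !mxE => e; rewrite -[RHS]e; apply: eq_bigr => t _.
  by rewrite !mxE enum_rankK /= mcoeffZ.
pose p : {poly L} := \poly_(t < N.+1) z ord0 (inord t).
have p0 : p != 0.
  apply: contraNneq z0 => p0; apply/eqP/rowP => t; rewrite mxE.
  by have := coef_poly N.+1 (fun t => z ord0 (inord t)) t; rewrite -/p p0 coef0 ltn_ord inord_val.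
have Bp : B (map_poly (@mpolyC n L) p).[ 'X_i ].
  rewrite (horner_coef_wide _ (n := N.+1)); last first.
    by rewrite size_map_inj_poly ?size_poly ?mpolyC0 //; exact: (can_inj (@mpolyCK _ _)).
  have -> : \sum_(t < N.+1) (map_poly (@mpolyC n L) p)`_t * 'X_i ^+ t
     = \sum_(t < N.+1) z ord0 t *: ('X_i ^+ t - g t) + \sum_t z ord0 t *: g t.
    rewrite -big_split; apply: eq_bigr => t _ /=; rewrite -scalerDr subrK.
    by rewrite coef_map_id0 ?mpolyC0 // coef_poly ltn_ord inord_val mul_mpolyC.
  rewrite gz addr0; apply: ideal_sum => // t _ _.
  by rewrite -mul_mpolyC; apply: BM; case: (hg t).
have [s ps] := closed_field_poly_normal p.
apply/nB/(ideal_prod_unit (s := s) (F := fun r => 'X_i - r%:MP)) => //.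
have := BM (lead_coef p)^-1%:MP _ Bp.
rewrite [in map_poly _ _]ps; set w := \prod_(_ <- _) _.
rewrite map_polyZ hornerZ mulrA -mpolyCM mulVf ?lead_coef_eq0 // mpolyC1 mul1r.
rewrite /w rmorph_prod horner_prod.
under eq_bigr do rewrite rmorphB /= map_polyX map_polyC hornerXsubC /=.
by [].
Qed.

(** Add linear polynomials in one variable after another. *)
Lemma maximal_point B M : is_ideal B -> bounded_mod B M -> ~ B 1 ->
  exists a : 'I_n -> L, forall f, B f -> f.@[a] = 0.
Proof.
move=> idB bB nB.
have [a [J [idJ BJ nJ aJ]]] : exists (a : 'I_n -> L) J, [/\ is_ideal J,
    forall f, B f -> J f, ~ J 1 & forall i, J ('X_i - (a i)%:MP)].
  suff H k : (k <= n)%N -> exists (a : 'I_n -> L) J, [/\ is_ideal J,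
      forall f, B f -> J f, ~ J 1 & forall i : 'I_n, (i < k)%N -> J ('X_i - (a i)%:MP)].
    have [a [J [? ? ? aJ]]] := H n (leqnn n).
    by exists a, J; split=> // i; apply: aJ.
  elim: k => [_|k IH kn]; first by exists (fun=> 0), B.
  have [a [J [idJ BJ nJ aJ]]] := IH (ltnW kn).
  have bJ : bounded_mod J M.
    by move=> f; have [g ? ?] := bB f; exists g => //; apply: BJ.
  have [r hr] := finite_codim_root (Ordinal kn) idJ bJ nJ.
  exists (fun i => if val i == k then r else a i), (adjoin J ('X_(Ordinal kn) - r%:MP)); split=> //.
  - exact: adjoin_ideal.
  - by move=> f /BJ; apply: adjoin_sub.
  move=> i; rewrite ltnS leq_eqVlt; case: eqP => [ik _|_ /= ik].
    have -> : i = Ordinal kn by apply: val_inj.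
    exact: adjoin_gen.
  by apply: adjoin_sub; apply: aJ.
exists a; have [J0 JD JM] := idJ.
have ev f : J (f - (f.@[a])%:MP).
  elim/mpolyind: f => [|c m p _ _ IH]; first by rewrite meval0 mpolyC0 subr0.
  rewrite mevalD mpolyCD opprD addrACA; apply: (JD) => //.
  rewrite mevalZ mpolyCM mul_mpolyC -scalerBr -mul_mpolyC; apply: (JM).
  rewrite mpolyXE_id.
  apply: (big_ind (fun g => J (g - (g.@[a])%:MP))) => [|f g Jf Jg|i _].
  - by rewrite meval1 mpolyC1 subrr.
  - rewrite mevalM mpolyCM.
    have -> : f * g - (f.@[a])%:MP * (g.@[a])%:MP
      = g * (f - (f.@[a])%:MP) + (f.@[a])%:MP * (g - (g.@[a])%:MP) by ring.
    by apply: (JD); apply: (JM).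
  - rewrite mevalX_exp mevalXU (rmorphXn (@mpolyC n L)) subrXX mulrC; apply: (JM); exact: aJ.
move=> f /BJ Jf; apply/eqP; apply: contrapT => /negP fa.
have Jc : J (f.@[a])%:MP.
  by have := JD _ _ Jf (ideal_opp idJ (ev f)); rewrite opprB addrC subrK.
by apply: nJ; have := JM (f.@[a])^-1%:MP _ Jc; rewrite -mpolyCM mulVf.
Qed.

End FiniteCodimension.

Section Projective.
Variables (L : closedFieldType) (n : nat).
Implicit Types (I J : {mpoly L[n.+1]} -> Prop).

Definition homog_ideal J := is_ideal J /\ forall d f, J f -> J (pihomog mdeg d f).

(** The zero set in projective space is empty. *)
Definition irrelevant J := forall i : 'I_n.+1, exists m, J ('X_i ^+ m).

Lemma irrelevant_monomials J : is_ideal J -> irrelevant J ->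
  exists M, forall u, (M <= mdeg u)%N -> J 'X_[u].
Proof.
move=> [J0 JD JM] /choice[m hm]; exists (\sum_i m i).+1%N => u Mu.
have [i iu] : exists i, (m i <= u i)%N.
  apply/existsP; apply: contraLR Mu; rewrite negb_exists => /forallP h.
  rewrite -leqNgt mdegE leq_sum // => i _.
  by rewrite ltnW // ltnNge.
have -> : u = ((u - U_(i) *+ m i) + U_(i) *+ m i)%MM.
  rewrite submK //; apply/mnm_lepP => l; rewrite mulmnE mnm1E.
  by case: eqP => [<-|_]; rewrite ?mul1n ?mul0n.
by rewrite mpolyXD -mpolyXn; apply: (JM).
Qed.

Lemma irrelevant_forms J : is_ideal J -> irrelevant J ->
  exists M, forall d f, f \is d.-homog -> (M <= d)%N -> J f.
Proof.
move=> idJ /(irrelevant_monomials idJ)[M hM]; exists M => d f /dhomogP fd Md.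
rewrite [f]mpolyE; apply: ideal_sum => // u /fd ud _; rewrite -mul_mpolyC.
by case: idJ => _ _ JM; apply: (JM); apply: hM; rewrite [mdeg u]ud.
Qed.

Lemma pihomog0M (a : {mpoly L[n.+1]}) i : pihomog mdeg 0 (a * 'X_i) = 0.
Proof.
elim/mpolyind: a => [|c m p _ _ IH]; first by rewrite mul0r raddf0.
rewrite mulrDl raddfD /= IH addr0 -scalerAl linearZ /= -mpolyXD pihomogX /=.
by rewrite mdegD mdeg1 addn1 scaler0.
Qed.

Lemma adjoinX_homog J i : homog_ideal J -> homog_ideal (adjoin J 'X_i).
Proof.
move=> [idJ hJ]; split; first exact: adjoin_ideal.
move=> d _ [h [a [Jh ->]]]; rewrite raddfD /=; case: d => [|d].
  exists (pihomog mdeg 0 h), 0; split; first exact: hJ.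
  by rewrite mul0r addr0 pihomog0M addr0.
exists (pihomog mdeg d.+1 h), (pihomog mdeg d a); split; first exact: hJ.
by rewrite (@pihomogM _ _ d.+1 1 a) ?dhomogXU // subn1.
Qed.

(** The components of 1 = h + a * (x_i - 1) show that the component of degree [d] of
    [a] is congruent to - x_i ^ d modulo [J]; but [a] has finitely many. *)
Lemma dehomogenize_proper J i : homog_ideal J -> (forall m, ~ J ('X_i ^+ m)) ->
  ~ adjoin J ('X_i - 1) 1.
Proof.
move=> [idJ hJ] nX [h [a [Jh e]]]; have [J0 JD JM] := idJ.
have eqd d : pihomog mdeg d a + pihomog mdeg d 1
    = pihomog mdeg d h + pihomog mdeg d (a * 'X_i).
  by rewrite -!raddfD /= {1}e; congr (pihomog _ _ _); ring.
have hom1 : (1 : {mpoly L[n.+1]}) \is 0.-homog by apply: dhomog1.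
have pi1 : pihomog mdeg 0 1 = 1 :> {mpoly L[n.+1]} by apply: pihomog_dE.
have pi1S d : pihomog mdeg d.+1 1 = 0 :> {mpoly L[n.+1]} by apply: pihomog_ne0 hom1.
have claim d : J (pihomog mdeg d a + 'X_i ^+ d).
  elim: d => [|d IH].
    by rewrite expr0 -{1}pi1 eqd pihomog0M addr0; apply: hJ.
  have := eqd d.+1; rewrite pi1S addr0 => ->.
  rewrite (@pihomogM _ _ d.+1 1 a) ?dhomogXU // subn1 /= exprSr -addrA -mulrDl mulrC.
  by apply: (JD); [exact: hJ|apply: (JM)].
apply: (nX (msize a)); have := claim (msize a).
suff -> : pihomog mdeg (msize a) a = 0 by rewrite add0r.
rewrite pihomogE big1_seq // => u /andP[/eqP ua /msize_mdeg_lt].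
by rewrite -ua ltnn.
Qed.

(** Modulo [J], a monomial of large degree is a multiple of x_i; modulo x_i - 1 its
    degree drops. *)
Lemma dehomogenize_bounded J i : homog_ideal J -> irrelevant (adjoin J 'X_i) ->
  exists M, bounded_mod (adjoin J ('X_i - 1)) M.
Proof.
move=> hJ irr; have [idJ _] := hJ.
have [idJ' hJ'] := adjoinX_homog i hJ.
have idB := adjoin_ideal ('X_i - 1) idJ; have [B0 BD BM] := idB.
have [M hM] := irrelevant_monomials idJ' irr; exists M.+1.
pose Q f := exists2 g, (msize g <= M.+1)%N & adjoin J ('X_i - 1) (f - g).
have QD c f1 f2 : Q f1 -> Q f2 -> Q (c *: f1 + f2).
  case=> g1 s1 b1 [g2 s2 b2]; exists (c *: g1 + g2).
    apply: leq_trans (msizeD_le _ _) _; rewrite geq_max s2 andbT.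
    exact: leq_trans (mmeasureZ_le _ _ _) s1.
  rewrite opprD addrACA -scalerBr -mul_mpolyC; apply: (BD) => //; exact: (BM).
have Q0 : Q 0 by exists 0; rewrite ?mmeasure0 // subr0.
have QX k u : (mdeg u <= k)%N -> Q 'X_[u].
  elim: k u => [|k IH] u uk.
    by exists 'X_[u]; rewrite ?msizeX ?subrr // ltnS (leq_trans uk).
  have [uM|Mu] := ltnP (mdeg u) M.
    by exists 'X_[u]; rewrite ?msizeX ?subrr // ltnS ltnW.
  have [u0|u0] := posnP (mdeg u).
    by exists 'X_[u]; rewrite ?msizeX ?subrr // u0.
  have [h [a [Jh e]]] := hM u Mu.
  have := congr1 (pihomog mdeg (mdeg u)) e.
  rewrite pihomogX eqxx raddfD /= (@pihomogM _ _ _ 1 a) ?dhomogXU // => e'.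
  set a' := pihomog _ _ a in e'.
  have Qa : Q a'.
    have /dhomogP a'd : a' \is (mdeg u - 1).-homog by apply: pihomogP.
    rewrite [a']mpolyE big_seq; apply: (big_ind Q) => // [f1 f2 q1 q2|w /a'd wd].
      by have := QD 1 _ _ q1 q2; rewrite scale1r.
    rewrite -[_ *: _]addr0; apply: (QD) => //; apply: IH.
    by rewrite [mdeg w]wd leq_subLR add1n.
  have [g gs Bg] := Qa; exists g => //.
  have -> : 'X_[u] - g = pihomog mdeg (mdeg u) h + a' * ('X_i - 1) + (a' - g).
    by rewrite e'; ring.
  apply: (BD) => //; exists (pihomog mdeg (mdeg u) h), a'; split=> //.
  by case: hJ => _; apply.
move=> f; rewrite -/(Q f) [f]mpolyE; apply: (big_ind Q) => // [f1 f2 q1 q2|w _].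
  by have := QD 1 _ _ q1 q2; rewrite scale1r.
by rewrite -[_ *: _]addr0; apply: (QD) => //; apply: (QX _ _ (leqnn _)).
Qed.

(** Adjoin x_0, x_1, ... to [J] until the ideal contains a power of each coordinate,
    and let x_k be the last one adjoined.  Modulo the ideal before this step and
    x_k - 1 the polynomials form a nonzero finite dimensional algebra, and a maximal
    ideal of it is a zero of [J]. *)
Lemma projective_zero J : homog_ideal J -> ~ irrelevant J ->
  exists v : 'rV[L]_n.+1, v != 0 /\ forall f, J f -> f.@[v ord0] = 0.
Proof.
move=> hJ nirr.
pose fix Jk k := if k is k'.+1 then adjoin (Jk k') 'X_(inord k' : 'I_n.+1) else J.
have hJk k : homog_ideal (Jk k) by elim: k => // k IH; apply: adjoinX_homog.
have Jksub k l f : (k <= l)%N -> Jk k f -> Jk l f.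
  elim: l => [|l IH]; first by rewrite leqn0 => /eqP->.
  rewrite leq_eqVlt => /orP[/eqP->//|kl Jf].
  by apply: adjoin_sub; apply: IH.
have irrN : irrelevant (Jk n.+1).
  move=> i; exists 1%N; rewrite expr1; apply: (@Jksub i.+1) => //=.
  by rewrite inord_val; apply: adjoin_gen; case: (hJk i).
have [k nk ik] : exists2 k, ~ irrelevant (Jk k) & irrelevant (Jk k.+1).
  apply: contrapT => nk; suff : forall k, ~ irrelevant (Jk k) by move/(_ n.+1).
  elim=> // k IH ik; apply: nk; by exists k.
pose x : 'I_n.+1 := inord k; have {}ik : irrelevant (adjoin (Jk k) 'X_x) := ik.
have hK := hJk k; have [idK _] := hK; have [K0 KD KM] := idK.
have nx m : ~ Jk k ('X_x ^+ m).
  move=> xm; apply: nk => i; have [m' [h [a [Jh e]]]] := ik i.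
  exists (m' * m)%N; rewrite exprM e.
  rewrite -[_ ^+ m](subrK ((a * 'X_x) ^+ m)) subrXX addrK; apply: (KD).
    by rewrite mulrC; apply: (KM).
  by rewrite exprMn; apply: (KM).
have [M bM] := dehomogenize_bounded hK ik.
have [a Ba] := maximal_point (adjoin_ideal ('X_x - 1) idK) bM (dehomogenize_proper hK nx).
have ax : a x = 1.
  apply/eqP; rewrite -subr_eq0; apply/eqP.
  by have := Ba _ (adjoin_gen _ idK); rewrite mevalB mevalXU meval1.
exists (\row_i a i); split.
  by apply/eqP => /rowP/(_ x); rewrite !mxE ax => /eqP; rewrite oner_eq0.
move=> f Jf; rewrite -[RHS](Ba f); first by apply: meval_eq => i; rewrite mxE.
by apply: adjoin_sub; apply: (@Jksub 0%N k).
Qed.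

(** The forms in a homogeneous ideal, rather than the ideal, are what the uses
    below provide. *)
Theorem projective_nullstellensatz (E : {mpoly L[n.+1]} -> Prop) :
  E 0 ->
  (forall d f g, f \is d.-homog -> g \is d.-homog -> E f -> E g -> E (f + g)) ->
  (forall d e a f, a \is d.-homog -> f \is e.-homog -> E f -> E (a * f)) ->
  (forall P : proj L n, exists d f, [/\ f \is d.-homog, E f & eval_at f P != 0]) ->
  exists M, forall d f, f \is d.-homog -> (M <= d)%N -> E f.
Proof.
move=> E0 ED EM noz.
pose J f := forall d, E (pihomog mdeg d f).
have JE d f : f \is d.-homog -> J f -> E f by move=> fd /(_ d); rewrite pihomog_dE.
have EJ d f : f \is d.-homog -> E f -> J f.
  move=> fd Ef e; have [->|de] := eqVneq e d; first by rewrite pihomog_dE.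
  by rewrite (pihomog_ne0 _ fd) // eq_sym.
have J0 : J 0 by move=> d; rewrite raddf0.
have JD f g : J f -> J g -> J (f + g).
  by move=> Jf Jg d; rewrite raddfD /=; apply: (ED d); rewrite ?pihomogP.
have Jpi f d : J f -> J (pihomog mdeg d f) by move/(_ d) => h; apply: EJ h; apply: pihomogP.
have JM a f : J f -> J (a * f).
  move=> Jf; rewrite [a]mpolyE mulr_suml; apply: (big_ind J) => // u _.
  rewrite [f](@pihomog_partitionE _ _ mdeg (msize f)) // mulr_sumr.
  apply: (big_ind J) => // d _; have fd := pihomogP mdeg d f.
  have ud : a@_u *: 'X_[u] \is (mdeg u).-homog by rewrite rpredZ // dhomogX.
  by apply: (EJ (mdeg u + d)%N); [exact: dhomogM|apply: (EM (mdeg u) d)].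
have hJ : homog_ideal J by split=> [|d f Jf]; [split|apply: Jpi].
have irr : irrelevant J.
  apply: contrapT => /(projective_zero hJ)[v [v0 Jv]].
  have [d [f [fd Ef]]] := noz (mkpt v0).
  have e : val (mkpt v0) = <[v]>%VS by [].
  have f0 : f.@[v ord0] = 0 by apply: Jv; apply: EJ fd Ef.
  by rewrite (eval_line_eq0 v0 e fd) f0 eqxx.
have [M hM] := irrelevant_forms hJ.1 irr; exists M => d f fd Md.
exact: JE fd (hM d f fd Md).
Qed.

End Projective.

(** * The complement of a hypersurface is affine *)

Section ToPoint.
Variables (L : fieldType) (n : nat).
Implicit Types v : 'rV[L]_n.+1.

Lemma delta_row_neq0 : delta_mx ord0 ord0 != 0 :> 'rV[L]_n.+1.
Proof. by apply/eqP => /matrixP/(_ ord0 ord0)/eqP; rewrite !mxE !eqxx oner_eq0. Qed.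

(** Arbitrary if [v] is zero. *)
Definition topt v : proj L n := insubd (mkpt delta_row_neq0) <[v]>%VS.

Lemma val_topt v : v != 0 -> val (topt v) = <[v]>%VS.
Proof. by move=> v0; rewrite val_insubd dim_vline v0. Qed.

Lemma val_inj_line (P Q : proj L n) v c :
  val P = <[v]>%VS -> val Q = <[c *: v]>%VS -> c != 0 -> P = Q.
Proof.
move=> eP eQ c0; apply: val_inj; rewrite eP eQ; apply/eqP.
rewrite eqEdim !dim_vline scaler_eq0 (negPf c0) /= leqnn andbT -memvE.
by apply/vlineP; exists c^-1; rewrite scalerA mulVf ?scale1r.
Qed.

End ToPoint.

Lemma map_mpoly_id (R : comNzRingType) n (f : {mpoly R[n]}) :
  map_mpoly (idfun : {rmorphism R -> R}) f = f.
Proof. by apply/mpolyP => m; rewrite mcoeff_map_mpoly. Qed.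

Section Monomials.
Variables (R : comNzRingType) (n D : nat).

(** Indexing monomials by maps, with repetition, makes the relations between them
    identities of products. *)
Definition mono (s : {ffun 'I_D -> 'I_n}) : {mpoly R[n]} := \prod_k 'X_(s k).

Lemma mono_homog s : mono s \is D.-homog.
Proof.
have -> : D = (\sum_(k < D) 1)%N by rewrite sum1_card card_ord.
by apply: dhomog_bigprod => k _; apply: dhomogXU.
Qed.

Lemma mono_span f : f \is D.-homog -> exists h, f = \sum_s h s *: mono s.
Proof.
have mE k u : mdeg u = k -> exists s : 'I_k -> 'I_n, 'X_[u] = \prod_l 'X_(s l) :> {mpoly R[n]}.
  elim: k u => [|k IH] u uk.
    move/eqP: uk; rewrite mdeg_eq0 => /eqP->.
    have s : 'I_0 -> 'I_n by case.
    by exists s; rewrite big_ord0 mpolyX0.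
  have [i ui] : exists i, u i != 0%N.
    apply/existsP; apply: contra_eqT uk; rewrite negb_exists => /forallP h.
    by rewrite mdegE big1 // => i _; apply/eqP/negPn.
  have eu : u = (U_(i) + (u - U_(i)))%MM by rewrite addmC submK // lep1mP.
  have [|s es] := IH (u - U_(i))%MM.
    by apply/eqP; rewrite -eqSS -uk {2}eu mdegD mdeg1.
  exists (fun l => oapp s i (unlift ord0 l)).
  rewrite big_ord_recl unlift_none /= {1}eu mpolyXD es; congr (_ * _).
  by apply: eq_bigr => l _; rewrite liftK.
pose Q (f : {mpoly R[n]}) := exists h, f = \sum_s h s *: mono s.
have QD c f1 f2 : Q f1 -> Q f2 -> Q (c *: f1 + f2).
  case=> h1 -> [h2 ->]; exists (fun s => c * h1 s + h2 s).
  by rewrite scaler_sumr -big_split; apply: eq_bigr => s _; rewrite scalerA scalerDl.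
have Q0 : Q 0 by exists (fun=> 0); rewrite big1 // => s _; rewrite scale0r.
move/dhomogP => fD; rewrite -/(Q f) [f]mpolyE big_seq.
apply: (big_ind Q) => // [f1 f2 q1 q2|u /fD uD].
  by have := QD 1 _ _ q1 q2; rewrite scale1r.
rewrite -[_ *: _]addr0; apply: (QD) => //.
have [s es] := mE _ _ uD; exists (fun t => (t == finfun s)%:R).
rewrite (bigD1 (finfun s)) //= eqxx scale1r big1 => [|t /negPf->]; last by rewrite scale0r.
by rewrite addr0 es; apply: eq_bigr => l _; rewrite ffunE.
Qed.

End Monomials.

Section Veronese.
Variables (L : fieldType) (n D : nat) (X : proj L n -> Prop) (H : {mpoly L[n.+1]}).
Hypotheses (Xcl : zariski_closed X) (D0 : (0 < D)%N) (HD : H \is D.-homog).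

Let T := {ffun 'I_D -> 'I_n.+1}.
Let N := #|{: T}|.
Let W P := X P /\ eval_at H P != 0.

(** [H] comes first, as [affine] inverts the first coordinate. *)
Let G (i : 'I_N.+1) : {mpoly L[n.+1]} :=
  if unlift ord0 i is Some k then mono L (enum_val k) else H.

Let idx (s : T) : 'I_N.+1 := lift ord0 (enum_rank s).
Let vec P : 'rV[L]_N.+1 := \row_i eval_at (G i) P.
Let ver P : proj L N := topt (vec P).
(** The monomials x_i * x_j ^ (D - 1), whose ratios for fixed [j] recover the point *)
Let mon1 (i j : 'I_n.+1) : T := [ffun k => if val k == 0%N then i else j].

Let G_homog i : G i \is D.-homog.
Proof. by rewrite /G; case: unliftP => [k|] _ //; apply: mono_homog. Qed.

Let G0 : G ord0 = H. Proof. by rewrite /G unlift_none. Qed.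

Let Gidx s : G (idx s) = mono L s.
Proof. by rewrite /G /idx liftK enum_rankK. Qed.

Let vec_neq0 P : W P -> vec P != 0.
Proof.
case=> _ HP; apply: contraNneq HP => /rowP/(_ ord0).
by rewrite !mxE G0 => ->.
Qed.

Let val_ver P : W P -> val (ver P) = <[vec P]>%VS.
Proof. by move/vec_neq0/val_topt. Qed.

Let Z Q := forall e (r : {mpoly L[N.+1]}), r \is e.-homog ->
  (forall P, W P -> r.@[vec P ord0] = 0) -> eval_at r Q = 0.

Let Zcl : zariski_closed Z.
Proof.
exists (fun r => exists2 e, r \is e.-homog & forall P, W P -> r.@[vec P ord0] = 0).
split=> [r [e re _]|Q]; first exact: homogE re.
by split=> [h r [e re hr]|h e r re hr]; [apply: h re hr|apply: h; exists e].
Qed.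

Let eval_mon1 i j P : eval_at (mono L (mon1 i j)) P = coords P ord0 i * coords P ord0 j ^+ D.-1.
Proof.
rewrite /mono eval_at_prod (bigD1 (Ordinal D0)) //= ffunE /= eval_atXU; congr (_ * _).
rewrite (eq_bigr (fun=> coords P ord0 j)) => [|k k0].
  rewrite prodr_const -[X in _ = _ ^+ X.-1](card_ord D) -(cardC1 (Ordinal D0)).
  by congr (_ ^+ _); apply: eq_card => k; rewrite !inE.
rewrite ffunE eval_atXU ifF //; apply: contraNF k0 => /eqP k0.
by apply/eqP/val_inj.
Qed.

Let ver_inv P j : W P -> coords (ver P) ord0 (idx (mon1 j j)) != 0 ->
  val P = <[\row_i coords (ver P) ord0 (idx (mon1 i j))]>%VS.
Proof.
move=> WP; have [c c0 e] := coords_line (vec_neq0 WP) (val_ver WP).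
have cE s : coords (ver P) ord0 (idx s) = c * eval_at (mono L s) P.
  by rewrite e !mxE Gidx.
rewrite cE eval_mon1 => nz.
have -> : \row_i coords (ver P) ord0 (idx (mon1 i j))
    = (c * coords P ord0 j ^+ D.-1) *: coords P.
  by apply/rowP => i; rewrite !mxE cE eval_mon1; ring.
rewrite -coordsK; apply/eqP; rewrite eqEdim !dim_vline coords_neq0.
have nz' : c * coords P ord0 j ^+ D.-1 != 0.
  by apply: contraNneq nz => h; rewrite mulrCA h mulr0.
rewrite scaler_eq0 (negPf nz') coords_neq0 andbT -memvE.
by apply/vlineP; exists (c * coords P ord0 j ^+ D.-1)^-1; rewrite scalerA mulVf ?scale1r.
Qed.

(** Each [R1], [R2], [R3] is a relation between the monomials, read off at [Q]: some
    monomial is nonzero at [Q], then some x_j ^ D is, and then all coordinates of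
    [Q] are determined by those of index x_i * x_j ^ (D - 1). *)
Let ver_surj Q : Z Q -> coords Q ord0 ord0 != 0 -> exists2 P, W P & ver P = Q.
Proof.
move=> ZQ y0.
pose Y (s : T) : L := coords Q ord0 (idx s); pose Xs s : {mpoly L[N.+1]} := 'X_(idx s).
have Xs1 s : Xs s \is 1.-homog by apply: dhomogXU.
have XsQ s : eval_at (Xs s) Q = Y s by apply: eval_atXU.
have XsP s P : (Xs s).@[vec P ord0] = eval_at (mono L s) P.
  by rewrite mevalXU mxE Gidx.
have [h Hh] := mono_span HD.
have R1 : coords Q ord0 ord0 = \sum_s h s * Y s.
  pose r := 'X_ord0 - \sum_s h s *: Xs s.
  have rh : r \is 1.-homog.
    by rewrite rpredB ?dhomogXU // rpred_sum // => s _; rewrite rpredZ.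
  have := ZQ _ _ rh; rewrite /r eval_atB eval_at_sum eval_atXU => e.
  apply/eqP; rewrite -subr_eq0; apply/eqP; rewrite -[RHS](e _).
    by congr (_ - _); apply: eq_bigr => s _; rewrite eval_atZ XsQ.
  move=> P _; rewrite mevalB mevalXU mxE G0 {1}Hh eval_at_sum (raddf_sum (meval _)).
  rewrite -sumrB big1 // => s _; rewrite /= mevalZ XsP eval_atZ subrr //.
have [s Ys] : exists s, Y s != 0.
  apply: contrapT => nY; move/negP: y0; apply; rewrite R1 big1 // => s _.
  have [->|Ys] := eqVneq (Y s) 0; first by rewrite mulr0.
  by case: nY; exists s.
have eval_diag P j : eval_at (mono L (mon1 j j)) P = coords P ord0 j ^+ D.
  by rewrite eval_mon1 -exprS prednK.
have R2 : Y s ^+ D = \prod_k Y (mon1 (s k) (s k)).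
  pose r := Xs s ^+ D - \prod_k Xs (mon1 (s k) (s k)).
  have rh : r \is D.-homog.
    rewrite rpredB //; first by have := dhomogMn D (Xs1 s); rewrite mul1n.
    have := @dhomog_bigprod L N.+1 'I_D (index_enum _) xpredT (fun=> 1%N)
       (fun k => Xs (mon1 (s k) (s k))) (fun k _ => Xs1 _).
    by rewrite sum1_card card_ord.
  have := ZQ _ _ rh; rewrite /r eval_atB eval_atX eval_at_prod XsQ => e.
  apply/eqP; rewrite -subr_eq0; apply/eqP; rewrite -[RHS](e _).
    by congr (_ - _); apply: eq_bigr => k _; rewrite XsQ.
  move=> P _; rewrite mevalB mevalX_exp XsP (rmorph_prod (meval _)) /=.
  under eq_bigr do rewrite XsP eval_diag.
  rewrite prodrXl /mono eval_at_prod; under eq_bigr do rewrite eval_atXU.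
  by rewrite subrr.
pose k0 : 'I_D := Ordinal D0; pose j := s k0; pose c := Y (mon1 j j).
have c0 : c != 0.
  have := expf_neq0 D Ys; rewrite R2 (bigD1 k0) //= mulf_eq0 negb_or.
  by case/andP => yk _; exact: yk.
pose z : 'rV[L]_n.+1 := \row_i Y (mon1 i j).
have z0 : z != 0 by apply: contraNneq c0 => /rowP/(_ j); rewrite /z !mxE => <-.
have R3 (t : T) : \prod_k z ord0 (t k) = Y t * c ^+ D.-1.
  pose r := \prod_k Xs (mon1 (t k) j) - Xs t * Xs (mon1 j j) ^+ D.-1.
  have rh : r \is D.-homog.
    rewrite rpredB //; last first.
      by have := dhomogM (Xs1 t) (dhomogMn D.-1 (Xs1 (mon1 j j))); rewrite mul1n add1n prednK.
    have := @dhomog_bigprod L N.+1 'I_D (index_enum _) xpredT (fun=> 1%N)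
       (fun k => Xs (mon1 (t k) j)) (fun k _ => Xs1 _).
    by rewrite sum1_card card_ord.
  have := ZQ _ _ rh; rewrite /r eval_atB eval_atM eval_atX eval_at_prod !XsQ => e.
  apply/eqP; rewrite -subr_eq0; apply/eqP; rewrite -[RHS](e _).
    by congr (_ - _); apply: eq_bigr => k _; rewrite mxE XsQ.
  move=> P _; rewrite mevalB mevalM mevalX_exp !XsP (rmorph_prod (meval _)) /=.
  under eq_bigr do rewrite XsP eval_mon1.
  rewrite big_split /= prodr_const card_ord eval_diag exprAC /mono eval_at_prod.
  by under [X in _ - X * _]eq_bigr do rewrite eval_atXU; rewrite subrr.
have GE i : (G i).@[z ord0] = c ^+ D.-1 * coords Q ord0 i.
  have mE (t : T) : (mono L t).@[z ord0] = c ^+ D.-1 * Y t.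
    rewrite /mono (rmorph_prod (meval _)) /= mulrC -R3.
    by apply: eq_bigr => k _; rewrite mevalXU.
  rewrite /G; case: unliftP => [k ->|->].
    by rewrite mE /Y /idx enum_valK.
  rewrite {1}Hh (raddf_sum (meval _)) R1 mulr_sumr; apply: eq_bigr => t _.
  by rewrite /= mevalZ mE mulrCA.
have eP : val (mkpt z0) = <[z]>%VS by [].
have WP : W (mkpt z0).
  split; last first.
    by rewrite (eval_line_eq0 z0 eP HD) -G0 GE mulf_neq0 ?expf_neq0.
  have [I [Ih IX]] := Xcl; apply/IX => f If; have /homogP[e fe] := Ih f If.
  apply/eqP; rewrite (eval_line_eq0 z0 eP fe); apply/eqP.
  pose lq := [tuple Xs (mon1 i j) | i < n.+1].
  have rh : f \mPo lq \is (e * 1).-homog.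
    by apply: dhomog_comp => // i; rewrite tnth_mktuple.
  have := ZQ _ _ rh; rewrite /eval_at comp_mpoly_meval => E.
  rewrite -[RHS]E; first by apply: meval_eq => i; rewrite tnth_mktuple mxE -XsQ.
  move=> P [XP _]; rewrite comp_mpoly_meval.
  transitivity (f.@[fun i => coords P ord0 j ^+ D.-1 * coords P ord0 i]).
    by apply: meval_eq => i; rewrite tnth_mktuple XsP eval_mon1 mulrC.
  by rewrite (meval_scale _ _ fe) -/(eval_at f P) ((IX P).1 XP f If) mulr0.
exists (mkpt z0) => //.
have [l l0 hl] := eval_line z0 eP.
apply: esym; apply: (@val_inj_line _ _ _ _ (coords Q) (l ^+ D * c ^+ D.-1)).
- by rewrite coordsK.
- rewrite (val_ver WP); congr <[_]>%VS; apply/rowP => i.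
  by rewrite !mxE (hl _ _ (G_homog i)) GE mulrA.
- by rewrite mulf_neq0 ?expf_neq0.
Qed.

(** The Veronese map identifies [W] with the zeros, off the first coordinate
    hyperplane, of all forms vanishing on its image. *)
Lemma affine_complement : affine (fun P => X P /\ eval_at H P != 0).
Proof.
exists N, Z; split; first exact: Zcl.
have ZW P : W P -> Z (ver P) /\ coords (ver P) ord0 ord0 != 0.
  move=> WP; split=> [e r re hr|].
    by apply/eqP; rewrite (eval_line_eq0 (vec_neq0 WP) (val_ver WP) re) hr.
  have [c c0 ->] := coords_line (vec_neq0 WP) (val_ver WP).
  by rewrite !mxE G0 mulf_neq0 //; case: WP.
have /choice[psi hpsi] Q : exists P, Z Q /\ coords Q ord0 ord0 != 0 -> W P /\ ver P = Q.
  have [[ZQ yQ]|nQ] := pselect (Z Q /\ coords Q ord0 ord0 != 0).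
    by have [P WP vP] := ver_surj ZQ yQ; exists P.
  by exists (topt 0).
have diag P : W P -> exists j, coords (ver P) ord0 (idx (mon1 j j)) != 0.
  move=> WP; have [j Pj] := coords_ex P; exists j.
  have [c c0 ->] := coords_line (vec_neq0 WP) (val_ver WP).
  by rewrite !mxE Gidx eval_mon1 !mulf_neq0 ?expf_neq0.
exists ver, psi; split.
- move=> P WP; split; first exact: ZW.
  exists D, G; split; first exact: G_homog.
  apply: near_all => Q /val_ver ->; congr <[_]>%VS; apply/rowP => i.
  by rewrite !mxE map_mpoly_id.
- move=> Q ZQ; have [WP vP] := hpsi Q ZQ; split=> //.
  have [j] := diag _ WP; rewrite vP => yj.
  exists 1%N, (fun i => 'X_(idx (mon1 i j))); split=> [i|]; first exact: dhomogXU.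
  apply: (@near_basic _ _ _ _ _ 'X_(idx (mon1 j j)) 1); rewrite ?dhomogXU ?eval_atXU //.
  move=> R /hpsi[WR vR]; rewrite eval_atXU -{1}vR => yR.
  rewrite (ver_inv WR yR) vR; congr <[_]>%VS; apply/rowP => i.
  by rewrite !mxE map_mpoly_id eval_atXU.
- move=> P WP; have [WP' vP'] := hpsi _ (ZW _ WP).
  have [j yj] := diag _ WP; apply: val_inj.
  by rewrite (ver_inv WP yj) (ver_inv (P := psi (ver P)) (j := j) WP') vP'.
- by move=> Q ZQ; have [] := hpsi Q ZQ.
Qed.

End Veronese.

(** * Regular functions off a hypersurface section, and finiteness *)

Section RegularRing.
Variables (L : fieldType) (n : nat) (X : proj L n -> Prop).

Lemma regular_cst P (c : L) : X P -> regular_at X P (fun=> c).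
Proof.
move=> XP; exists 0%N, c%:MP, 1; split; rewrite ?dhomog_mpolyC ?dhomog1 //.
by apply: near_all => Q _; rewrite eval_at1 oner_neq0 divr1 /eval_at mevalC.
Qed.

Lemma regular_add P f g : regular_at X P f -> regular_at X P g ->
  regular_at X P (fun Q => f Q + g Q).
Proof.
case=> d [a [b [ad bd fab]]] [e [a' [b' [ae be gab]]]].
exists (d + e)%N, (a * b' + a' * b), (b * b'); split.
- by rewrite rpredD //; [apply: dhomogM|rewrite addnC; apply: dhomogM].
- exact: dhomogM.
apply: near_sub (near_and fab gab) => Q XQ [[bQ ->] [bQ' ->]].
by rewrite eval_atD !eval_atM mulf_neq0 //; split=> //; field; rewrite bQ bQ'.
Qed.

Lemma regular_mul P f g : regular_at X P f -> regular_at X P g ->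
  regular_at X P (fun Q => f Q * g Q).
Proof.
case=> d [a [b [ad bd fab]]] [e [a' [b' [ae be gab]]]].
exists (d + e)%N, (a * a'), (b * b'); split; [exact: dhomogM|exact: dhomogM|].
apply: near_sub (near_and fab gab) => Q XQ [[bQ ->] [bQ' ->]].
by rewrite !eval_atM mulf_neq0 //; split=> //; field; rewrite bQ bQ'.
Qed.

End RegularRing.

Section Chart.
Variables (L : closedFieldType) (n : nat) (X : proj L n -> Prop).
Hypotheses (Xcl : zariski_closed X) (Xirr : irreducible X).
Hypothesis Xsm : forall P, X P -> exists d q,
  [/\ q \is d.-homog, eval_at q P = 0 & generates_at X P d q].
Variables (D : nat) (H : {mpoly L[n.+1]}).
Hypotheses (D0 : (0 < D)%N) (HD : H \is D.-homog).

Let W P := X P /\ eval_at H P != 0.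

Lemma form_off_closed P : ~ X P -> exists d f,
  [/\ f \is d.-homog, eval_at f P != 0 & forall Q, X Q -> eval_at f Q = 0].
Proof.
have [I [Ih IX]] := Xcl => nXP.
have [f /not_implyP[If fP]] : exists f, ~ (I f -> eval_at f P = 0).
  by apply/existsNP => h; apply/nXP/IX.
have /homogP[d fd] := Ih f If; exists d, f; split=> //; first exact/eqP.
by move=> Q /IX; apply.
Qed.

(** The forms [e] such that [e * f] is given by a form up to powers of [H] have
    no common zero: at a zero of [H], a denominator of [f] divides a power of [H]
    since both have finite order. *)
Lemma regular_on_complement f : regular_fun W f ->
  exists k g, g \is (k * D).-homog /\
    forall P, W P -> f P = eval_at g P / eval_at H P ^+ k.
Proof.
move=> reg.
pose R d e k g := [/\ e \is d.-homog, g \is (d + k * D).-homog &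
  forall P, W P -> eval_at e P * eval_at H P ^+ k * f P = eval_at g P].
pose E e := exists d k g, R d e k g.
have RE d e : e \is d.-homog -> E e -> exists k g, R d e k g.
  move=> ed [d' [k [g [ed' gd h]]]].
  have [e0|e0] := eqVneq e 0; last by exists k, g; rewrite (dhomog_uniq e0 ed ed').
  exists 0%N, 0; split=> //; first exact: rpred0.
  by move=> P _; rewrite e0 !eval_at0 !mul0r.
have local P : W P -> exists d e g, R d e 0%N g /\ eval_at e P != 0.
  move=> WP; have [d [g [h [gd hd /near_basicP[b [c [bc bP ab]]]]]]] := reg P WP.
  have [hP _] := ab P WP bP.
  exists (c + d)%N, (b * h), (b * g); split; last by rewrite eval_atM mulf_neq0.
  split; [exact: dhomogM|by rewrite addn0; exact: dhomogM|move=> Q WQ].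
  rewrite expr0 mulr1 !eval_atM; have [->|bQ] := eqVneq (eval_at b Q) 0.
    by rewrite !mul0r.
  by have [hQ ->] := ab Q WQ bQ; rewrite -mulrA [_ * (_ / _)]mulrC divfK.
have [||||M hM] := @projective_nullstellensatz L n E.
- exists 0%N, 0%N, 0; split; rewrite ?rpred0 // => P _.
  by rewrite eval_at0 !mul0r.
- move=> d e1 e2 ed1 ed2 /(RE d _ ed1)[k1 [g1 [_ gd1 h1]]] /(RE d _ ed2)[k2 [g2 [_ gd2 h2]]].
  exists d, (k1 + k2)%N, (g1 * H ^+ k2 + g2 * H ^+ k1); split; first exact: rpredD.
    rewrite mulnDl rpredD // addnA.
      by rewrite [(k2 * D)%N]mulnC; apply: dhomogM => //; apply: dhomogMn.
    by rewrite addnAC [(k1 * D)%N]mulnC; apply: dhomogM => //; apply: dhomogMn.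
  by move=> P WP; rewrite !eval_atD !eval_atM !eval_atX -h1 // -h2 // exprD; ring.
- move=> d e a f' ad fe /(RE e _ fe)[k [g [_ ge h]]].
  exists (d + e)%N, k, (a * g); split; first exact: dhomogM.
    by rewrite -addnA; apply: dhomogM.
  by move=> P WP; rewrite !eval_atM -h // !mulrA.
- move=> P; have [XP|nXP] := pselect (X P); last first.
    have [d [e [ed eP eX]]] := form_off_closed nXP.
    exists d, e; split=> //; exists d, 0%N, 0; split=> //; first exact: rpred0.
    by move=> Q [XQ _]; rewrite eX // !mul0r eval_at0.
  have [HP|HP] := eqVneq (eval_at H P) 0; last first.
    have [d [e [g [Reg eP]]]] := local P (conj XP HP).
    by exists d, e; split=> //; [case: Reg|exists d, 0%N, g].
  have [[P1 WP1]|nW] := pselect (exists P1, W P1); last first.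
    exists 0%N, 1; split; [exact: dhomog1| |by rewrite eval_at1 oner_neq0].
    exists 0%N, 0%N, 0; split; [exact: dhomog1|exact: rpred0|].
    by move=> Q WQ; case: nW; exists Q.
  have [d1 [e1 [g1 [[e1d g1d h1] e1P]]]] := local P1 WP1.
  have [d [q [qd qP qgen]]] := Xsm XP.
  have e1X : exists2 Q, X Q & eval_at e1 Q != 0 by exists P1 => //; case: WP1.
  have HX : exists2 Q, X Q & eval_at H Q != 0 by exists P1; case: WP1.
  have [m [k1 [k2 [s1 [s2 [s1k s2k s1P s2P [ks hs]]]]]]] :=
    finite_order XP qd qP qgen Xirr e1d e1X.
  have [m' [l1 [l2 [t1 [t2 [t1k t2k t1P t2P [kt ht]]]]]]] :=
    finite_order XP qd qP qgen Xirr HD HX.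
  (* e1 * s1 = q^m * s2 and H * t1 = q^m' * t2, so s2 * t1^m * H^m is a multiple of e1. *)
  have m'0 : (0 < m')%N.
    rewrite lt0n; apply/eqP => m'0; have := ht P XP; rewrite m'0 HP mul0r mul1r.
    by move/esym/eqP; rewrite (negPf t2P).
  exists (k2 + l1 * m)%N, (s2 * t1 ^+ m); split.
  - by apply: dhomogM => //; apply: dhomogMn.
  - exists (k2 + l1 * m)%N, m, (q ^+ (m'.-1 * m) * t2 ^+ m * s1 * g1); split.
    + by apply: dhomogM => //; apply: dhomogMn.
    + have := dhomogM (dhomogM (dhomogM (dhomogMn (m'.-1 * m) qd) (dhomogMn m t2k)) s1k) g1d.
      suff -> : (d * (m'.-1 * m) + l2 * m + k1 + (d1 + 0 * D) = k2 + l1 * m + m * D)%N by [].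
      have e : (m * (m' * d) = d * (m'.-1 * m) + m * d)%N.
        by rewrite -{1}(prednK m'0); ring.
      have := congr1 (muln m) kt; rewrite !mulnDr e [(l2 * m)%N]mulnC [(l1 * m)%N]mulnC.
      by move: ks; clear; lia.
    + move=> Q WQ; have [XQ _] := WQ.
      rewrite !eval_atM !eval_atX -(h1 Q WQ) expr0 mulr1.
      have e2 : eval_at t1 Q ^+ m * eval_at H Q ^+ m
         = eval_at q Q ^+ (m'.-1 * m) * eval_at q Q ^+ m * eval_at t2 Q ^+ m.
        rewrite -exprMn mulrC ht // exprMn -exprM -exprD; congr (_ ^+ _ * _).
        by rewrite -{1}(prednK m'0) mulSn addnC.
      rewrite -[_ * _ * _ ^+ m]mulrA e2.
      transitivity (eval_at q Q ^+ (m'.-1 * m) * eval_at t2 Q ^+ m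
        * (eval_at q Q ^+ m * eval_at s2 Q) * f Q); first by ring.
      by rewrite -hs //; ring.
  - by rewrite eval_atM eval_atX mulf_neq0 ?expf_neq0.
have HM := dhomogMn M HD.
have [k [g [_ gd h]]] := RE _ _ HM (hM _ _ HM (leq_pmull _ D0)).
exists (M + k)%N, g; split; first by rewrite mulnDl [(M * D)%N]mulnC.
move=> P WP; have [_ HP] := WP; rewrite -h // eval_atX -exprD mulrAC divff ?mul1r //.
by rewrite expf_neq0.
Qed.

Variable G : {mpoly L[n.+1]}.
Hypotheses (GD : G \is D.-homog).
Hypothesis GH : forall P, X P -> eval_at G P = 0 -> eval_at H P = 0 -> False.

(** [G], [H] and the equations of [X] have no common zero in projective space. *)
Lemma forms_generated : exists M, forall d e, e \is d.-homog -> (M <= d)%N ->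
  (D <= d)%N -> exists a b, [/\ a \is (d - D).-homog, b \is (d - D).-homog &
    forall P, X P -> eval_at e P = eval_at a P * eval_at G P + eval_at b P * eval_at H P].
Proof.
pose R d e a b := [/\ a * G \is d.-homog, b * H \is d.-homog &
    forall P, X P -> eval_at e P = eval_at a P * eval_at G P + eval_at b P * eval_at H P].
pose E e := exists d a b, e \is d.-homog /\ R d e a b.
have RE d e : e \is d.-homog -> E e -> exists a b, R d e a b.
  move=> ed [d' [a [b [ed' Rab]]]].
  have [e0|e0] := eqVneq e 0; last by exists a, b; rewrite (dhomog_uniq e0 ed ed').
  exists 0, 0; split=> [||P _]; rewrite ?mul0r ?rpred0 //.
  by rewrite e0 !eval_at0 !mul0r addr0.
have [||||M hM] := @projective_nullstellensatz L n E.
- exists 0%N, 0, 0; split; [exact: rpred0|split=> [||P _]; rewrite ?mul0r ?rpred0 //].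
  by rewrite !eval_at0 !mul0r addr0.
- move=> d e1 e2 ed1 ed2 /(RE d _ ed1)[a1 [b1 [h1 k1 l1]]] /(RE d _ ed2)[a2 [b2 [h2 k2 l2]]].
  exists d, (a1 + a2), (b1 + b2); split; first exact: rpredD.
  split=> [||P XP]; rewrite ?mulrDl ?rpredD //.
  by rewrite !eval_atD l1 // l2 //; ring.
- move=> d e c f cd fe /(RE e _ fe)[a [b [h1 h2 h3]]].
  exists (d + e)%N, (c * a), (c * b); split; first exact: dhomogM.
  split=> [||P XP]; rewrite -?mulrA; [exact: dhomogM|exact: dhomogM|].
  by rewrite !eval_atM h3 //; ring.
- move=> P; have [XP|nXP] := pselect (X P); last first.
    have [d [e [ed eP eX]]] := form_off_closed nXP.
    exists d, e; split=> //; exists d, 0, 0; split=> //.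
    split=> [||Q XQ]; rewrite ?mul0r ?rpred0 //.
    by rewrite !eval_at0 eX // !mul0r addr0.
  have [GP|GP] := eqVneq (eval_at G P) 0; last first.
    exists D, G; split=> //; exists D, 1, 0; split=> //.
    split=> [||Q XQ]; rewrite ?mul0r ?mul1r ?rpred0 //.
    by rewrite eval_at0 eval_at1 mul1r mul0r addr0.
  exists D, H; split=> //.
    exists D, 0, 1; split=> //; split=> [||Q XQ]; rewrite ?mul0r ?mul1r ?rpred0 //.
    by rewrite eval_at0 eval_at1 mul1r mul0r add0r.
  by apply/eqP => HP; apply: GH XP GP HP.
exists M => d e ed Md Dd; have [a [b [ha hb hab]]] := RE _ _ ed (hM d e ed Md).
exists (pihomog mdeg (d - D) a), (pihomog mdeg (d - D) b); split; try exact: pihomogP.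
move=> P XP; rewrite hab // -!eval_atM.
by rewrite -(pihomogM _ GD Dd) -(pihomogM _ HD Dd) !pihomog_dE.
Qed.

(** By the preceding lemma a form of large degree is a polynomial in [G] and [H]
    with coefficients in a fixed degree; dividing by a power of [H] gives
    generators over the polynomials in G / H. *)
Lemma finite_chart m (V : proj L m -> Prop) (phi : proj L n -> proj L m) tau :
  (forall P, W P -> V (phi P)) -> regular_fun V tau ->
  (forall P, W P -> tau (phi P) = eval_at G P / eval_at H P) ->
  finite_over W V phi.
Proof.
move=> WV regtau tauE; have [k0 hk0] := forms_generated.
pose T := {ffun 'I_(k0 * D) -> 'I_n.+1}.
exists #|{: T}|, (fun i P => eval_at (mono L (enum_val i : T)) P / eval_at (H ^+ k0) P).
have regb (g : {mpoly L[n.+1]}) : g \is (k0 * D).-homog ->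
    regular_fun W (fun P => eval_at g P / eval_at (H ^+ k0) P).
  move=> gd P WP; apply: (regular_frac (d := (k0 * D)%N)) => //.
    by rewrite mulnC; apply: dhomogMn.
  by rewrite eval_atX expf_neq0 //; case: WP.
split=> [i|f regf]; first by apply/regb/mono_homog.
pose Mod (f : proj L n -> L) := exists a : 'I_#|{: T}| -> proj L m -> L,
  (forall i, regular_fun V (a i)) /\ forall P, W P ->
    f P = \sum_i a i (phi P) * (eval_at (mono L (enum_val i)) P / eval_at (H ^+ k0) P).
rewrite -/(Mod f).
have Mext f1 f2 : (forall P, W P -> f1 P = f2 P) -> Mod f1 -> Mod f2.
  by move=> e [a [ra ha]]; exists a; split=> // P WP; rewrite -e ?ha.
have MD f1 f2 : Mod f1 -> Mod f2 -> Mod (fun P => f1 P + f2 P).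
  move=> [a1 [r1 h1]] [a2 [r2 h2]]; exists (fun i R => a1 i R + a2 i R); split.
    by move=> i R VR; apply: regular_add; [apply: r1|apply: r2].
  move=> P WP; rewrite h1 // h2 // -big_split; apply: eq_bigr => i _.
  by rewrite /= mulrDl.
have MM f1 : Mod f1 -> Mod (fun P => eval_at G P / eval_at H P * f1 P).
  move=> [a1 [r1 h1]]; exists (fun i R => tau R * a1 i R); split.
    by move=> i R VR; apply: regular_mul; [apply: regtau|apply: r1].
  move=> P WP; rewrite h1 // -tauE // mulr_sumr; apply: eq_bigr => i _.
  by rewrite mulrA.
have Mform k : forall g, g \is ((k0 + k) * D).-homog ->
    Mod (fun P => eval_at g P / eval_at H P ^+ (k0 + k)).
  elim: k => [|k IH] g gd.
    rewrite addn0 in gd *; have [h hg] := mono_span gd.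
    exists (fun i _ => h (enum_val i)); split=> [i R VR|P WP]; first exact: regular_cst.
    rewrite {1}hg eval_at_sum mulr_suml (reindex _ (onW_bij _ (@enum_val_bij T))) /=.
    apply: eq_bigr => i _.
    by rewrite eval_atZ eval_atX mulrA.
  have d1 : (k0 <= (k0 + k.+1) * D)%N.
    by rewrite (leq_trans (leq_pmulr k0 D0)) // leq_mul2r leq_addr orbT.
  have d2 : (D <= (k0 + k.+1) * D)%N by rewrite addnS leq_pmull.
  have [a [b [ha hb hab]]] := hk0 _ _ gd d1 d2.
  have e : ((k0 + k.+1) * D - D = (k0 + k) * D)%N by rewrite addnS mulSn addKn.
  rewrite e in ha hb; apply: Mext (MD _ _ (MM _ (IH a ha)) (IH b hb)) => P [XP HP].
  by rewrite hab // addnS exprS; field; rewrite HP expf_neq0.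
have [k [g [gd fg]]] := regular_on_complement regf.
have gH : g * H ^+ k0 \is ((k0 + k) * D).-homog.
  by rewrite addnC mulnDl; apply: dhomogM => //; rewrite mulnC; apply: dhomogMn.
apply: Mext (Mform k _ gH) => P WP; rewrite fg // eval_atM eval_atX exprD.
by have [_ HP] := WP; field; rewrite !expf_neq0.
Qed.

End Chart.

(** * Conjugate points *)

Section Galois.
Variables (K : fieldType) (L : closedFieldType) (iota : {rmorphism K -> L}).
Hypothesis algL : algebraic_closure iota.

(** An equation of least degree for [a] has a nonzero constant term. *)
Lemma algebraic_inverse a : a != 0 -> exists r : {poly K}, a * (map_poly iota r).[a] = 1.
Proof.
move=> a0; have [m [p [p0 pa <-]] min] := @nat_minimal
    (fun m => exists p : {poly K}, [/\ p != 0, root (map_poly iota p) a & size p = m])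
    (let: ex_intro2 p p0 pa := algL a in ex_intro _ (size p) (ex_intro _ p (And3 p0 pa erefl))).
have [q [c e]] : exists q c, p = q * 'X + c%:P.
  by elim/poly_ind: p {p0 pa min} => [|q c _]; [exists 0, 0; rewrite mul0r addr0|exists q, c].
have c0 : c != 0.
  apply: contraTneq p0 => c0; rewrite negbK; apply/eqP.
  have [q0|q0] := eqVneq q 0; first by rewrite e q0 c0 mul0r addr0.
  have := min (size q); rewrite e c0 addr0 size_mulX // ltnn => h.
  suff : false by []. apply: h; exists q; split=> //.
  move: pa; rewrite /root e c0 addr0 rmorphM /= map_polyX hornerM hornerX mulf_eq0.
  by rewrite (negPf a0) orbF.
exists (- c^-1 *: q); rewrite map_polyZ hornerZ.
move: pa; rewrite /root e rmorphD rmorphM /= map_polyX map_polyC hornerMXaddC /= => /eqP pa.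
have ic0 : iota c != 0 by rewrite fmorph_eq0.
have ce : iota c = - ((map_poly iota q).[a] * a).
  by apply/eqP; rewrite -addr_eq0 addrC pa.
rewrite rmorphN fmorphV; move: ic0; rewrite ce oppr_eq0 mulf_eq0 negb_or => /andP[q0 _].
by field; rewrite oppr_eq0 mulf_neq0.
Qed.

(** Graphs of ring homomorphisms over [K] from a subring of [L] to [L]. *)
Definition partial_hom (A : L -> L -> Prop) :=
  [/\ forall a, A (iota a) (iota a),
      forall x y x' y', A x y -> A x' y' -> A (x + x') (y + y'),
      forall x y x' y', A x y -> A x' y' -> A (x * x') (y * y') &
      forall y, A 0 y -> y = 0].

Section PartialHom.
Variable A : L -> L -> Prop.
Hypothesis hA : partial_hom A.

Lemma partial_hom0 : A 0 0.
Proof. by case: hA => h _ _ _; rewrite -(rmorph0 iota). Qed.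

Lemma partial_hom1 : A 1 1.
Proof. by case: hA => h _ _ _; rewrite -(rmorph1 iota). Qed.

Lemma partial_homB x y x' y' : A x y -> A x' y' -> A (x - x') (y - y').
Proof.
case: hA => hK hD hM _ xy xy'; apply: (hD) => //; rewrite -[- x']mulN1r -[- y']mulN1r.
by apply: (hM) => //; rewrite -(rmorphN1 iota).
Qed.

Lemma partial_hom_fun x y y' : A x y -> A x y' -> y = y'.
Proof.
move=> xy xy'; apply/eqP; rewrite -subr_eq0; apply/eqP.
have [_ _ _] := hA; apply; rewrite -(subrr x); exact: partial_homB.
Qed.

Lemma partial_hom_sum (I : Type) (r : seq I) (F F' : I -> L) :
  (forall i, A (F i) (F' i)) -> A (\sum_(i <- r) F i) (\sum_(i <- r) F' i).
Proof.
move=> h; have [_ hD _ _] := hA.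
apply: (big_ind2 A) => [|u u' w w' h1 h2|i _]; [exact: partial_hom0|exact: hD|exact: h].
Qed.

Lemma partial_hom_horner (r : {poly K}) x y : A x y ->
  A (map_poly iota r).[x] (map_poly iota r).[y].
Proof.
move=> xy; have [hK hD hM _] := hA; elim/poly_ind: r => [|r c IH].
  by rewrite rmorph0 !horner0; apply: partial_hom0.
rewrite rmorphD rmorphM /= map_polyX map_polyC !hornerMXaddC /=.
by apply: (hD); [apply: (hM)|apply: hK].
Qed.

Lemma partial_hom_inv x y : A x y -> x != 0 -> exists y', A x^-1 y' /\ y * y' = 1.
Proof.
move=> xy x0; have [r hr] := algebraic_inverse x0.
have e : x^-1 = (map_poly iota r).[x] by apply: (mulfI x0); rewrite divff.
have [hK hD hM _] := hA.
exists (map_poly iota r).[y]; split; first by rewrite e; apply: partial_hom_horner.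
apply: (@partial_hom_fun 1); last exact: partial_hom1.
by rewrite -hr; apply: hM => //; apply: partial_hom_horner.
Qed.

(** Adjoin [x], sending it to a root of the image of its minimal polynomial. *)
Lemma partial_hom_extend x : exists A', [/\ partial_hom A',
  forall u w, A u w -> A' u w & exists y, A' x y].
Proof.
have [hK hD hM h0] := hA.
pose R (q q' : {poly L}) := forall i, A q`_i q'`_i.
have [N [p [p' [[Rp p0 px] pN]]] min] : exists2 N,
    exists p p', [/\ R p p', p != 0 & p.[x] = 0] /\ size p = N &
    forall k, (exists p p', [/\ R p p', p != 0 & p.[x] = 0] /\ size p = k) -> (N <= k)%N.
  apply: nat_minimal; have [p p0 px] := algL x.
  exists (size (map_poly iota p)), (map_poly iota p), (map_poly iota p); split=> //.
  by split; [move=> i; rewrite coef_map; apply: hK|rewrite map_poly_eq0|apply/eqP].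
have {p p' Rp p0 px pN min N} [p [p' [Rp pmon px p'mon min]]] : exists p p',
   [/\ R p p', p \is monic, p.[x] = 0, p'`_(size p).-1 = 1 &
     forall q q', R q q' -> q.[x] = 0 -> (size q < size p)%N -> q = 0].
  have lp0 : lead_coef p != 0 by rewrite lead_coef_eq0.
  have [b' [Ab' bb']] := partial_hom_inv (Rp (size p).-1) lp0.
  have sp : size ((lead_coef p)^-1 *: p) = size p by rewrite size_scale ?invr_eq0.
  exists ((lead_coef p)^-1 *: p), (b' *: p'); split.
  - by move=> i; rewrite !coefZ; apply: hM.
  - by rewrite monicE lead_coefZ mulVf.
  - by rewrite hornerZ px mulr0.
  - by rewrite sp coefZ mulrC.
  - rewrite sp pN => q q' Rq qx qN; apply/eqP; apply: contraTT qN => q0.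
    by rewrite -leqNgt; apply: min; exists q, q'.
have small q q' : R q q' -> q = 0 -> q' = 0.
  by move=> Rq q0; apply/polyP => i; rewrite coef0; apply: h0; have := Rq i; rewrite q0 coef0.
have p0 : p != 0 by rewrite monic_neq0.
have p1 : (1 < size p)%N.
  rewrite ltnNge; apply/negP => /size1_polyC e; move: p0 px; rewrite e hornerC polyC_eq0.
  by move=> /eqP.
have p'1 : size p' != 1%N.
  apply/eqP => e; move/eqP: p'mon; rewrite nth_default ?e; last by case: (size p) p1 => [|[|]].
  by rewrite eq_sym oner_eq0.
have [y /eqP p'y] := closed_rootP p' p'1.
have key N (q q' : {poly L}) : (size q <= N)%N -> R q q' -> q.[x] = 0 -> q'.[y] = 0.
  elim: N q q' => [|N IH] q q' qN Rq qx.
    move: qN; rewrite leqn0 size_poly_eq0 => /eqP q0.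
    by rewrite (small _ _ Rq q0) horner0.
  have [qp|pq] := ltnP (size q) (size p).
    by rewrite (small _ _ Rq (min _ _ Rq qx qp)) horner0.
  pose k := (size q - size p)%N; pose j := (size q).-1.
  pose q1 := q - q`_j *: ('X^k * p); pose q1' := q' - q'`_j *: ('X^k * p').
  have R1 : R q1 q1'.
    move=> i; rewrite !coefB !coefZ !coefXnM; apply: partial_homB => //.
    by apply: hM => //; case: ifP => _; [apply: partial_hom0|apply: Rp].
  have := IH q1 q1'; rewrite /q1 /q1' !hornerD !hornerN !hornerZ !hornerM px p'y !mulr0 !subr0.
  apply=> //; apply/leq_sizeP => i Ni.
  rewrite coefB coefZ coefXnM.
  have ji : (j <= i)%N by rewrite /j; lia.
  have sq0 : (0 < size q)%N by apply: leq_trans pq; rewrite (ltn_trans _ p1).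
  have ki : (k <= i)%N by rewrite /k /j in ji *; lia.
  rewrite ltnNge ki /=; have [ij|ij] := eqVneq i j.
    have -> : (i - k = (size p).-1)%N by rewrite ij /j /k; lia.
    by move/monicP: (pmon); rewrite lead_coefE ij => ->; rewrite mulr1 subrr.
  have {}ij : ((size q).-1 < i)%N by rewrite ltn_neqAle eq_sym ij.
  rewrite [q`_i]nth_default; last by rewrite -(prednK sq0).
  rewrite [p`_(i - k)]nth_default ?mulr0 ?subrr //.
  by rewrite leq_subRL // subnK // -(prednK sq0).
exists (fun u w => exists q q', [/\ R q q', u = q.[x] & w = q'.[y]]); split.
- split=> [a|u w u' w'|u w u' w'|w].
  + exists (iota a)%:P, (iota a)%:P; rewrite !hornerC; split=> // i.
    by rewrite coefC; case: ifP => _; [apply: hK|apply: partial_hom0].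
  + move=> [q [q' [Rq -> ->]]] [r [r' [Rr -> ->]]].
    exists (q + r), (q' + r'); rewrite !hornerD; split=> // i.
    by rewrite !coefD; apply: hD.
  + move=> [q [q' [Rq -> ->]]] [r [r' [Rr -> ->]]].
    exists (q * r), (q' * r'); rewrite !hornerM; split=> // i.
    by rewrite !coefM; apply: partial_hom_sum => k; apply: hM.
  + by move=> [q [q' [Rq e ->]]]; apply: (key (size q) q).
- move=> u w uw; exists u%:P, w%:P; rewrite !hornerC; split=> // i.
  by rewrite !coefC; case: ifP => _; [|apply: partial_hom0].
- exists y; exists 'X, 'X; rewrite !hornerX; split=> // i.
  by rewrite coefX; case: eqP => _; [apply: partial_hom1|apply: partial_hom0].
Qed.

End PartialHom.

Lemma partial_hom_ext (A B : L -> L -> Prop) :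
  (forall x y, A x y <-> B x y) -> partial_hom A -> partial_hom B.
Proof.
move=> e [hK hD hM h0]; split=> [a|x y x' y' /e ? /e ?|x y x' y' /e ? /e ?|y /e].
- exact/e.
- by apply/e; apply: hD.
- by apply/e; apply: hM.
- exact: h0.
Qed.

(** By [partial_hom_extend] a maximal graph is total.  Zorn's lemma is applied to the
    sets whose union with [A] is such a graph, which include the empty set. *)
Lemma partial_hom_total A : partial_hom A ->
  exists C, [/\ partial_hom C, forall x y, A x y -> C x y & forall x, exists y, C x y].
Proof.
move=> hA; pose U (B : L * L -> Prop) x y := B (x, y) \/ A x y.
have [F FP Ftot|B [hB Bmax]] :=
    @classical_sets.Zorn_bigcup (L * L)%type (fun B => partial_hom (U B)).
  set V := classical_sets.bigcup _ _.
  have AV x y : A x y -> U V x y by right.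
  have XV X x y : F X -> U X x y -> U V x y.
    by move=> FX [xX|]; [left; exists X|right].
  have common x y x' y' : U V x y -> U V x' y' ->
      exists C, [/\ partial_hom C, C x y, C x' y' & forall u w, C u w -> U V u w].
    case=> [[X FX Xp]|Ap] [[X' FX' Xp']|Ap'].
    - case: (Ftot _ _ FX FX') => XX; [exists (U X')|exists (U X)]; split=> //.
      + exact: FP.
      + by left; apply: XX.
      + by left.
      + by move=> u w; apply: XV.
      + exact: FP.
      + by left.
      + by left; apply: XX.
      + by move=> u w; apply: XV.
    - exists (U X); split=> //; [exact: FP|by left|by right|].
      by move=> u w; apply: XV.
    - exists (U X'); split=> //; [exact: FP|by right|by left|].
      by move=> u w; apply: XV.
    - by exists A.
  split=> [a|x y x' y' h h'|x y x' y' h h'|y h].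
  - by apply: AV; case: hA.
  - have [C [[_ hD _ _] Cp Cp' CV]] := common _ _ _ _ h h'; exact/CV/hD.
  - have [C [[_ _ hM _] Cp Cp' CV]] := common _ _ _ _ h h'; exact/CV/hM.
  - by have [C [[_ _ _ h0] Cp Cp' CV]] := common _ _ _ _ h h; apply: h0.
exists (U B); split=> // [x y|x]; first by right.
have [A' [hA' BA' [y xy]]] := partial_hom_extend hB x.
exists y; apply: contrapT => nxy; apply: (Bmax (fun z => A' z.1 z.2)).
  split=> [[u w] Buw|/(_ (x, y) xy) Bxy]; first by apply: BA'; left.
  by apply: nxy; left.
apply: partial_hom_ext hA' => u w; split=> [|[]//]; first by left.
by move=> Auw; apply: BA'; right.
Qed.

(** A total homomorphism is onto, because it permutes the finitely many roots of
    each polynomial over [K]. *)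
Lemma galois_aut_extends A : partial_hom A ->
  exists2 s : {rmorphism L -> L}, galois_aut iota s & forall x y, A x y -> s x = y.
Proof.
move=> /partial_hom_total[C [hC AC /choice[s0 Cs]]].
have fC := partial_hom_fun hC; have [hK hD hM h0] := hC.
have sB : zmod_morphism s0.
  by move=> x y; apply: (fC (x - y)); [exact: Cs|apply: partial_homB].
have sM : monoid_morphism s0.
  split; first by apply: (fC 1); [exact: Cs|exact: partial_hom1].
  by move=> x y; apply: (fC (x * y)); [exact: Cs|apply: hM].
pose s : {rmorphism L -> L} := HB.pack s0
  (GRing.isZmodMorphism.Build L L s0 sB) (GRing.isMonoidMorphism.Build L L s0 sM).
exists s; last by move=> x y /AC xy; apply: (fC x); [exact: Cs|].
have siota a : s (iota a) = iota a by apply: (fC (iota a)); [exact: Cs|exact: hK].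
split=> //.
have sinj : injective s := fmorph_inj s.
have /choice[t ht] y : exists x, s x = y.
  have [p p0 py] := algL y.
  have [rs ers] := closed_field_poly_normal (map_poly iota p).
  have lp0 : lead_coef (map_poly iota p) != 0 by rewrite lead_coef_eq0 map_poly_eq0.
  have rootE x : root (map_poly iota p) x = (x \in undup rs).
    by rewrite mem_undup ers rootZ // root_prod_XsubC.
  have [|||_ e] := @uniq_min_size _ (map s (undup rs)) (undup rs).
  - by rewrite map_inj_uniq // undup_uniq.
  - move=> _ /mapP[x xr ->]; rewrite -rootE in xr.
    suff : root (map_poly iota p) (s x) by rewrite rootE.
    have sp : map_poly s (map_poly iota p) = map_poly iota p.
      by apply/polyP => i; rewrite !coef_map; apply: siota.
    by have /eqP h := xr; rewrite /root -sp horner_map h rmorph0.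
  - by rewrite size_map.
  by have := py; rewrite rootE -e => /mapP[x _ ->]; exists x.
by exists t => [x|x]; [apply: sinj; rewrite ht|rewrite ht].
Qed.

(** The residue field of [P] over [K] maps onto that of [Q]; as it is a field, this
    is an isomorphism, and its inverse extends to [L]. *)
Lemma conjugate_of_ideals n (P Q : proj L n) :
  (forall d f, f \is d.-homog -> eval_at (map_mpoly iota f) P = 0 ->
     eval_at (map_mpoly iota f) Q = 0) ->
  conjugate iota Q P.
Proof.
move=> PQ; have [j Qj] := coords_ex Q.
have Pj : coords P ord0 j != 0.
  apply: contraNneq Qj => Pj; apply/eqP.
  have := PQ 1%N 'X_j (dhomogXU _ _); rewrite map_mpolyXU !eval_atXU; exact.
pose u i := coords P ord0 i / coords P ord0 j.
pose w i := coords Q ord0 i / coords Q ord0 j.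
pose ev v (q : {mpoly K[n.+1]}) : L := (map_mpoly iota q).@[v].
have homogenize R (q : {mpoly K[n.+1]}) : coords R ord0 j != 0 ->
    eval_at (map_mpoly iota (\sum_(d < msize q) pihomog mdeg d q * 'X_j ^+ (msize q - d))) R
    = coords R ord0 j ^+ msize q * ev (fun i => coords R ord0 i / coords R ord0 j) q.
  move=> Rj; rewrite /ev; have -> : map_mpoly iota q
      = map_mpoly iota (\sum_(d < msize q) pihomog mdeg d q).
    by rewrite -pihomog_partitionE.
  rewrite !(raddf_sum (map_mpoly iota)) eval_at_sum (raddf_sum (meval _)) mulr_sumr.
  apply: eq_bigr => d _; rewrite /= rmorphM rmorphXn /= map_mpolyXU eval_atM eval_atX eval_atXU.
  have qd := dhomog_map iota (pihomogP mdeg d q).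
  rewrite [eval_at _ R](_ : _ = coords R ord0 j ^+ d *
     (map_mpoly iota (pihomog mdeg d q)).@[fun i => coords R ord0 i / coords R ord0 j]).
    rewrite mulrAC -exprD subnKC //; exact/ltnW/ltn_ord.
  rewrite -(meval_scale _ _ qd); apply: meval_eq => i /=.
  by rewrite mulrC divfK.
have uw q : ev u q = 0 -> ev w q = 0.
  move=> qu; pose f := \sum_(d < msize q) pihomog mdeg d q * 'X_j ^+ (msize q - d).
  have fh : f \is (msize q).-homog.
    apply: rpred_sum => d _.
    have := dhomogM (pihomogP mdeg d q) (dhomogMn (msize q - d) (dhomogXU K j)).
    by rewrite mul1n subnKC // ltnW.
  have := PQ _ f fh; rewrite /f !homogenize // -/u -/w qu mulr0 => /(_ erefl)/eqP.
  by rewrite mulf_eq0 expf_eq0 (negPf Qj) andbF => /eqP.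
have wu q : ev w q = 0 -> ev u q = 0.
  move=> qw; apply/eqP; apply: contrapT => /negP qu.
  have [r hr] := algebraic_inverse qu.
  pose rq := (map_poly (@mpolyC n.+1 K) r).[q].
  have evr v : ev v rq = (map_poly iota r).[ev v q].
    rewrite /rq; elim/poly_ind: r {hr rq} => [|r c IH].
      by rewrite /ev !rmorph0 !horner0 !rmorph0.
    rewrite !rmorphD !rmorphM /= !map_polyX !map_polyC !hornerMXaddC /=.
    rewrite /ev rmorphD rmorphM mevalD mevalM /= map_mpolyC mevalC.
    by congr (_ * _ + _); apply: IH.
  have : ev w (q * rq - 1) = 0.
    by apply: uw; rewrite /ev rmorphB rmorphM rmorph1 mevalB mevalM meval1 -!/(ev u _) evr hr subrr.
  rewrite /ev rmorphB rmorphM rmorph1 mevalB mevalM meval1 -!/(ev w _) qw mul0r sub0r.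
  by move/eqP; rewrite oppr_eq0 oner_eq0.
have hA : partial_hom (fun x y => exists q, x = ev w q /\ y = ev u q).
  split=> [a|x y x' y' [q [-> ->]] [r [-> ->]]|x y x' y' [q [-> ->]] [r [-> ->]]|y [q [e ->]]].
  - by exists a%:MP; rewrite /ev map_mpolyC !mevalC.
  - by exists (q + r); rewrite /ev rmorphD !mevalD.
  - by exists (q * r); rewrite /ev rmorphM !mevalM.
  - exact: wu.
have [s sg sA] := galois_aut_extends hA; exists s => //.
have sw i : s (w i) = u i.
  by apply: sA; exists 'X_i; rewrite /ev map_mpolyXU !mevalXU.
have c0 : s (coords Q ord0 j) / coords P ord0 j != 0.
  by rewrite mulf_neq0 ?invr_eq0 // fmorph_eq0.
have -> : map_mx s (coords Q) = (s (coords Q ord0 j) / coords P ord0 j) *: coords P.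
  apply/rowP => i; rewrite !mxE.
  have -> : coords Q ord0 i = coords Q ord0 j * w i by rewrite /w mulrC divfK.
  by rewrite rmorphM sw /u; ring.
rewrite -coordsK; apply/eqP; rewrite eqEdim !dim_vline scaler_eq0 (negPf c0) coords_neq0 andbT.
rewrite -memvE; apply/vlineP; exists (s (coords Q ord0 j) / coords P ord0 j)^-1.
by rewrite scalerA mulVf ?scale1r.
Qed.

Lemma conjugate_ideals n (P Q : proj L n) (f : {mpoly K[n.+1]}) d : f \is d.-homog ->
  conjugate iota Q P -> eval_at (map_mpoly iota f) Q = 0 -> eval_at (map_mpoly iota f) P = 0.
Proof.
move=> fd [s [_ sK] e] fQ; have fd' := dhomog_map iota fd.
have v0 : map_mx s (coords Q) != 0 by rewrite map_mx_eq0 coords_neq0.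
apply/eqP; rewrite (eval_line_eq0 v0 e fd').
have -> : (map_mpoly iota f).@[(map_mx s (coords Q)) ord0] = s (eval_at (map_mpoly iota f) Q).
  rewrite -(meval_map s); have -> : map_mpoly s (map_mpoly iota f) = map_mpoly iota f.
    by apply/mpolyP => m; rewrite !mcoeff_map_mpoly /= sK.
  by apply: meval_eq => i; rewrite mxE.
by rewrite fQ rmorph0.
Qed.

End Galois.

(** * Maps to the projective line *)

Section Tangent.
Variables (L : fieldType) (m n : nat) (J : 'M[L]_(m, n.+1)).
Hypothesis rkJ : (\rank J + 1 = n)%N.

Lemma rank_transversal (g : 'rV[L]_n.+1) : ~~ (g <= J)%MS -> \rank (col_mx J g) = n.
Proof.
move=> gJ; rewrite -addsmxE; have lt : (\rank J < \rank (J + g)%MS)%N.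
  rewrite (ltn_leqif (mxrank_leqif_sup (addsmxSl J g))).
  by apply: contra gJ; apply: submx_trans; apply: addsmxSr.
have le : (\rank (J + g)%MS <= \rank J + 1)%N.
  apply: leq_trans (mxrank_adds_leqif J g).1 _.
  by rewrite leq_add2l rank_leq_row.
by move: lt le rkJ; lia.
Qed.

Lemma tangent_form (v : 'rV[L]_n.+1) : v != 0 -> exists2 l : 'rV[L]_n.+1,
  ~~ (l <= J)%MS & l *m v^T = 0.
Proof.
move=> v0; pose A := kermx v^T.
have rA : \rank A = n by rewrite mxrank_ker mxrank_tr rank_rV v0 subn1.
have /row_subPn[i hi] : ~~ (A <= J)%MS.
  by apply/negP => /mxrankS; rewrite rA -{1}rkJ addn1 ltnn.
exists (row i A) => //; apply/sub_kermxP; exact: row_sub.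
Qed.

End Tangent.

Section PointsFacts.
Variables (K : fieldType) (L : closedFieldType) (iota : {rmorphism K -> L}).
Variables (n : nat) (F : seq {mpoly K[n.+1]}).

Lemma points_closed : (forall f, f \in F -> f \is homog mdeg) ->
  zariski_closed (points iota F).
Proof.
move=> Fh; exists (fun f => exists2 g, g \in F & f = map_mpoly iota g); split.
  by move=> _ [g /Fh/homogP[d gd] ->]; apply: homogE (dhomog_map iota gd).
move=> P; split=> [XP _ [g gF ->]|h g gF]; first exact: XP.
by apply: h; exists g.
Qed.

Lemma curve_parameter P : curve iota F -> points iota F P -> exists q,
  [/\ q \is 1.-homog, eval_at q P = 0 & generates_at (points iota F) P 1 q].
Proof.
move=> [Fh _ _ smooth] XP; have rkJ := smooth P XP.
have [l lJ lv] := tangent_form rkJ (coords_neq0 P).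
pose q : {mpoly L[n.+1]} := \sum_i l ord0 i *: 'X_i.
have qd : q \is 1.-homog by apply: rpred_sum => i _; rewrite rpredZ ?dhomogXU.
have qP : eval_at q P = 0.
  move/matrixP/(_ ord0 ord0): lv; rewrite !mxE => <-; rewrite eval_at_sum.
  by apply: eq_bigr => i _; rewrite eval_atZ eval_atXU mxE.
have gq : grad q P = l.
  apply/rowP => k; rewrite mxE (raddf_sum (mderiv k)) eval_at_sum (bigD1 k) //=.
  rewrite big1 ?addr0 => [|i ik].
    by rewrite mderivZ mderivXU eqxx eval_atZ eval_at1 mulr1.
  by rewrite mderivZ mderivXU (negPf ik) scaler0 eval_at0.
exists q; split=> //; apply: generates_transversal => //.
by rewrite gq rank_transversal.
Qed.

End PointsFacts.

Lemma near_regular_neq0 (L : fieldType) n (X : proj L n -> Prop) P f :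
  X P -> regular_at X P f -> f P != 0 -> near_in X P (fun Q => f Q != 0).
Proof.
move=> XP [d [g [h [gd hd fgh]]]]; have [hP ->] := near_self XP fgh.
rewrite mulf_eq0 negb_or => /andP[gP _].
have ng : near_in X P (fun Q => eval_at g Q != 0) by apply: (near_basic gd).
apply: near_sub (near_and fgh ng) => Q XQ [[hQ ->] gQ].
by rewrite mulf_neq0 ?invr_eq0.
Qed.

Lemma regular_exp (L : fieldType) n (X : proj L n -> Prop) P f k :
  X P -> regular_at X P f -> regular_at X P (fun Q => f Q ^+ k).
Proof.
move=> XP rf; elim: k => [|k IH]; first exact: regular_cst.
by have := regular_mul rf IH; under eq_fun do rewrite -exprS.
Qed.

Section MapToLine.
Variables (L : closedFieldType) (n : nat) (X : proj L n -> Prop).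
Variables (D : nat) (G H : {mpoly L[n.+1]}).
Hypotheses (GD : G \is D.-homog) (HD : H \is D.-homog).
Hypothesis GH : forall P, X P -> eval_at G P = 0 -> eval_at H P = 0 -> False.

Definition line_vec P : 'rV[L]_2 := \row_i eval_at (if i == ord0 then G else H) P.

Definition line_map P : proj L 1 := topt (line_vec P).

Lemma line_vec_neq0 P : X P -> line_vec P != 0.
Proof.
move=> XP; apply/eqP => /rowP e; apply: (GH XP).
- by have := e ord0; rewrite !mxE.
- by have := e ord_max; rewrite !mxE.
Qed.

Lemma val_line_map P : X P -> val (line_map P) = <[line_vec P]>%VS.
Proof. by move/line_vec_neq0/val_topt. Qed.

Lemma line_map_eval P : X P -> exists2 c, c != 0 & forall d f, f \is d.-homog ->
  eval_at f (line_map P) = c ^+ d * eval_at (f \mPo [tuple G; H]) P.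
Proof.
move=> XP; have [c c0 h] := eval_line (line_vec_neq0 XP) (val_line_map XP).
exists c => // d f fd; rewrite (h d f fd) /eval_at comp_mpoly_meval; congr (_ * _).
apply: meval_eq => i; rewrite mxE (tnth_nth 0).
by case: i => [[|[|]]].
Qed.

Lemma line_map0 P : X P -> (eval_at 'X_ord0 (line_map P) == 0) = (eval_at G P == 0).
Proof.
move=> XP; rewrite (eval_line_eq0 (line_vec_neq0 XP) (val_line_map XP) (dhomogXU _ _)).
by rewrite mevalXU !mxE.
Qed.

Lemma line_map1 P : X P -> (eval_at 'X_ord_max (line_map P) == 0) = (eval_at H P == 0).
Proof.
move=> XP; rewrite (eval_line_eq0 (line_vec_neq0 XP) (val_line_map XP) (dhomogXU _ _)).
by rewrite mevalXU !mxE.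
Qed.

Lemma line_map_infty P : X P -> line_map P = infty L <-> eval_at H P = 0.
Proof.
move=> XP; have inf0 : delta_mx ord0 ord0 != 0 :> 'rV[L]_2 by apply: delta_row_neq0.
have vinf : val (infty L) = <[delta_mx ord0 ord0]>%VS by [].
split=> [e|HP].
  apply/eqP; rewrite -line_map1 // e (eval_line_eq0 inf0 vinf (dhomogXU _ _)).
  by rewrite mevalXU !mxE.
have [c c0 e] := coords_line (line_vec_neq0 XP) (val_line_map XP).
have GP : eval_at G P != 0 by apply/eqP => GP; apply: (GH XP).
apply: esym; apply: (@val_inj_line _ _ _ _ (delta_mx ord0 ord0) (eval_at G P)) => //.
rewrite val_line_map //; congr <[_]>%VS; apply/rowP => i; rewrite !mxE.
by case: i => [[|[|]]] //= _; rewrite ?mulr1 ?mulr0.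
Qed.

Lemma comp_homog d f : f \is d.-homog -> f \mPo [tuple G; H] \is (d * D).-homog.
Proof.
move=> fd; apply: dhomog_comp => // i; rewrite (tnth_nth 0).
by case: i => [[|[|]]].
Qed.

Lemma near_line_map P (A : proj L 1 -> Prop) : X P ->
  near_in (@projT L 1) (line_map P) A -> near_in X P (fun Q => A (line_map Q)).
Proof.
move=> XP /near_basicP[b [d [bd bP bA]]].
apply: (near_basic (comp_homog bd)).
  by have [c c0 h] := line_map_eval XP; move: bP; rewrite (h d b bd) mulf_eq0 negb_or => /andP[].
move=> Q XQ bQ; apply: bA => //; have [c c0 h] := line_map_eval XQ.
by rewrite (h d b bd) mulf_neq0 ?expf_neq0.
Qed.

Lemma regular_line_map P (f : proj L 1 -> L) : X P ->
  regular_at (@projT L 1) (line_map P) f -> regular_at X P (f \o line_map).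
Proof.
move=> XP [d [a [b [ad bd fab]]]].
exists (d * D)%N, (a \mPo [tuple G; H]), (b \mPo [tuple G; H]).
split; [exact: comp_homog|exact: comp_homog|].
apply: near_sub (near_line_map XP fab) => Q XQ /= [bQ ->].
have [c c0 h] := line_map_eval XQ; move: bQ; rewrite !(h d) //.
have cd : c ^+ d != 0 by rewrite expf_neq0.
rewrite mulf_eq0 negb_or cd /= => bQ; split=> //.
by field; rewrite bQ cd.
Qed.

(** An affine coordinate at the image of a point where the map is finite pulls
    back to [fiber_form P] divided by [H]. *)
Definition fiber_form P := eval_at H P *: G - eval_at G P *: H.

Lemma fiber_form_homog P : fiber_form P \is D.-homog.
Proof. by rewrite rpredB ?rpredZ. Qed.

Lemma fiber_form_eval P : eval_at (fiber_form P) P = 0.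
Proof. by rewrite eval_atB !eval_atZ mulrC subrr. Qed.

Hypothesis Xirr : irreducible X.
Hypothesis X2 : exists P Q, [/\ X P, X Q & P <> Q].

(** A function generating the maximal ideal cannot be divisible by its square
    unless it vanishes near the point, and then the curve is that point. *)
Lemma line_map_unramified P : X P -> eval_at H P != 0 ->
  generates_at X P D (fiber_form P) -> ~ ramified X line_map P.
Proof.
move=> XP HP gen [e [t [rt t0 tdiv] [tau [u [[rtau tau0 _] ru _ te]]]] e1].
set q := fiber_form P in gen; have qD : q \is D.-homog := fiber_form_homog P.
have qP : eval_at q P = 0 := fiber_form_eval P.
pose l : {mpoly L[2]} := eval_at H P *: 'X_ord0 - eval_at G P *: 'X_ord_max.
have lh : l \is 1.-homog by rewrite rpredB ?rpredZ ?dhomogXU.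
pose s R := eval_at l R / eval_at 'X_ord_max R.
have lmap Q : X Q -> s (line_map Q) = eval_at q Q / eval_at H Q.
  move=> XQ; rewrite /s; have [c c0 h] := line_map_eval XQ.
  rewrite (h 1%N l lh) (h 1%N 'X_ord_max (dhomogXU _ _)) !expr1 invfM mulrACA divff // mul1r.
  rewrite comp_mpolyXU /l comp_mpolyB !comp_mpolyZ !comp_mpolyXU /=.
  by [].
have rs : regular_at (@projT L 1) (line_map P) s.
  by apply: (regular_frac (d := 1%N)); rewrite ?dhomogXU // line_map1.
have [g rg sg] := tdiv s rs (etrans (lmap P XP) (eq_trans (congr1 (fun x => x / _) qP) (mul0r _))).
have [_ _ sdiv] := generates_uniformizer XP qD qP gen HD HP.
have [r rr tr] := sdiv tau rtau tau0.
pose w Q := g (line_map Q) * u Q * r Q ^+ e.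
have rw : regular_at X P w.
  apply: regular_mul; last exact: regular_exp.
  by apply: regular_mul => //; apply: (@regular_line_map P g XP rg).
pose z Q := 1 - w Q * (eval_at q Q / eval_at H Q) ^+ e.-1.
have rz : regular_at X P z.
  have rq := regular_exp e.-1 XP (regular_frac XP qD HD HP).
  have := regular_add (regular_cst 1 XP) (regular_mul (regular_cst (-1) XP) (regular_mul rw rq)).
  by under eq_fun do rewrite mulN1r.
have zP : z P != 0.
  by rewrite /z qP mul0r expr0n; case: (e) e1 => [|[|k]] //= _; rewrite mulr0 subr0 oner_neq0.
have nH : near_in X P (fun Q => eval_at H Q != 0) by apply: (near_basic HD).
have q0 : forall Q, X Q -> eval_at q Q = 0.
  apply: (irr_near Xirr qD XP).
  apply: near_sub (near_and (near_and (near_line_map XP sg) te)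
    (near_and tr (near_and nH (near_regular_neq0 XP rz zP)))) => Q XQ [[sQ teQ] [trQ [HQ zQ]]].
  have : eval_at q Q / eval_at H Q = w Q * (eval_at q Q / eval_at H Q) ^+ e.
    by rewrite -{1}lmap // sQ [t _]teQ trQ /w exprMn; ring.
  rewrite -{1}(prednK (ltnW e1)) exprS => eq1.
  have : eval_at q Q / eval_at H Q * z Q = 0.
    rewrite /z mulrBr mulr1 {1}eq1; ring.
  by move/eqP; rewrite !mulf_eq0 (negPf zQ) invr_eq0 (negPf HQ) !orbF => /eqP.
have [N [E [EN EP _ gen']]] := gen.
have all0 k h : h \is k.-homog -> eval_at h P = 0 -> forall Q, X Q -> eval_at h Q = 0.
  move=> hk hP; have [s' _ hs'] := gen' k h hk hP.
  by apply: (irr_cancel Xirr hk EN XP EP) => Q XQ; rewrite hs' // q0 // mulr0.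
have eqP1 Q : X Q -> Q = P.
  move=> XQ; apply: proj_eqP => i j; apply/eqP; rewrite -subr_eq0; apply/eqP.
  have := all0 1%N (coords P ord0 j *: 'X_i - coords P ord0 i *: 'X_j).
  move=> h; rewrite [_ * coords P ord0 j]mulrC [_ * coords P ord0 i]mulrC.
  rewrite -!eval_atXU -!eval_atZ -eval_atB !eval_atXU; apply: h => //.
    by rewrite rpredB ?rpredZ ?dhomogXU.
  by rewrite eval_atB !eval_atZ !eval_atXU mulrC subrr.
by have [Q1 [Q2 [/eqP1 -> /eqP1 -> []]]] := X2.
Qed.

(** A zero of [H = C ^+ N] is a pole of order [N] times the order of [C]. *)
Lemma line_map_ramified P C N d q : X P -> C \is (D %/ N).-homog -> H = C ^+ N ->
  (1 < N)%N -> (N %| D)%N ->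
  eval_at C P = 0 -> (exists2 Q, X Q & eval_at C Q != 0) ->
  q \is d.-homog -> eval_at q P = 0 -> generates_at X P d q ->
  ramified X line_map P.
Proof.
move=> XP CD HC N1 ND CP CX qd qP gen.
have HP : eval_at H P = 0 by rewrite HC eval_atX CP expr0n; case: (N) N1.
have GP : eval_at G P != 0 by apply/eqP => GP; apply: (GH XP).
have [j Pj] := coords_ex P.
pose h : {mpoly L[n.+1]} := 'X_j ^+ d.
have hd : h \is d.-homog by have := dhomogMn d (dhomogXU L j); rewrite mul1n.
have hP : eval_at h P != 0 by rewrite eval_atX eval_atXU expf_neq0.
clearbody h; have unif := generates_uniformizer XP qd qP gen hd hP.
have [m [k1 [k2 [s1 [s2 [s1k s2k s1P s2P [ks hs]]]]]]] := finite_order XP qd qP gen Xirr CD CX.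
have m0 : (0 < m)%N.
  rewrite lt0n; apply/eqP => m0; have := hs P XP; rewrite m0 CP mul0r mul1r.
  by move/esym/eqP; rewrite (negPf s2P).
exists (m * N)%N; last by rewrite (leq_trans N1) // leq_pmull.
exists (fun R => eval_at 'X_ord_max R / eval_at 'X_ord0 R).
  have e : line_map P = infty L by apply/line_map_infty.
  rewrite e; have inf0 : delta_mx ord0 ord0 != 0 :> 'rV[L]_2 by apply: delta_row_neq0.
  have vinf : val (infty L) = <[delta_mx ord0 ord0]>%VS by [].
  apply: (generates_uniformizer (d := 1%N)); rewrite ?dhomogXU //.
  - by apply/eqP; rewrite (eval_line_eq0 inf0 vinf (dhomogXU _ _)) mevalXU !mxE.
  - have -> : @projT L 1 = points (idfun : {rmorphism L -> L}) [::].
      by apply/funext => R; apply/propext; split=> // _ f; rewrite in_nil.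
    apply: generates_transversal; rewrite ?dhomogXU //.
      by apply/eqP; rewrite (eval_line_eq0 inf0 vinf (dhomogXU _ _)) mevalXU !mxE.
    apply: rank_transversal; first by rewrite [jacobian _ _ _]flatmx0 mxrank0.
    apply/negP => /submxP[E]; rewrite [E]thinmx0 mul0mx => /rowP/(_ ord_max)/eqP.
    by rewrite !mxE mderivXU eqxx eval_at1 oner_eq0.
  - by rewrite (eval_line_eq0 inf0 vinf (dhomogXU _ _)) mevalXU !mxE oner_neq0.
exists (fun Q => eval_at q Q / eval_at h Q),
  (fun Q => eval_at (s2 ^+ N * h ^+ (m * N)) Q / eval_at (s1 ^+ N * G) Q).
have deg : (k2 * N + d * (m * N) = k1 * N + D)%N.
  have := congr1 (muln^~ N) ks; rewrite !mulnDl divnK // => ks'.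
  by rewrite mulnA [(d * m)%N]mulnC; move: ks'; clear; lia.
split=> //.
- apply: (regular_frac (d := (k1 * N + D)%N)) => //.
  + by rewrite -deg; apply: dhomogM; apply: dhomogMn.
  + by apply: dhomogM => //; apply: dhomogMn.
  + by rewrite eval_atM eval_atX mulf_neq0 ?expf_neq0.
- by rewrite !eval_atM !eval_atX mulf_neq0 ?invr_eq0 ?mulf_neq0 ?expf_neq0.
have nh : near_in X P (fun Q => eval_at h Q != 0) by apply: (near_basic hd).
have ns : near_in X P (fun Q => eval_at s1 Q != 0) by apply: (near_basic s1k).
have nG : near_in X P (fun Q => eval_at G Q != 0) by apply: (near_basic GD).
apply: near_sub (near_and nh (near_and ns nG)) => Q XQ [hQ [sQ GQ]].
have [c c0 ec] := line_map_eval XQ.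
rewrite /= !(ec 1%N _ (dhomogXU _ _)) !comp_mpolyXU /= !expr1.
rewrite !eval_atM !eval_atX HC eval_atX exprMn exprVn.
have -> : eval_at C Q = eval_at q Q ^+ m * eval_at s2 Q / eval_at s1 Q.
  by rewrite -hs // mulfK.
rewrite !exprMn exprVn -exprM.
by field; rewrite ?c0 ?GQ ?expf_neq0.
Qed.

End MapToLine.

Section FiniteMap.
Variables (K : fieldType) (L : closedFieldType) (iota : {rmorphism K -> L}).
Variables (n : nat) (F : seq {mpoly K[n.+1]}).
Hypothesis curveF : curve iota F.
Let X := points iota F.
Variables (D : nat) (G H : {mpoly K[n.+1]}).
Hypotheses (D0 : (0 < D)%N) (GD : G \is D.-homog) (HD : H \is D.-homog).
Let G' := map_mpoly iota G.
Let H' := map_mpoly iota H.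
Hypothesis GH : forall P, X P -> eval_at G' P = 0 -> eval_at H' P = 0 -> False.

(** Over each standard chart of the line lies the complement of [G] or of [H]. *)
Lemma line_map_finite_morphism :
  finite_morphism iota X (@projT L 1) (line_map G' H').
Proof.
have [Fh Xirr _ _] := curveF; have Xcl : zariski_closed X := points_closed iota Fh.
have GD' : G' \is D.-homog by apply: dhomog_map.
have HD' : H' \is D.-homog by apply: dhomog_map.
have Xsm P : X P -> exists d q,
    [/\ q \is d.-homog, eval_at q P = 0 & generates_at X P d q].
  by move=> XP; have [q hq] := curve_parameter curveF XP; exists 1%N, q.
split=> [P XP|Q _].
  split=> //; exists D, (fun i => if i == ord0 then G else H); split=> [i|].
    by case: ifP.
  apply: near_all => Q XQ; rewrite (val_line_map GH) //; congr <[_]>%VS.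
  by apply/rowP => i; rewrite !mxE; case: ifP.
have chart (i j : 'I_2) (A B : {mpoly L[n.+1]}) : A \is D.-homog -> B \is D.-homog ->
    (forall P, X P -> eval_at A P = 0 -> eval_at B P = 0 -> False) ->
    (forall P, X P -> (eval_at 'X_j (line_map G' H' P) == 0) = (eval_at B P == 0)) ->
    (forall P, X P -> eval_at B P != 0 -> eval_at 'X_i (line_map G' H' P)
       / eval_at 'X_j (line_map G' H' P) = eval_at A P / eval_at B P) ->
    eval_at 'X_j Q != 0 ->
    exists U : proj L 1 -> Prop,
    let V := fun R => projT R /\ U R in
    let W := fun P => X P /\ U (line_map G' H' P) in
    [/\ zariski_open U, U Q, affine V, affine W & finite_over W V (line_map G' H')].
  move=> AD BD AB jB quot jQ; exists (fun R => eval_at 'X_j R != 0) => V W.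
  have WE : W = (fun P => X P /\ eval_at B P != 0).
    by apply/funext => P; apply/propext; split=> -[XP BP]; split=> //; rewrite jB // in BP *.
  split=> //.
  - rewrite /zariski_open; have -> : (fun P => ~ eval_at 'X_j P != 0)
        = (fun P : proj L 1 => eval_at 'X_j P = 0).
      by apply/funext => P; apply/propext; split=> [/negP/negPn/eqP|->]; rewrite ?eqxx.
    exact: closed_form (dhomogXU _ _).
  - apply: (@affine_complement _ _ 1%N); rewrite ?dhomogXU //.
    by exists (fun=> False); split=> // P; split.
  - by rewrite WE; apply: (@affine_complement _ _ D).
  rewrite WE; apply: (finite_chart Xcl Xirr Xsm D0 BD AD AB
    (tau := fun R => eval_at 'X_i R / eval_at 'X_j R)).
  - by move=> P [XP BP]; split=> //; rewrite jB.
  - by move=> R [_ jR]; apply: (regular_frac (d := 1%N)); rewrite ?dhomogXU.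
  - by move=> P [XP BP]; apply: quot.
have quot (i j : 'I_2) P : X P -> eval_at [tuple G'; H']`_j P != 0 ->
    eval_at 'X_i (line_map G' H' P) / eval_at 'X_j (line_map G' H' P)
    = eval_at [tuple G'; H']`_i P / eval_at [tuple G'; H']`_j P.
  move=> XP jP; have [c c0 ec] := line_map_eval GH XP.
  by rewrite !(ec 1%N _ (dhomogXU _ _)) !comp_mpolyXU expr1; field; rewrite c0 jP.
have [Q1|Q1] := eqVneq (eval_at 'X_ord_max Q) 0.
  apply: (chart ord_max ord0 H' G') => //.
  - by move=> P XP h1 h2; apply: (GH XP).
  - by move=> P XP; apply: (line_map0 GH XP).
  - exact: (quot ord_max ord0).
  - have [[[|[|]] // i2] Qi] := coords_ex Q; rewrite -eval_atXU in Qi.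
      by rewrite (_ : ord0 = Ordinal i2) //; apply: val_inj.
    by move: Qi; rewrite (_ : Ordinal i2 = ord_max) ?Q1 ?eqxx //; apply: val_inj.
apply: (chart ord0 ord_max G' H') => //.
- by move=> P XP; apply: (line_map1 GH XP).
- exact: (quot ord0 ord_max).
Qed.

End FiniteMap.

(** * Prime avoidance over the ground field *)

Lemma minor_neq0 (F : fieldType) m k r (M : 'M[F]_(m, k)) : \rank M = r ->
  exists (f : 'I_r -> 'I_m) (g : 'I_r -> 'I_k), \det (mxsub f g M) != 0.
Proof.
have rows m' k' r' (A : 'M[F]_(m', k')) : \rank A = r' ->
    exists f : 'I_r' -> 'I_m', row_free (rowsub f A).
  by move=> <-; exists (maxrankfun A); apply: maxrowsub_free.
move=> rk; have [f fM] := rows _ _ _ M rk.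
have [|g gM] := rows _ _ r (rowsub f M)^T; first by rewrite mxrank_tr; apply/eqP.
exists f, g; rewrite -det_tr -unitfE -unitmxE -row_free_unit.
by congr (row_free _ = true): gM; apply/matrixP => i j; rewrite !mxE.
Qed.

Lemma minor_rank (F : fieldType) m k r (M : 'M[F]_(m, k))
    (f : 'I_r -> 'I_m) (g : 'I_r -> 'I_k) : \det (mxsub f g M) != 0 -> (r <= \rank M)%N.
Proof.
rewrite -unitfE -unitmxE -row_free_unit => /eqP <-.
have -> : mxsub f g M = rowsub f 1%:M *m M *m colsub g 1%:M.
  by rewrite -rowsubE mulmx_colsub mulmx1; apply/matrixP => i j; rewrite !mxE.
exact: leq_trans (mxrankM_maxl _ _) (mxrankM_maxr _ _).
Qed.

Section Forms.
Variables (K : fieldType) (L : closedFieldType) (iota : {rmorphism K -> L}).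
Variables (n : nat).
Implicit Types (P Q : proj L n) (f g : {mpoly K[n.+1]}).

Definition ev f P : L := eval_at (map_mpoly iota f) P.

Lemma evM f g P : ev (f * g) P = ev f P * ev g P.
Proof. by rewrite /ev rmorphM eval_atM. Qed.
Lemma evD f g P : ev (f + g) P = ev f P + ev g P.
Proof. by rewrite /ev rmorphD eval_atD. Qed.
Lemma evZ c f P : ev (c *: f) P = iota c * ev f P.
Proof. by rewrite /ev map_mpolyZ eval_atZ. Qed.
Lemma evX f k P : ev (f ^+ k) P = ev f P ^+ k.
Proof. by rewrite /ev rmorphXn eval_atX. Qed.
Lemma ev0 P : ev 0 P = 0.
Proof. by rewrite /ev rmorph0 eval_at0. Qed.
Lemma ev1 P : ev 1 P = 1.
Proof. by rewrite /ev rmorph1 eval_at1. Qed.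
Lemma evXU i P : ev 'X_i P = coords P ord0 i.
Proof. by rewrite /ev map_mpolyXU eval_atXU. Qed.

(** [Q] lies in the closure of [P] for the topology of closed sets over [K]. *)
Definition specializes P Q :=
  forall d f, f \is d.-homog -> ev f P = 0 -> ev f Q = 0.

Lemma separating_form (l : seq (proj L n)) Q :
  (forall P, P \in l -> ~ specializes P Q) ->
  exists d u, [/\ u \is d.-homog, ev u Q != 0 & forall P, P \in l -> ev u P = 0].
Proof.
elim: l => [|P l IH] h.
  by exists 0%N, 1; rewrite ev1 oner_neq0 dhomog1.
have [|d [u [ud uQ ul]]] := IH; first by move=> R Rl; apply: h; rewrite inE Rl orbT.
have [e [w [we wP wQ]]] : exists e w, [/\ w \is e.-homog, ev w P = 0 & ev w Q != 0].
  apply: contrapT => nw; apply: (h P); first by rewrite mem_head.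
  move=> e w we wP; apply/eqP; apply: contrapT => /negP wQ; apply: nw.
  by exists e, w.
exists (d + e)%N, (u * w); split; first exact: dhomogM.
  by rewrite evM mulf_neq0.
by move=> R; rewrite inE evM => /orP[/eqP->|/ul->]; rewrite ?wP ?mulr0 ?mul0r.
Qed.

(** Prime avoidance for finitely many points.  If an object good at [l] must be
    improved at [P0] and no form separates [P0] from [l], then some point of [l]
    specializes to [P0] and can be dropped. *)
Lemma avoidance (T : Type) (good : T -> proj L n -> Prop) (l0 : seq (proj L n)) (a0 : T) :
  (forall a P Q, P \in l0 -> Q \in l0 -> specializes P Q -> good a Q -> good a P) ->
  (forall a b d u, u \is d.-homog -> exists c, forall P, P \in l0 ->
     (good a P -> ev u P = 0 -> good c P) /\
     (~ good a P -> good b P -> ev u P != 0 -> good c P)) ->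
  (forall P, P \in l0 -> exists a, good a P) ->
  exists a, forall P, P \in l0 -> good a P.
Proof.
move=> mono comb ex.
suff H N : forall l, (size l <= N)%N -> {subset l <= l0} -> exists a, forall P, P \in l -> good a P.
  exact: (H _ l0 (leqnn _)).
elim: N => [|N IH] [|P0 l] // lN ll0; try by exists a0.
have P00 : P0 \in l0 by apply: ll0; rewrite mem_head.
have ll0' : {subset l <= l0} by move=> P Pl; apply: ll0; rewrite inE Pl orbT.
have [a ha] := IH l lN ll0'.
have [aP0|naP0] := pselect (good a P0).
  by exists a => P; rewrite inE => /orP[/eqP->|/ha].
have [[P Pl sp]|nsp] := pselect (exists2 P, P \in l & specializes P P0).
  have [||b hb] := IH (P0 :: rem P l).
  - rewrite /= size_rem //.
    by move: Pl lN; clear; case: l => [|x l _]; [rewrite in_nil|rewrite /= ltnS].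
  - move=> Q; rewrite inE => /orP[/eqP->//|/mem_rem]; exact: ll0'.
  have bP0 : good b P0 by apply: hb; rewrite mem_head.
  exists b => Q; rewrite inE => /orP[/eqP->//|Ql].
  have [->|QP] := eqVneq Q P; first exact: mono (ll0' _ Pl) P00 sp bP0.
  have := perm_mem (perm_to_rem Pl) Q; rewrite Ql inE (negPf QP) /= => Qr.
  by apply: hb; rewrite inE -Qr orbT.
have [|d [u [ud uP0 ul]]] := @separating_form l P0.
  by move=> P Pl sp; apply: nsp; exists P.
have [b bP0] := ex P0 P00; have [c hc] := comb a b d u ud.
exists c => P; rewrite inE => /orP[/eqP->|Pl].
  by have [_ h] := hc P0 P00; apply: h.
by have [h _] := hc P (ll0' P Pl); apply: h; [apply: ha|apply: ul].
Qed.

(** Two forms are combined after raising them to powers of equal degree. *)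
Lemma avoid_forms (J : {mpoly K[n.+1]} -> Prop) (l : seq (proj L n)) : J 0 ->
  (forall f g, J f -> J g -> J (f + g)) -> (forall f g, J f -> J (g * f)) ->
  (forall P, P \in l -> exists d f, [/\ (0 < d)%N, f \is d.-homog, J f & ev f P != 0]) ->
  exists d f, [/\ (0 < d)%N, f \is d.-homog, J f & forall P, P \in l -> ev f P != 0].
Proof.
move=> J0 JD JM ex.
pose T := {f | exists d, [/\ (0 < d)%N, f \is d.-homog & J f]}.
pose mk f (h : exists d, [/\ (0 < d)%N, f \is d.-homog & J f]) : T := exist _ f h.
have T0 : T by exists 0; exists 1%N; split; rewrite ?rpred0.
have [||P /ex[d [f [d0 fd Jf fP]]]|[f [d [d0 fd Jf]]] h] :=
   @avoidance T (fun x P => ev (sval x) P != 0) l T0.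
- move=> [a [d [d0 ad Ja]]] P Q _ _ sp /=; apply: contraNneq => aP; apply/eqP.
  exact: sp ad aP.
- move=> [a [d [d0 ad Ja]]] [b [e [e0 be Jb]]] k u uk /=.
  have hc : exists d', [/\ (0 < d')%N, a ^+ (e + k) + (b * u) ^+ d \is d'.-homog &
      J (a ^+ (e + k) + (b * u) ^+ d)].
    exists (d * (e + k))%N; split; first by rewrite muln_gt0 d0 addn_gt0 e0.
      by rewrite rpredD ?dhomogMn // [(d * _)%N]mulnC dhomogMn // dhomogM.
    apply: JD; first by rewrite -(prednK (_ : 0 < e + k)%N) ?addn_gt0 ?e0 // exprSr; apply: JM.
    by rewrite -(prednK d0) exprSr mulrA mulrAC; apply: JM.
  exists (mk _ hc) => P _ /=; rewrite evD !evX evM; split=> [aP ->|/negP/negPn/eqP-> bP uP].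
    by rewrite mulr0 [X in _ + X]expr0n eqn0Ngt d0 addr0 expf_neq0.
  by rewrite expr0n addn_eq0 eqn0Ngt e0 /= add0r expf_neq0 // mulf_neq0.
- by exists (mk f (ex_intro _ d (And3 d0 fd Jf))).
- by exists d, f.
Qed.

End Forms.

(** * Construction of the map *)

Lemma mderiv_exp (R : comNzRingType) n (f : {mpoly R[n]}) i k :
  (f ^+ k)^`M(i) = k%:R *: (f ^+ k.-1 * f^`M(i)).
Proof.
elim: k => [|k IH]; first by rewrite expr0 -mpolyC1 mderivC scale0r.
rewrite exprS mderivM IH; case: k {IH} => [|k] /=.
  by rewrite scale0r mulr0 addr0 expr0 mulr1 mul1r scale1r.
rewrite -scalerAr mulrA -exprS [in RHS]mulrSr scalerDl scale1r addrC.
by rewrite [f^`M(i) * _]mulrC.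
Qed.

Section Construction.
Variables (K : fieldType) (p : nat) (pcharK : p \in [pchar K]).
Variables (L : closedFieldType) (iota : {rmorphism K -> L}).
Variables (n : nat) (F : seq {mpoly K[n.+1]}) (curveF : curve iota F).
Local Notation X := (points iota F).
Local Notation ev := (ev iota).
Implicit Types (A B f g : {mpoly K[n.+1]}) (P Q : proj L n).

Let p_gt1 : (1 < p)%N. Proof. exact: prime_gt1 (pcharf_prime pcharK). Qed.
Let p_gt0 : (0 < p)%N. Proof. exact: ltnW. Qed.

Let natp_eq0 k : (p * k)%:R = 0 :> K.
Proof. by rewrite natrM pcharf0 // mul0r. Qed.

Let Fhomog f : f \in F -> f \is homog mdeg. Proof. by case: curveF => h _ _ _; apply: h. Qed.
Let Xirr : irreducible X. Proof. by case: curveF. Qed.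
Let Xdim : has_dim X 1. Proof. by case: curveF. Qed.
Let rkJ P : X P -> (\rank (jacobian iota F P) + 1 = n)%N.
Proof. by case: curveF => _ _ _; apply. Qed.
Let Xcl : zariski_closed X. Proof. exact: points_closed. Qed.

Let gradK f P := grad (map_mpoly iota f) P.

(** The differential of [f] vanishes along the tangent line at [P]. *)
Definition degenerate f P := (gradK f P <= jacobian iota F P)%MS.

Lemma gradE f P k : gradK f P ord0 k = ev f^`M(k) P.
Proof. by rewrite mxE /ev map_mderiv. Qed.

Lemma grad_pow f k P : gradK (f ^+ (p * k)) P = 0.
Proof. by apply/rowP => i; rewrite gradE mxE mderiv_exp natp_eq0 scale0r ev0. Qed.

Let add_entry (u w : 'rV[L]_n.+1) i : (u + w) ord0 i = u ord0 i + w ord0 i.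
Proof. by rewrite mxE. Qed.

Let lin_entry (x y : L) (u w : 'rV[L]_n.+1) i :
  (x *: u + y *: w) ord0 i = x * u ord0 i + y * w ord0 i.
Proof. by rewrite !mxE. Qed.

Lemma gradM A B P : gradK (A * B) P = ev A P *: gradK B P + ev B P *: gradK A P.
Proof.
apply/rowP => i; rewrite lin_entry; apply: (etrans (gradE _ _ _)); rewrite mderivM evD 2!evM addrC.
by congr (_ + _); rewrite 1?[ev A^`M(i) P * _]mulrC; congr (_ * _); apply/esym/gradE.
Qed.

Lemma gradD A B P : gradK (A + B) P = gradK A P + gradK B P.
Proof.
apply/rowP => i; rewrite add_entry; apply: (etrans (gradE _ _ _)).
by rewrite mderivD evD; congr (_ + _); apply/esym/gradE.
Qed.

Lemma gradM_cst A B P : gradK B P = 0 -> gradK (A * B) P = ev B P *: gradK A P.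
Proof. by move=> B0; rewrite gradM B0 scaler0 add0r. Qed.

Lemma degenerateZ f g P c : c != 0 -> gradK f P = c *: gradK g P ->
  degenerate f P = degenerate g P.
Proof. by move=> c0; rewrite /degenerate => ->; rewrite (eqmx_scale _ c0). Qed.

Definition minor A (f : 'I_n -> 'I_(size F + 1)) (g : 'I_n -> 'I_n.+1) : {mpoly K[n.+1]} :=
  \det (mxsub f g (col_mx (\matrix_(i < size F, j < n.+1) (F`_i)^`M(j)) (\row_j A^`M(j)))).

Lemma minor_homog d A (r : 'I_n -> 'I_(size F + 1)) (s : 'I_n -> 'I_n.+1) :
  A \is d.-homog -> exists e, minor A r s \is e.-homog.
Proof.
move=> Ad; have /choice[dF hF] (i : 'I_(size F)) : exists e, F`_i \is e.-homog.
  by have /homogP[e h] := Fhomog (mem_nth 0 (ltn_ord i)); exists e.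
pose e (i : 'I_(size F + 1)) := if split i is inl k then (dF k).-1 else d.-1.
exists (\sum_i e (r i))%N; apply: dhomog_det_rows => i j.
by rewrite !mxE /e; case: split => k; rewrite !mxE; apply: dhomog_mderiv.
Qed.

Lemma minor_ev A (r : 'I_n -> 'I_(size F + 1)) (s : 'I_n -> 'I_n.+1) P : ev (minor A r s) P
  = \det (mxsub r s (col_mx (jacobian iota F P) (gradK A P))).
Proof.
rewrite /ev /eval_at -!det_map_mx; congr (\det _); apply/matrixP => i j.
by rewrite !mxE; case: split => k; rewrite !mxE /= ?map_mderiv.
Qed.

(** The Jacobian matrix has rank [n - 1], so a further row outside its row space gives
    a nonzero minor of size [n]. *)
Lemma nondegenerateP A P : X P ->
  reflect (exists r s, ev (minor A r s) P != 0) (~~ degenerate A P).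
Proof.
move=> XP; apply: (iffP idP) => [/(rank_transversal (rkJ XP))/minor_neq0[f [g h]]|[f [g]]].
  by exists f, g; rewrite minor_ev.
rewrite minor_ev => /minor_rank h; apply/negP => deg; move: h.
by rewrite -addsmxE (addsmx_idPl deg) -{1}(rkJ XP) addn1 ltnn.
Qed.

Lemma nondegenerate_specializes d A P Q : A \is d.-homog -> X P -> X Q ->
  specializes iota P Q -> ~~ degenerate A Q -> ~~ degenerate A P.
Proof.
move=> Ad XP XQ sp /(nondegenerateP _ XQ)[f [g h]]; apply/(nondegenerateP _ XP).
exists f, g; apply: contraNneq h => h; have [e he] := minor_homog f g Ad.
by apply/eqP; apply: sp he h.
Qed.

(** As [N] is zero in [K], the differentials of the x_i * x_j ^ (N - 1) span the
    linear forms vanishing at [P], and one of these is transversal to the curve. *)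
Lemma nondegenerate_at_point N P : X P -> (1 < N)%N -> N%:R = 0 :> K ->
  exists2 A, A \is N.-homog & ~~ degenerate A P.
Proof.
move=> XP N1 N0; have [j Pj] := coords_ex P; set v := coords P ord0 in Pj.
have [l lJ lv] := tangent_form (rkJ XP) (coords_neq0 P).
pose A i : {mpoly K[n.+1]} := 'X_i * 'X_j ^+ N.-1.
have Ah i : A i \is N.-homog.
  have := dhomogM (dhomogXU K i) (dhomogMn N.-1 (dhomogXU K j)).
  by rewrite mul1n add1n prednK // ltnW.
apply: contrapT => nA; move/negP: lJ; apply.
have all i : degenerate (A i) P.
  by apply: contrapT => /negP h; apply: nA; exists (A i).
have N1m : (N.-1)%:R = -1 :> K.
  apply/eqP; rewrite -addr_eq0 -[1 in X in X == _]/(1%:R) -natrD addn1 prednK ?N0 //.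
  exact: ltnW.
have c0 : v j ^+ N.-1 != 0 by rewrite expf_neq0.
rewrite -(eqmx_scale _ c0).
have -> : v j ^+ N.-1 *: l = \sum_i l ord0 i *: gradK (A i) P.
  apply/rowP => k; rewrite summxE mxE.
  have lv0 : \sum_i l ord0 i * v i = 0.
    move/matrixP/(_ ord0 ord0): lv; rewrite !mxE => e; rewrite -[RHS]e.
    by apply: eq_bigr => i _; rewrite mxE.
  have gA i : gradK (A i) P ord0 k = (i == k)%:R * v j ^+ N.-1 - v i * v j ^+ N.-2 * (j == k)%:R.
    have evb (b : bool) : ev b%:R P = b%:R by case: b; rewrite ?ev1 ?ev0.
    rewrite gradE mderivM evD !evM mderiv_exp N1m evZ rmorphN1 evM !mderivXU !evX !evb.
    by rewrite !evXU -/v; ring.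
  transitivity (v j ^+ N.-1 * (\sum_i l ord0 i * (i == k)%:R)
     - v j ^+ N.-2 * (j == k)%:R * (\sum_i l ord0 i * v i)).
    rewrite lv0 mulr0 subr0 (bigD1 k) //= eqxx mulr1 big1 ?addr0 // => i /negPf->.
    by rewrite mulr0.
  rewrite !mulr_sumr -sumrB; apply: eq_bigr => i _.
  by rewrite [RHS]mxE gA; ring.
apply: summx_sub => i _; apply: scalemx_sub; exact: all.
Qed.

(** Prime avoidance applies to differentials too: a combination of [A] and [B] whose
    coefficients are [p]-th powers has the corresponding combination of
    differentials.  Powers of [a1] equalize the degrees. *)
Lemma exists_nondegenerate a1 delta (l : seq (proj L n)) :
  (forall P, P \in l -> X P) -> (0 < delta)%N -> a1 \is delta.-homog ->
  (forall P, P \in l -> ev a1 P != 0) ->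
  exists k A, A \is (p * (delta * k)).-homog /\ forall P, P \in l -> ~~ degenerate A P.
Proof.
move=> lX d0 a1d a1l.
pose T := {A : {mpoly K[n.+1]} | exists k, A \is (p * (delta * k)).-homog}.
pose mk A (h : exists k, A \is (p * (delta * k)).-homog) : T := exist _ A h.
have T0 : T by exists 0; exists 0%N; rewrite rpred0.
have [||P Pl|[A [k Ak]] h] := @avoidance K L iota n T (fun x P => ~~ degenerate (sval x) P) l T0.
- move=> [A [k Ak]] P Q Pl Ql sp /=; apply: nondegenerate_specializes Ak _ _ sp; exact: lX.
- move=> [A [k Ak]] [B [e Be]] m u um /=.
  pose C := A * a1 ^+ (p * (e + m)) + B * (u ^+ (p * delta) * a1 ^+ (p * k)).
  have hC : exists k', C \is (p * (delta * k')).-homog.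
    exists (k + (e + m))%N; rewrite rpredD //.
      have := dhomogM Ak (dhomogMn (p * (e + m)) a1d).
      suff -> : (p * (delta * k) + delta * (p * (e + m)) = p * (delta * (k + (e + m))))%N by [].
      by ring.
    have := dhomogM Be (dhomogM (dhomogMn (p * delta) um) (dhomogMn (p * k) a1d)).
    suff -> : (p * (delta * e) + (m * (p * delta) + delta * (p * k))
               = p * (delta * (k + (e + m))))%N by [].
    by ring.
  have gC P : gradK C P = ev a1 P ^+ (p * (e + m)) *: gradK A P
      + (ev u P ^+ (p * delta) * ev a1 P ^+ (p * k)) *: gradK B P.
    have g0 : gradK (u ^+ (p * delta) * a1 ^+ (p * k)) P = 0.
      by rewrite (gradM_cst _ (grad_pow a1 k P)) (grad_pow u delta) scaler0.
    rewrite /C gradD (gradM_cst A (grad_pow a1 _ P)) (gradM_cst B g0).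
    by rewrite -!evX -evM.
  exists (mk C hC) => P Pl /=; have a0 := a1l P Pl; split=> [goodA uP|/negP/negPn degA goodB uP].
    have e0 : (0 < p * delta)%N by rewrite muln_gt0 p_gt0.
    rewrite (@degenerateZ C A P (ev a1 P ^+ (p * (e + m)))) ?expf_neq0 // gC uP.
    by rewrite expr0n eqn0Ngt e0 mul0r scale0r addr0.
  apply: contra goodB; rewrite /degenerate gC => degC.
  have c0 : ev u P ^+ (p * delta) * ev a1 P ^+ (p * k) != 0 by rewrite mulf_neq0 ?expf_neq0.
  rewrite -(eqmx_scale _ c0); set x := _ *: gradK A P in degC; set y := (X in (X <= _)%MS).
  have -> : y = x + y - x by rewrite addrC addKr.
  by apply: addmx_sub => //; rewrite eqmx_opp; apply: scalemx_sub.
- have [|A Ah AP] := @nondegenerate_at_point (p * delta) P (lX P Pl) _ (natp_eq0 delta).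
    by rewrite (leq_trans p_gt1) // leq_pmulr.
  have hA : exists k, A \is (p * (delta * k)).-homog by exists 1%N; rewrite muln1.
  by exists (mk A hA).
- by exists k, A.
Qed.

Lemma form_avoiding_points (l : seq (proj L n)) : exists d a,
  [/\ (0 < d)%N, a \is d.-homog & forall P, P \in l -> ev a P != 0].
Proof.
have [||||d [a [d0 ad _ al]]] := @avoid_forms K L iota n (fun=> True) l => //.
  move=> P _; have [j Pj] := coords_ex P; exists 1%N, 'X_j.
  by rewrite evXU dhomogXU.
by exists d, a.
Qed.

(** First [A] is nondegenerate at [T], then [C] vanishes where [A] is degenerate and
    at [S] but not at [T], and finally [a] avoids the finitely many zeros of [C] on
    the curve.  After each step the degrees are equalized by taking powers of [C] and
    [a] and multiplying [A] with [p]-th powers, which do not affect its degeneracy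
    away from their zeros. *)
Lemma construct_forms (S T : seq (proj L n)) :
  (forall P, P \in S -> X P) -> (forall P, P \in T -> X P) ->
  (0 < size T)%N ->
  (forall P Q, P \in S -> Q \in T -> ~ specializes iota P Q) ->
  exists m A C a, [/\ [/\ (0 < m)%N, A \is (p * m).-homog, C \is m.-homog & a \is m.-homog],
    forall P, X P -> ev C P != 0 -> ~~ degenerate A P,
    forall P, X P -> ev C P = 0 -> ev a P != 0,
    forall P, P \in S -> ev C P = 0 &
    forall P, P \in T -> ev C P != 0].
Proof.
move=> SX TX T0 ST.
have [delta [a1 [d0 a1d a1T]]] := form_avoiding_points T.
have [k [A [Ah AT]]] := exists_nondegenerate TX d0 a1d a1T.
pose J f := forall P, X P -> degenerate A P \/ ev a1 P = 0 \/ P \in S -> ev f P = 0.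
have [||||gamma [c [g0 cg Jc cT]]] := @avoid_forms K L iota n J T.
- by move=> P _ _; rewrite ev0.
- by move=> f g Jf Jg P XP h; rewrite evD Jf ?Jg ?addr0.
- by move=> f g Jf P XP h; rewrite evM Jf ?mulr0.
- move=> P PT; have XP := TX P PT.
  have [r [s rs]] := nondegenerateP A XP (AT P PT).
  have [e1 he1] := minor_homog r s Ah.
  have [|e2 [u [ue uP uS]]] := @separating_form K L iota n S P; first by move=> Q QS; apply: ST.
  exists (delta + (e1 + e2))%N, (a1 * (minor A r s * u)); split.
  + by rewrite addn_gt0 d0.
  + by apply: dhomogM => //; apply: dhomogM.
  + move=> Q XQ; rewrite !evM => -[deg|[->|/uS->]]; rewrite ?mul0r ?mulr0 //.
    rewrite [ev (minor _ _ _) Q](_ : _ = 0) ?mul0r ?mulr0 //.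
    apply/eqP; apply: contrapT => /negP h.
    have /negP := introT (nondegenerateP A XQ) (ex_intro _ r (ex_intro _ s h)).
    exact.
  + by rewrite 2!evM !mulf_neq0 ?a1T.
have k0 : (0 < k)%N.
  rewrite lt0n; apply/eqP => k0; case: T T0 AT {TX ST a1T cT} => // P T _ /(_ P (mem_head _ _)).
  rewrite k0 !muln0 in Ah; rewrite (dhomog0_const Ah) => /negP; apply.
  rewrite /degenerate [gradK _ _](_ : _ = 0) ?sub0mx //.
  by apply/rowP => i; rewrite gradE mderivC ev0 mxE.
pose A1 := A * a1 ^+ (p * (gamma.-1 * k)); pose C1 := c ^+ (delta * k).
pose m1 := (gamma * (delta * k))%N.
have m10 : (0 < m1)%N by rewrite !muln_gt0 g0 d0.
have A1h : A1 \is (p * m1).-homog.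
  have := dhomogM Ah (dhomogMn (p * (gamma.-1 * k)) a1d).
  suff -> : (p * (delta * k) + delta * (p * (gamma.-1 * k)) = p * m1)%N by [].
  by rewrite /m1 -{2}(prednK g0); ring.
have C1h : C1 \is m1.-homog by apply: dhomogMn.
have C1E P : (ev C1 P == 0) = (ev c P == 0).
  by rewrite /C1 evX expf_eq0 muln_gt0 d0 k0.
have A1good P : X P -> ev C1 P != 0 -> ~~ degenerate A1 P.
  move=> XP; rewrite C1E => cP.
  have a1P : ev a1 P != 0 by apply: contraNneq cP => h; apply/eqP/Jc => //; right; left.
  rewrite (@degenerateZ A1 A P (ev a1 P ^+ (p * (gamma.-1 * k)))) ?expf_neq0 //.
    by apply: contraNN cP => h; apply/eqP/Jc => //; left.
  by rewrite /A1 (gradM_cst _ (grad_pow _ _ _)) evX.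
have [|r hr] := curve_zeros_finite Xcl Xirr Xdim (dhomog_map iota C1h).
  case: T T0 TX cT {ST a1T AT} => // P T _ TX cT.
  by exists P; [apply: TX|rewrite -/(ev C1 P) C1E cT]; rewrite ?mem_head.
have [da [a [da0 ah ar]]] := form_avoiding_points r.
exists (m1 * da)%N, (A1 * C1 ^+ (p * da.-1)), (C1 ^+ da), (a ^+ m1); split.
- split; [by rewrite muln_gt0 m10| |exact: dhomogMn|by rewrite mulnC; apply: dhomogMn].
  have := dhomogM A1h (dhomogMn (p * da.-1) C1h).
  suff -> : (p * m1 + m1 * (p * da.-1) = p * (m1 * da))%N by [].
  by rewrite -{2}(prednK da0); ring.
- move=> P XP; rewrite evX expf_eq0 da0 /= => CP.
  rewrite (@degenerateZ _ A1 P (ev C1 P ^+ (p * da.-1))) ?expf_neq0 //; first exact: A1good.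
  by rewrite (gradM_cst _ (grad_pow _ _ _)) evX.
- move=> P XP /eqP; rewrite evX expf_eq0 da0 /= => /eqP CP.
  by rewrite evX expf_neq0 // ar // hr.
- move=> P PS; apply/eqP; rewrite evX expf_eq0 da0 C1E /=.
  by apply/eqP/Jc; [exact: SX|right; right].
- by move=> P PT; rewrite evX expf_neq0 // C1E cT.
Qed.

End Construction.

(** * Maps branched over one point *)

Section Main.
Variables (K : fieldType) (p : nat) (pcharK : p \in [pchar K]).
Variables (L : closedFieldType) (iota : {rmorphism K -> L}).
Variables (n : nat) (F : seq {mpoly K[n.+1]}) (curveF : curve iota F).
Local Notation X := (points iota F).
Local Notation ev := (ev iota).
Implicit Types (f g : {mpoly K[n.+1]}) (P Q : proj L n).

Let Fhomog f : f \in F -> f \is homog mdeg. Proof. by case: curveF => h _ _ _; apply: h. Qed.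
Let Xirr : irreducible X. Proof. by case: curveF. Qed.
Let Xdim : has_dim X 1. Proof. by case: curveF. Qed.

(** With [A], [C], [a] from the preceding construction take the map
    [A * C ^ p + a ^ (2 p) : C ^ (2 p)].  Off the zeros of [C] its differential is a
    multiple of that of [A], since everything else is a [p]-th power; at a zero of
    [C] only the second coordinate vanishes, to an order divisible by 2 p. *)
Lemma map_branched_at_infinity (S T : seq (proj L n)) :
  (forall P, P \in S -> X P) -> (forall P, P \in T -> X P) ->
  (0 < size S)%N -> (0 < size T)%N ->
  (forall P Q, P \in S -> Q \in T -> ~ specializes iota P Q) ->
  exists phi : proj L n -> proj L 1,
    [/\ finite_morphism iota X (@projT L 1) phi,
        forall R, branch X phi R <-> R = infty L,
        forall P, P \in S -> ramified X phi P &
        forall P, P \in T -> phi P <> infty L].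
Proof.
move=> SX TX S0 T0 ST.
have [m [A [C [a [[m0 Ah Ch ah] Agood aC CS CT]]]]] :=
  construct_forms pcharK curveF SX TX T0 ST.
have p1 : (1 < p)%N := prime_gt1 (pcharf_prime pcharK).
pose G := A * C ^+ (p * 1) + a ^+ (p * 2); pose H := C ^+ (p * 2).
pose D := (m * (p * 2))%N.
have D0 : (0 < D)%N by rewrite !muln_gt0 m0 (ltnW p1).
have HD : H \is D.-homog by apply: dhomogMn.
have GD : G \is D.-homog.
  rewrite rpredD ?dhomogMn //; have := dhomogM Ah (dhomogMn (p * 1) Ch).
  by suff -> : (p * m + m * (p * 1) = D)%N by []; rewrite /D; ring.
have HE P : (ev H P == 0) = (ev C P == 0).
  by rewrite /H evX expf_eq0 muln_gt0 (ltnW p1).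
have GH P : X P -> eval_at (map_mpoly iota G) P = 0 -> eval_at (map_mpoly iota H) P = 0 -> False.
  move=> XP /eqP GP /eqP; rewrite -/(ev H P) HE => /eqP CP.
  move: GP; rewrite -/(ev G P) /G evD evM !evX CP [0 ^+ _]expr0n muln1 eqn0Ngt (ltnW p1).
  by rewrite mulr0 add0r expf_eq0 (negPf (aC P XP CP)) andbF.
have GD' := dhomog_map iota GD; have HD' := dhomog_map iota HD.
have X2 := curve_two_points Xdim.
pose phi := line_map (map_mpoly iota G) (map_mpoly iota H).
have inf P : X P -> phi P = infty L <-> ev C P = 0.
  move=> XP; rewrite (line_map_infty GH XP); split=> /eqP h; apply/eqP; first by rewrite -HE.
  by rewrite -/(ev H P) HE.
have ram P : X P -> ev C P = 0 -> ramified X phi P.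
  move=> XP CP; have [q [q1 qP gen]] := curve_parameter curveF XP.
  apply: (line_map_ramified GD' GH Xirr XP (C := map_mpoly iota C)
    (N := (p * 2)%N) _ _ _ _ CP _ q1 qP gen).
  - by rewrite /D mulnK ?muln_gt0 ?(ltnW p1) //; apply: dhomog_map.
  - by rewrite /H rmorphXn.
  - by rewrite (leq_trans p1) // leq_pmulr.
  - exact: dvdn_mull.
  - by case: T T0 TX CT {ST} => // Q T _ TX CT; exists Q; [apply: TX|apply: CT]; rewrite mem_head.
have unram P : X P -> ev C P != 0 -> ~ ramified X phi P.
  move=> XP CP; apply: (line_map_unramified GD' HD' GH Xirr X2 XP).
    by rewrite -/(ev H P) HE.
  apply: generates_transversal => //; [exact: fiber_form_homog|exact: fiber_form_eval|].
  apply: rank_transversal; first by case: curveF => _ _ _; apply.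
  have gradF : grad (fiber_form (map_mpoly iota G) (map_mpoly iota H) P) P
     = (ev H P * ev C P ^+ p) *: grad (map_mpoly iota A) P.
    have gH : grad (map_mpoly iota H) P = 0 by apply: (grad_pow pcharK).
    have gG : grad (map_mpoly iota G) P = ev C P ^+ p *: grad (map_mpoly iota A) P.
      by rewrite /G gradD gradM !(grad_pow pcharK) scaler0 add0r addr0 evX muln1.
    rewrite -scalerA -gG; have := gH; rewrite /ev.
    move: (map_mpoly iota G) (map_mpoly iota H) => g h /rowP gh; apply/rowP => k.
    rewrite !mxE /fiber_form mderivB !mderivZ eval_atB !eval_atZ.
    by have := gh k; rewrite !mxE => ->; rewrite mulr0 subr0.
  rewrite gradF; have c0 : ev H P * ev C P ^+ p != 0 by rewrite mulf_neq0 ?expf_neq0 // HE.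
  by rewrite (eqmx_scale _ c0); apply: Agood.
exists phi; split.
- exact: (line_map_finite_morphism curveF D0 GD HD GH).
- move=> R; split=> [[P [XP rP <-]]|->].
    by apply/inf => //; apply/eqP; apply: contrapT => /negP CP; apply: unram rP.
  have [s sS] : exists s, s \in S by case: S S0 {SX ST CS} => // s S _; exists s; rewrite mem_head.
  have Xs := SX s sS; have Cs := CS s sS.
  by exists s; split; [|apply: ram|apply/inf].
- by move=> P PS; apply: ram; [exact: SX|exact: CS].
- by move=> P PT /(inf P (TX P PT)) CP; have := CT P PT; rewrite CP eqxx.
Qed.

Hypothesis algL : algebraic_closure iota.

(** Closed points are not dense: if the minimal equations of all coordinates of
    [P] held on the curve, irreducibility would make the coordinates constant. *)
Lemma vanishing_form P : X P -> exists d f,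
  [/\ f \is d.-homog, ev f P = 0 & exists2 Q, X Q & ev f Q != 0].
Proof.
move=> XP; apply: contrapT => nf; have [j Pj] := coords_ex P.
have all0 d f : f \is d.-homog -> ev f P = 0 -> forall Q, X Q -> ev f Q = 0.
  move=> fd fP Q XQ; apply/eqP; apply: contrapT => /negP fQ; apply: nf.
  by exists d, f; split=> //; exists Q.
have /choice[r hr] i : exists r, forall Q, X Q -> coords Q ord0 i = r * coords Q ord0 j.
  have [q q0 qr] := algL (coords P ord0 i / coords P ord0 j).
  pose f : {mpoly K[n.+1]} := \sum_(k < size q) q`_k *: ('X_i ^+ k * 'X_j ^+ ((size q).-1 - k)).
  have kle (k : 'I_(size q)) : (k <= (size q).-1)%N.
    by rewrite -ltnS (leq_trans (ltn_ord k)) // leqSpred.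
  have fd : f \is (size q).-1.-homog.
    apply: rpred_sum => k _; apply: rpredZ.
    have := dhomogM (dhomogMn k (dhomogXU K i)) (dhomogMn ((size q).-1 - k) (dhomogXU K j)).
    by rewrite !mul1n subnKC.
  have fE Q : coords Q ord0 j != 0 -> ev f Q
      = coords Q ord0 j ^+ (size q).-1 * (map_poly iota q).[coords Q ord0 i / coords Q ord0 j].
    move=> Qj; rewrite horner_coef size_map_poly mulr_sumr /ev raddf_sum eval_at_sum.
    apply: eq_bigr => k _ /=; rewrite -/(ev _ _) evZ evM !evX !evXU coef_map /=.
    rewrite [RHS]mulrCA; congr (_ * _); rewrite exprMn exprVn.
    rewrite -[in RHS](subnKC (kle k)) exprD.
    by field; rewrite expf_neq0.
  have f0 := all0 _ f fd; rewrite fE // (eqP qr) mulr0 in f0.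
  have {}f0 := f0 erefl.
  have [rs ers] := closed_field_poly_normal (map_poly iota q).
  have lq0 : lead_coef (map_poly iota q) != 0 by rewrite lead_coef_eq0 map_poly_eq0.
  have prod0 Q : X Q -> eval_at ('X_j * \prod_(r <- rs) ('X_i - r *: 'X_j)) Q = 0.
    move=> XQ; rewrite eval_atM eval_atXU; have [->|Qj] := eqVneq (coords Q ord0 j) 0.
      by rewrite mul0r.
    apply/eqP; rewrite mulf_eq0 (negPf Qj) /=; move/eqP: (f0 Q XQ).
    rewrite fE // mulf_eq0 expf_eq0 (negPf Qj) andbF /= ers hornerZ mulf_eq0 (negPf lq0) /=.
    rewrite horner_prod eval_at_prod !prodf_seq_eq0; apply: sub_has => r /=.
    rewrite hornerXsubC subr_eq0 => /eqP e; rewrite eval_atB eval_atZ !eval_atXU -e.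
    by rewrite divfK // subrr.
  have lin (r : L) : ('X_i - r *: 'X_j : {mpoly L[n.+1]}) \is 1.-homog.
    by rewrite rpredB ?rpredZ ?dhomogXU.
  have {prod0}: forall Q, X Q -> eval_at (\prod_(r <- rs) ('X_i - r *: 'X_j)) Q = 0.
    have h := @dhomog_bigprod L n.+1 L rs xpredT (fun=> 1%N)
      (fun r => 'X_i - r *: 'X_j) (fun r _ => lin r).
    apply: (irr_cancel Xirr h (dhomogXU L j) XP); first by rewrite eval_atXU.
    by move=> Q XQ; rewrite mulrC -eval_atM prod0.
  elim: rs {ers} => [|r rs IH] h.
    by have := h P XP; rewrite big_nil eval_at1 => /eqP; rewrite oner_eq0.
  have h' := @dhomog_bigprod L n.+1 L rs xpredT (fun=> 1%N)
    (fun r => 'X_i - r *: 'X_j) (fun r _ => lin r).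
  have [|hr|//] := irr_mul Xirr (lin r) h'.
    by move=> Q XQ; have := h Q XQ; rewrite big_cons eval_atM.
  exists r => Q XQ; apply/eqP; rewrite -subr_eq0; have := hr Q XQ.
  by rewrite eval_atB eval_atZ !eval_atXU => ->.
have [Q1 [Q2 [XQ1 XQ2 []]]] := curve_two_points Xdim.
by apply: proj_eqP => i k; rewrite (hr i Q1) // (hr k Q2) // (hr k Q1) // (hr i Q2) //; ring.
Qed.

(** By irreducibility the product of the forms given by the preceding lemma is not
    zero on the curve. *)
Lemma avoiding_point (l : seq (proj L n)) : (forall P, P \in l -> X P) ->
  exists2 Q, X Q & forall P, P \in l -> exists d f,
    [/\ f \is d.-homog, ev f P = 0 & ev f Q != 0].
Proof.
move=> lX; suff [d [f [fd [Q XQ fQ] fl]]] : exists d f, [/\ f \is d.-homog,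
    exists2 Q, X Q & ev f Q != 0 & forall P, P \in l -> ev f P = 0].
  by exists Q => // P Pl; exists d, f; split=> //; apply: fl.
elim: l lX => [|P l IH] lX.
  have [Q [_ [XQ _ _]]] := curve_two_points Xdim.
  by exists 0%N, 1; split; [exact: dhomog1|exists Q; rewrite // ev1 oner_neq0|].
have [|d [f [fd [Q XQ fQ] fl]]] := IH; first by move=> R Rl; apply: lX; rewrite inE Rl orbT.
have [|e [g [ge gP [R XR gR]]]] := @vanishing_form P; first by apply: lX; rewrite mem_head.
exists (d + e)%N, (f * g); split; first exact: dhomogM.
  apply: contrapT => nQ.
  have fg P' : X P' -> eval_at (map_mpoly iota f) P' * eval_at (map_mpoly iota g) P' = 0.
    move=> XP'; apply/eqP; apply: contrapT => /negP h; apply: nQ; exists P' => //.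
    by rewrite evM.
  have [h|h] := irr_mul Xirr (dhomog_map iota fd) (dhomog_map iota ge) fg.
    by move/eqP: fQ; apply; apply: h.
  by move/eqP: gR; apply; apply: h.
by move=> R'; rewrite inE evM => /orP[/eqP->|/fl->]; rewrite ?gP ?mulr0 ?mul0r.
Qed.

End Main.

Theorem theorem1p2 (K : fieldType) (p : nat) (pcharK : p \in [pchar K])
    (perfK : perfect_field K)
    (L : closedFieldType) (iota : {rmorphism K -> L})
    (algL : algebraic_closure iota)
    (n : nat) (F : seq {mpoly K[n.+1]}) (curveF : curve iota F)
    (S T : {fset proj L n})
    (SC : forall P, P \in S -> points iota F P)
    (TC : forall P, P \in T -> points iota F P)
    (ST : forall P Q, P \in S -> Q \in T -> ~ conjugate iota Q P) :
  exists phi : proj L n -> proj L 1,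
    [/\ finite_morphism iota (points iota F) (@projT L 1) phi,
        forall Q, branch (points iota F) phi Q <-> Q = infty L,
        forall P, P \in S -> ramified (points iota F) phi P &
        forall P, P \in T -> phi P <> infty L].
Proof.
(* One extra point on either side makes the two finite sets nonempty. *)
have [t0 Xt0 ht0] := avoiding_point curveF algL (l := enum_fset S) SC.
have [|s0 Xs0 hs0] := avoiding_point curveF algL (l := t0 :: enum_fset T).
  by move=> P; rewrite inE => /orP[/eqP->|/TC].
have [|||phi [fin br ram T0]] := map_branched_at_infinity pcharK curveF
    (S := s0 :: enum_fset S) (T := t0 :: enum_fset T) _ _ isT isT.
- by move=> P; rewrite inE => /orP[/eqP->|/SC].
- by move=> P; rewrite inE => /orP[/eqP->|/TC].
- move=> P Q; rewrite inE => /orP[/eqP->|PS] QT sp.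
    have [d [f [fd fQ /eqP]]] := hs0 Q QT; apply.
    by apply: (conjugate_ideals fd (conjugate_of_ideals algL sp)).
  move: QT; rewrite inE => /orP[/eqP Q0|QT].
    have [d [f [fd fP /eqP]]] := ht0 P PS; apply; rewrite -Q0.
    exact: sp fd fP.
  exact: ST PS QT (conjugate_of_ideals algL sp).
exists phi; split=> // P PST; [apply: ram|apply: T0]; by rewrite inE [P \in _]PST orbT.
Qed.
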